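(* Let $\Gamma\subset\mathbb{R}^3$ be a continuous graph. Then the net total curvature $\mathrm{NTC}(\Gamma)\in(0,\infty]$ has the representation $$\mathrm{NTC}(\Gamma)=\frac12\int_{S^2}\mu(e)\,dA_{S^2}(e),$$ where, for almost all $e\in S^2$, the multiplicity $\mu(e)=\mu_\Gamma(e)$ is a positive half-integer (that is, a positive element of $\frac12\mathbb{Z}$) or $+\infty$, and, when it is not $+\infty$, it is given as the finite sum $$\mu_\Gamma(e)=\sum_q\mathrm{nlm}^+(e,q)$$ over the (finitely many) topological vertices of $\Gamma$ and critical points $q$ of $\langle e,\cdot\rangle$ along $\Gamma$.
   Context: A continuous graph $\Gamma\subset\mathbb{R}^3$ is the image under a continuous embedding of a connected finite graph with at least one edge (finitely many vertices and edges, edges being simple arcs whose endpoints are vertices). The degree $d(q)$ of a vertex is the number of edges ending at it (loops counted twice); a topological vertex is one of degree $\ne2$. Interior points of edges may be regarded as vertices of degree 2. Polygonal graphs: for a polygonal graph $P$ (edges straight segments) with vertices $q$, at which $T_1,\dots,T_{d}$ are the unit vectors pointing into the edges at $q$, put $\mathrm{ntc}(q)=\frac14\int_{S^2}[\sum_{i=1}^{d}\chi_i(e)]^+dA_{S^2}(e)$, where $\chi_i=-1$ on the hemisphere centered at $T_i$ and $+1$ on the opposite hemisphere, and $\mathrm{NTC}(P)=\sum_q\mathrm{ntc}(q)$. A polygonal graph $P$ is $\Gamma$-approximating if it is inscribed in $\Gamma$, its topological vertices are exactly those of $\Gamma$ with the same degrees, and the arcs of $P$ between two topological vertices correspond one-to-one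 to the edges of $\Gamma$ between those vertices (each edge of $\Gamma$ is replaced by a polygonal path through successive points of that edge; self-intersections of $P$ are disregarded). A refinement of $P$ is a $\Gamma$-approximating polygonal graph whose vertex set contains that of $P$. Define $\mathrm{NTC}(\Gamma)=\sup_P\mathrm{NTC}(P)\in[0,\infty]$ over all $\Gamma$-approximating polygonal graphs $P$. Critical points: $q\in\Gamma$ is critical relative to $e\in S^2$ if $q$ is a topological vertex or if $\langle e,\cdot\rangle$ is not monotone on any open interval of $\Gamma$ containing $q$. Net local maxima: a parameterization of the double of a graph (same vertices, two copies of each edge) is a mapping from a compact 1-manifold without boundary covering each of the doubled edges once, so that $d(q)$ points $q_1,\dots,q_{d(q)}$ lie over each vertex $q$. $\mathrm{nlm}(e,q)=\frac12[\mathrm{lmax}(e,q)-\mathrm{lmin}(e,q)]$, where $\mathrm{lmax}$, $\mathrm{lmin}$ are the numbers of local maxima and local minima of $\langle e,\cdot\rangle$ along the parameterization among $q_1,\dots,q_{d(q)}$ (an interior point of an edge counts as a vertex of degree 2). This does not depend on the parameterization. $\mathrm{nlm}^+=\max(\mathrm{nlm},0)$. Multiplicity: for polygonal $P$, $\mu_P(e)=\sum_q\mathrm{nlm}_P^+(e,q)$ over the vertices $q$ of $P$ (defined for a.a. $e$). For continuous $\Gamma$ and $e\in S^2$, $\mu_\Gamma(e)=\lim_{k\to\infty}\mu_{P_k}(e)\in[0,\infty]$, where $P_k$ is a sequence of $\Gamma$-approximating polygonal graphs such that $\mathrm{NTC}(P_k)\to\mathrm{NTC}(\Gamma)$, each $P_k$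 refines $P_{k-1}$, the arc of $\Gamma$ corresponding to each edge of $P_k$ has diameter $\le1/k$, and $P_k$ is obtained from a $\Gamma$-approximating polygonal graph $\widehat P_k$ by adding as vertices, for each edge of $\widehat P_k$, points of the corresponding arc of $\Gamma$ at which $\langle e,\cdot\rangle$ attains its maximum and minimum over that (closed) arc. The limit exists and is independent of the choice of such a sequence. *)

(* Defs.v *)
From HB Require Import structures.
From mathcomp Require Import all_boot all_order all_algebra.
From mathcomp Require Import all_classical all_reals all_analysis.
From mathcomp Require Import measurable_realfun.
Set Implicit Arguments.
Unset Strict Implicit.
Unset Printing Implicit Defensive.
Import Order.TTheory GRing.Theory Num.Theory.
Import numFieldNormedType.Exports.
Local Open Scope classical_set_scope.
Local Open Scope ring_scope.

(* Carries the product topology and the product (Borel) sigma-algebra. *)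
Notation R3 R := (R * R * R)%type.

Section Sphere.
Context {R : realType}.
Implicit Types u v e : R3 R.

Definition dot u v : R := u.1.1 * v.1.1 + u.1.2 * v.1.2 + u.2 * v.2.

(* The Euclidean norm: the library norm `|u| on a product is the max norm. *)
Definition enorm u : R := Num.sqrt (dot u u).

Definition S2 : set (R3 R) := [set e | enorm e = 1].

(* Cylindrical coordinates p = (theta, z) on the sphere. They are injective up
   to null sets and the area element |d_theta x d_z| dtheta dz is dtheta dz. *)
Definition cyl (p : R * R) : R3 R :=
  (Num.sqrt (1 - p.2 ^+ 2) * cos p.1, Num.sqrt (1 - p.2 ^+ 2) * sin p.1, p.2).

Definition cyl_domain : set (R * R) := `[0, 2 * pi] `*` `[-1, 1].

Lemma measurable_cyl_domain : measurable cyl_domain.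
Proof. by apply: measurableX; exact: measurable_itv. Qed.

Lemma measurable_cyl : measurable_fun [set: R * R] cyl.
Proof.
have mr : measurable_fun [set: R * R] (fun p => Num.sqrt (1 - p.2 ^+ 2)).
  apply: (measurableT_comp (f := fun x : R => Num.sqrt (1 - x ^+ 2))) => //.
  apply: continuous_measurable_fun => x.
  apply: (continuous_comp (f := fun x : R => 1 - x ^+ 2)).
    by apply: cvgB; [exact: cvg_cst | exact: exprn_continuous].
  exact: sqrt_continuous.
have mc : measurable_fun [set: R * R] (fun p => cos p.1).
  apply: (measurableT_comp (f := @cos R)) => //.
  by apply: continuous_measurable_fun; exact: continuous_cos.
have ms : measurable_fun [set: R * R] (fun p => sin p.1).
  apply: (measurableT_comp (f := @sin R)) => //.
  by apply: continuous_measurable_fun; exact: continuous_sin.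
apply: measurable_fun_pair => //; apply: measurable_fun_pair.
- exact: measurable_funM.
- exact: measurable_funM.
Qed.

(* The area measure of S^2, as a measure on R^3 carried by S^2. *)
Definition sphere_area : set (R3 R) -> \bar R :=
  pushforward (mrestr (lebesgue_measure \x lebesgue_measure)%E
                      measurable_cyl_domain) cyl.

Let sphere_area0 : sphere_area set0 = 0%E.
Proof. by rewrite /sphere_area /pushforward preimage_set0 measure0. Qed.

Let sphere_area_ge0 A : (0 <= sphere_area A)%E.
Proof. by rewrite /sphere_area /pushforward measure_ge0. Qed.

Let sphere_area_sigma_additive : semi_sigma_additive sphere_area.
Proof.
move=> F mF tF mUF; rewrite /sphere_area /pushforward preimage_bigcup.
apply: measure_semi_sigma_additive.
- by move=> n; rewrite -[X in measurable X]setTI; exact: measurable_cyl.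
- apply/trivIsetP => /= i j _ _ ij; rewrite -preimage_setI.
  by move/trivIsetP : tF => /(_ _ _ _ _ ij) ->//; rewrite preimage_set0.
- by rewrite -preimage_bigcup -[X in measurable X]setTI; exact: measurable_cyl.
Qed.

HB.instance Definition _ := isMeasure.Build _ _ _ sphere_area
  sphere_area0 sphere_area_ge0 sphere_area_sigma_additive.

End Sphere.

(* A finite graph drawn in R^3: [endpt false i] and [endpt true i] are the
   initial and final vertices of the edge i, drawn as [curve i] on [0, 1]. *)
Record graph (R : realType) := Graph {
  nv : nat;
  ne : nat;
  vtx : 'I_nv -> R3 R;
  endpt : bool -> 'I_ne -> 'I_nv;
  curve : 'I_ne -> R -> R3 R }.

Section Graph.
Context {R : realType}.
Implicit Types (G P : graph R) (e q : R3 R).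

Definition adjacent_vertices G : rel 'I_(nv G) :=
  fun u v => [exists i, [exists b, (endpt b i == u) && (endpt (~~ b) i == v)]].

(* A connected graph with at least one edge, continuously embedded in R^3;
   loops, multiple edges and vertices of degree 2 are allowed. *)
Definition continuous_graph G : Prop :=
  [/\ (0 < ne G)%N,
      forall u v, connect (@adjacent_vertices G) u v,
      forall i, {within `[(0 : R), 1]%classic, continuous (@curve R G i)},
      forall i (b : bool), @curve R G i b%:R = vtx (endpt b i)
    & injective (@vtx R G) /\
      forall (i j : 'I_(ne G)) (s t : R), 0 < s < 1 -> 0 <= t <= 1 ->
        curve i s = curve j t -> i = j /\ s = t].

Definition arc_set G (i : 'I_(ne G)) : set (R3 R) :=
  @curve R G i @` `[(0 : R), 1]%classic.

Definition graph_set G : set (R3 R) := \bigcup_(i in setT) @arc_set G i.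

(* An edge end is a pair (edge, end); a loop has both its ends at its vertex. *)
Definition end_vertex G (a : 'I_(ne G) * bool) : 'I_(nv G) := endpt a.2 a.1.

Definition degree G (v : 'I_(nv G)) : nat :=
  #|[pred a : 'I_(ne G) * bool | end_vertex a == v]|.

Definition top_vertex G (q : R3 R) (d : nat) : Prop :=
  d <> 2%N /\ exists v : 'I_(nv G), vtx v = q /\ degree v = d.

(* A polygonal graph inscribed in the graph G is encoded by the decomposition
   P of the set [graph_set G] into vertices and arcs that it induces; its edges
   are the chords of the arcs of P. The degenerate chords of loops are excluded.
   Only vertices of degree 2 can differ between P and G. *)
Definition approximating G P : Prop :=
  [/\ continuous_graph P,
      graph_set P = graph_set G,
      forall i : 'I_(ne P), endpt false i <> endpt true i
    & forall q d, top_vertex P q d <-> top_vertex G q d].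

Definition refines P' P : Prop := range (@vtx R P) `<=` range (@vtx R P').

Definition chordal P : graph R :=
  @Graph R (nv P) (ne P) (@vtx R P) (@endpt R P)
    (fun i t => (1 - t) *: (vtx (endpt false i) : R3 R)
                + t *: (vtx (endpt true i) : R3 R)).

(* The vector of the chord leaving from an edge end, and its direction. *)
Definition chord P (a : 'I_(ne P) * bool) : R3 R :=
  vtx (endpt (~~ a.2) a.1) - vtx (endpt a.2 a.1).

Definition tangent P (a : 'I_(ne P) * bool) : R3 R :=
  (enorm (chord a))^-1 *: chord a.

(* -1 on the open hemisphere centered at T, 1 on the opposite one. *)
Definition chi (T e : R3 R) : R := - Num.sg (dot e T).

Definition ntc P (v : 'I_(nv P)) : \bar R :=
  ((4^-1)%:E * \int[sphere_area]_(e in S2)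
     (Num.max (\sum_(a : 'I_(ne P) * bool | end_vertex a == v)
                 chi (tangent a) e) 0)%:E)%E.

Definition NTC_poly P : \bar R := (\sum_(v < nv P) ntc v)%E.

Definition NTC G : \bar R := ereal_sup [set NTC_poly P | P in approximating G].

(* An end of one of the two copies of an edge: ((edge, copy), end). *)
Definition dart G : finType := (('I_(ne G) * bool) * bool)%type.

Definition dart_vertex G (h : dart G) : 'I_(nv G) := endpt h.2 h.1.1.

(* A parameterization of the double: the 1-manifold is obtained from the
   segments ('I_(ne G) * bool) x [0, 1], mapped by [curve], by gluing their
   ends in pairs over each vertex. *)
Record double_param G := DoubleParam {
  joint : dart G -> dart G;
  jointK : involutive joint;
  joint_neq : forall h, joint h != h;
  joint_vertex : forall h, dart_vertex (joint h) = dart_vertex h }.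

(* The type is never empty: each doubled edge can be closed up into a circle. *)
Lemma double_param_inhabited G : inhabited (double_param G).
Proof.
exists; apply: (@DoubleParam G (fun h => ((h.1.1, ~~ h.1.2), h.2))) => //.
- by move=> [[i c] b] /=; rewrite negbK.
- by move=> [[i c] b] /=; rewrite !xpair_eqE; case: c; rewrite !andbF.
Qed.

(* Local extrema of <e, .> along an edge; one-sided at the ends t = 0, 1. *)
Definition edge_max G e (i : 'I_(ne G)) (t : R) : Prop :=
  \forall s \near within `[(0 : R), 1]%classic (nbhs t),
    dot e (curve i s) <= dot e (curve i t).

Definition edge_min G e (i : 'I_(ne G)) (t : R) : Prop :=
  \forall s \near within `[(0 : R), 1]%classic (nbhs t),
    dot e (curve i t) <= dot e (curve i s).

Section NetLocalMaxima.
Variables (G : graph R) (D : double_param G).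

(* The points of the 1-manifold lying over a vertex. *)
Definition over_vertex (v : 'I_(nv G)) : {set {set dart G}} :=
  [set [set h; joint D h]%SET | h : dart G & dart_vertex h == v]%SET.

Definition lmax_vertex e (v : 'I_(nv G)) : nat :=
  #|[pred m in over_vertex v |
      [forall h in m, `[< edge_max e h.1.1 h.2%:R >]]]|.

Definition lmin_vertex e (v : 'I_(nv G)) : nat :=
  #|[pred m in over_vertex v |
      [forall h in m, `[< edge_min e h.1.1 h.2%:R >]]]|.

Definition nlm_vertex e (v : 'I_(nv G)) : R :=
  2^-1 * ((lmax_vertex e v)%:R - (lmin_vertex e v)%:R).

(* Over a point of the embedded graph: if q lies inside an edge, the points
   over q are those with parameter t on the two copies (i, c) of the edge. *)
Definition lmax e q : nat :=
  ((\sum_(v < nv G | vtx v == q) lmax_vertex e v) +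
   #|[pred ic : 'I_(ne G) * bool |
       `[< exists t : R,
              [/\ (0 < t < 1)%R, curve ic.1 t = q & edge_max e ic.1 t] >]]|)%N.

Definition lmin e q : nat :=
  ((\sum_(v < nv G | vtx v == q) lmin_vertex e v) +
   #|[pred ic : 'I_(ne G) * bool |
       `[< exists t : R,
              [/\ (0 < t < 1)%R, curve ic.1 t = q & edge_min e ic.1 t] >]]|)%N.

Definition nlm e q : R := 2^-1 * ((lmax e q)%:R - (lmin e q)%:R).

End NetLocalMaxima.

(* c is a homeomorphism from ]0, 1[ onto an open subset of Gamma. *)
Definition open_interval_of (Gamma : set (R3 R)) (c : R -> R3 R) : Prop :=
  [/\ {within `](0 : R), 1[%classic, continuous c},
      {in `](0 : R), 1[ &, injective c}
    & forall a b : R, 0 <= a -> a < b -> b <= 1 ->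
        exists2 U, open U & c @` `]a, b[%classic = Gamma `&` U].

Definition monotone_along e (c : R -> R3 R) : Prop :=
  {in `](0 : R), 1[ &, {homo (fun t => dot e (c t)) : s t / s <= t}} \/
  {in `](0 : R), 1[ &, {homo (fun t => dot e (c t)) : s t /~ s <= t}}.

(* Topological vertices are critical by convention. *)
Definition critical G e : set (R3 R) :=
  [set q | graph_set G q /\
    ((exists d, top_vertex G q d) \/
     forall c, open_interval_of (graph_set G) c ->
       (c @` `](0 : R), 1[%classic) q -> ~ monotone_along e c)].

(* The directions at which the multiplicity of the polygonal graph is defined:
   those which are orthogonal to no edge. *)
Definition regular_direction P e : Prop :=
  forall i : 'I_(ne P), dot e (chord (i, false)) <> 0.

Section Multiplicity.
(* A choice of parameterizations of the doubles of all graphs. *)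
Variable D : forall G : graph R, double_param G.

(* The sum is over the indices of the vertices of the chordal graph, so that
   its self-intersections play no role. *)
Definition mu_poly P e : R :=
  \sum_(v < nv P) Num.max (@nlm_vertex (chordal P) (D (chordal P)) e v) 0.

Definition attains_max e (A : set (R3 R)) q : Prop :=
  A q /\ forall x, A x -> dot e x <= dot e q.

Definition attains_min e (A : set (R3 R)) q : Prop :=
  A q /\ forall x, A x -> dot e q <= dot e x.

(* P is obtained from Q by adding the points x i and y i as vertices. *)
Definition adds_extrema e Q P : Prop :=
  exists x y : 'I_(ne Q) -> R3 R,
    [/\ forall i, attains_max e (arc_set i) (x i),
        forall i, attains_min e (arc_set i) (y i)
      & range (@vtx R P) = range (@vtx R Q) `|` range x `|` range y].

(* P k stands for the (k + 1)-st graph of the sequence. *)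
Definition mu_sequence G e (P : nat -> graph R) : Prop :=
  [/\ forall k, approximating G (P k) /\ regular_direction (P k) e,
      NTC_poly (P k) @[k --> \oo] --> NTC G,
      forall k, refines (P k.+1) (P k),
      forall k (i : 'I_(ne (P k))) x y,
        arc_set i x -> arc_set i y -> enorm (x - y) <= k.+1%:R^-1
    & forall k, exists2 Q, approximating G Q & adds_extrema e Q (P k)].

Definition is_mu_graph G e (m : \bar R) : Prop :=
  (exists P : nat -> graph R, mu_sequence G e P) /\
  forall P : nat -> graph R, mu_sequence G e P -> (mu_poly (P k) e)%:E @[k --> \oo] --> m.

(* The value 0 is a default for the directions e at which the limit does not
   exist or depends on the sequence. *)
Definition mu_graph G e : \bar R := xget 0%E [set m | is_mu_graph G e m].

End Multiplicity.
End Graph.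

(* Main.v *)
Require Import Defs.
From HB Require Import structures.
From mathcomp Require Import all_boot all_order all_algebra.
From mathcomp Require Import all_classical all_reals all_analysis.
From mathcomp Require Import measurable_realfun.
From mathcomp Require Import finmap ring lra.
Set Implicit Arguments.
Unset Strict Implicit.
Unset Printing Implicit Defensive.
Import Order.TTheory GRing.Theory Num.Theory.
Import numFieldNormedType.Exports.
Local Open Scope classical_set_scope.
Local Open Scope ring_scope.

(** Fix a direction e and write h for the height <e, .>. Let [mu_chi P e] be
    half the sum, over the vertices of a polygonal graph P, of the positive
    part of the sum of the signs [chi] of the edge ends there. Integrating
    over e gives twice [NTC_poly P] ([NTC_poly_integral]), and pairing the ends
    of the doubled edges shows that [mu_chi P e] is [mu_poly P e] when e is
    orthogonal to no edge of P ([mu_polyE]).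

    Everything rests on one domination principle, [mu_domination]: if e is
    orthogonal to no edge of P, then mu_chi P e <= mu_chi Q e for every
    polygonal graph Q inscribed in the same set whose arcs are small enough,
    whether or not Q refines P. A sum of positive parts is a maximum over
    sets: [mu_chi P e] is half the maximum over the vertex sets W of [cut e W],
    which counts the edges that leave W, positively when they go down and
    negatively when they go up. Given W, cut each arc of P at a point that
    lies between two consecutive vertices of Q whose heights are ordered like
    those of the ends of the arc; such vertices exist because Q has vertices
    near both ends. The vertices of Q in the stars of the vertices in W then
    have the same cut number as W.

    Consequently, along any sequence of approximating graphs whose arcs
    shrink, mu_chi converges for almost all e, and two such sequences have the
    same limit since each dominates the other. Together with Fatou's lemma,
    this shows that NTC(Gamma) is half the integral of the limit and that
    NTC_poly tends to NTC(Gamma) along every such sequence ([NTC_integral],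
    [NTC_poly_cvg]). So the limit that defines the multiplicity is independent
    of the sequence, and it remains to construct one sequence for almost
    all e. For this, e is assumed [generic]: it separates the points with
    rational parameters on each edge, which excludes countably many great
    circles. Refining by points with rational parameters whose heights avoid
    finitely many values, then adding extremal points, never creates a
    horizontal chord ([refining_sequence]).

    If the limit is finite, it bounds the number of successive peaks of h
    along each edge, since N peaks with rational parameters span a polygonal
    graph with mu_chi >= N ([peaks_mu]). Hence h is piecewise monotone along
    the edges ([piecewise_monotone]), strictly because e is generic. For a
    subdivision into arcs along which h is strictly monotone, the sum of signs
    at a vertex is twice the net number of local maxima on Gamma
    ([nlm_subdivision]), and the only vertices that contribute are critical
    points ([critical_formula]). Such subdivisions can be made as fine as
    desired, so by domination their common value is the limit
    ([finite_value]). *)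

(** * Vertices and arcs of a continuous graph *)

Section Topology.
Context {R : realType}.
Implicit Types (P Q G : graph R) (e x y q : R3 R) (s t r : R).

Definition vset P : set (R3 R) := range (@vtx R P).

Definition oarc P (i : 'I_(ne P)) : set (R3 R) :=
  curve i @` `](0 : R), 1[%classic.

Lemma dotB e x y : dot e (x - y) = dot e x - dot e y.
Proof. by rewrite /dot /=; ring. Qed.

Lemma dot_continuous e : continuous (dot e).
Proof.
move=> x; rewrite /dot; apply: cvgD; first apply: cvgD; apply: cvgM; try exact: cvg_cst.
- by apply: (@cvg_comp _ _ _ (fun z : R3 R => z.1) fst _ (nbhs x.1)); exact: cvg_fst.
- by apply: (@cvg_comp _ _ _ (fun z : R3 R => z.1) snd _ (nbhs x.1)); [exact: cvg_fst|exact: cvg_snd].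
- exact: cvg_snd.
Qed.

Lemma R3_hausdorff : hausdorff_space (R3 R).
Proof. exact: norm_hausdorff. Qed.

(** Two closed sets that cover a connected set and do not meet on it
    separate it; this decides below on which side of a vertex an arc lies. *)
Lemma connected_split (K A B : set (R3 R)) : connected K -> closed A -> closed B ->
  K `<=` A `|` B -> K `&` A `&` B = set0 -> K `&` A !=set0 -> K `<=` A.
Proof.
move=> cK cA cB KAB KAB0 KA0.
suff <- : K `&` A = K by move=> x [].
apply: cK => //; last by exists A.
exists (~` B); first exact: closed_openC.
rewrite eqEsubset; split=> x [Kx hx]; split=> //.
- by move=> Bx; have : (K `&` A `&` B) x by []; rewrite KAB0.
- by case: (KAB _ Kx).
Qed.

Section ContinuousGraph.
Variables (P : graph R) (hP : continuous_graph P).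

Lemma curve_inj (i j : 'I_(ne P)) s t : 0 < s < 1 -> 0 <= t <= 1 ->
  curve i s = curve j t -> i = j /\ s = t.
Proof. by case: hP => _ _ _ _ [_ h]; exact: h. Qed.

Lemma vtx_inj : injective (@vtx R P).
Proof. by case: hP => _ _ _ _ []. Qed.

Lemma curve_end (i : 'I_(ne P)) (b : bool) : curve i b%:R = vtx (endpt b i).
Proof. by case: hP => _ _ _ h _; exact: h. Qed.

Lemma curve0 (i : 'I_(ne P)) : curve i 0 = vtx (endpt false i).
Proof. exact: (curve_end i false). Qed.

Lemma curve1 (i : 'I_(ne P)) : curve i 1 = vtx (endpt true i).
Proof. exact: (curve_end i true). Qed.

Lemma curve_cts (i : 'I_(ne P)) : {within `[(0 : R), 1]%classic, continuous (curve i)}.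
Proof. by case: hP => _ _ h _ _; exact: h. Qed.

Lemma curve_cts_sub (i : 'I_(ne P)) (A : set R) : A `<=` `[0, 1]%classic ->
  {within A, continuous (curve i)}.
Proof. by move=> sA; apply: continuous_subspaceW sA _; exact: curve_cts. Qed.

Lemma vtx_end (v : 'I_(nv P)) : exists a, @end_vertex R P a = v.
Proof.
case: hP => ne0 /(_ v (endpt false (Ordinal ne0))) /connectP[p pp pl] _ _ _.
case: p pp pl => [_ /= <-|w p /= /andP[+ _] _]; first by exists (Ordinal ne0, false).
by move=> /existsP[i /existsP[b /andP[/eqP h _]]]; exists (i, b).
Qed.

(** A vertex is an end of some edge because the graph is connected and has
    an edge, so injectivity of the drawing keeps it off the open edges. *)
Lemma curve_notin_vset (i : 'I_(ne P)) t : 0 < t < 1 -> ~ vset P (curve i t).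
Proof.
move=> t01 [v _ vE]; have [[j b] /= jb] := vtx_end v.
have := vE; rewrite -jb /end_vertex/= -curve_end => /esym/curve_inj[] //.
  by case: b {jb}; rewrite ?lexx ?ler01.
by move=> _ tb; move: t01; rewrite tb; case: b {jb tb}; rewrite ?ltxx ?andbF.
Qed.

Lemma vset_graph : vset P `<=` graph_set P.
Proof.
move=> _ [v _ <-]; have [[j b] /= <-] := vtx_end v.
exists j => //; exists b%:R; last exact: curve_end.
by rewrite /= in_itv /=; case: b; rewrite ?lexx ?ler01.
Qed.

Lemma graph_set_split x : graph_set P x -> vset P x \/ exists i : 'I_(ne P), oarc i x.
Proof.
move=> [i _ [t]]; rewrite /= in_itv/= => /andP[]; rewrite le_eqVlt => /orP[/eqP<- _ <-|t0].
  by left; exists (endpt false i); rewrite ?curve0.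
rewrite le_eqVlt => /orP[/eqP-> <-|t1 <-]; first by left; exists (endpt true i); rewrite ?curve1.
by right; exists i; exists t; rewrite //= in_itv/= t0 t1.
Qed.

Lemma oarc_arc (i : 'I_(ne P)) : oarc i `<=` arc_set i.
Proof. by move=> x [t] /= h <-; exists t => //=; apply: subset_itv_oo_cc h. Qed.

Lemma arc_graph (i : 'I_(ne P)) : arc_set i `<=` graph_set P.
Proof. by move=> x h; exists i. Qed.

Lemma oarc_notin_vset (i : 'I_(ne P)) x : oarc i x -> ~ vset P x.
Proof. by move=> [t] /=; rewrite in_itv/= => t01 <-; exact: curve_notin_vset. Qed.

Lemma arc_split (i : 'I_(ne P)) x : arc_set i x ->
  [\/ x = vtx (endpt false i), x = vtx (endpt true i) | oarc i x].
Proof.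
move=> [t]; rewrite /= in_itv/= => /andP[]; rewrite le_eqVlt => /orP[/eqP<- _ <-|t0].
  by constructor 1; rewrite curve0.
rewrite le_eqVlt => /orP[/eqP-> <-|t1 <-]; first by constructor 2; rewrite curve1.
by constructor 3; exists t; rewrite //= in_itv/= t0 t1.
Qed.

Lemma arc_end (i : 'I_(ne P)) b : arc_set i (vtx (endpt b i)).
Proof.
exists b%:R; last exact: curve_end.
by rewrite /= in_itv /=; case: b; rewrite ?lexx ?ler01.
Qed.

Lemma oarc_arc_inj (i j : 'I_(ne P)) x : oarc i x -> arc_set j x -> i = j.
Proof.
move=> [s /=]; rewrite in_itv/= => s01 <- [t /=]; rewrite in_itv/= => t01 /esym.
by case/curve_inj.
Qed.

Lemma subarc_closed (i : 'I_(ne P)) s t : 0 <= s -> t <= 1 ->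
  closed (curve i @` `[s, t]%classic).
Proof.
move=> s0 t1; apply: compact_closed; first exact: R3_hausdorff.
apply: continuous_compact; last exact: segment_compact.
apply: curve_cts_sub => r /=; rewrite !in_itv/= => /andP[sr rt].
by rewrite (le_trans s0 sr) (le_trans rt t1).
Qed.

Lemma arc_closed (i : 'I_(ne P)) : closed (arc_set i).
Proof. exact: subarc_closed. Qed.

Lemma subarc_connected (i : 'I_(ne P)) (A : set R) : is_interval A ->
  A `<=` `[0, 1]%classic -> connected (curve i @` A).
Proof.
move=> iA sA; apply: connected_continuous_connected; first exact/connected_intervalP.
exact: curve_cts_sub.
Qed.

Lemma oarc_connected (i : 'I_(ne P)) : connected (oarc i).
Proof.
apply: subarc_connected; first exact: interval_is_interval.
exact: subset_itv_oo_cc.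
Qed.

(** The rest of the graph. It is a finite union of compact arcs, whence
    open subarcs are open in the graph. *)
Definition outside_subarc (i : 'I_(ne P)) s t : set (R3 R) :=
  (\bigcup_(j in [set j | j != i]) arc_set j) `|`
  (curve i @` `[0, s]%classic `|` curve i @` `[t, 1]%classic).

Lemma outside_subarc_closed (i : 'I_(ne P)) s t : s <= 1 -> 0 <= t -> closed (outside_subarc i s t).
Proof.
move=> s1 t0; apply: closedU; last by apply: closedU; apply: subarc_closed.
apply: closed_bigcup => [|j _]; last exact: arc_closed.
exact: finite_finset.
Qed.

Lemma outside_subarc_cover (i : 'I_(ne P)) s t x :
  graph_set P x -> (curve i @` `]s, t[%classic) x \/ outside_subarc i s t x.
Proof.
move=> [j _ [r /= r01 <-]]; have [ji|ji] := eqVneq j i; last first.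
  by right; left; exists j => //; exists r.
subst j; move: r01; rewrite in_itv/= => /andP[r0 r1].
have [rs|sr] := leP r s; first by right; right; left; exists r; rewrite //= in_itv/= r0 rs.
have [tr|rt] := leP t r; first by right; right; right; exists r; rewrite //= in_itv/= tr r1.
by left; exists r; rewrite //= in_itv/= sr rt.
Qed.

Lemma outside_subarc_disj (i : 'I_(ne P)) s t x : 0 <= s -> t <= 1 ->
  (curve i @` `]s, t[%classic) x -> ~ outside_subarc i s t x.
Proof.
move=> s0 t1 [r /=]; rewrite in_itv/= => /andP[sr rt] <-.
have r01 : 0 < r < 1 by rewrite (le_lt_trans s0 sr) (lt_le_trans rt t1).
case=> [[j /= ji [u /=]]|[[u /=]|[u /=]]]; rewrite in_itv/= => /andP[u0 u1] /esym/curve_inj.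
- by case=> //; [rewrite u0|move=> ij; rewrite ij eqxx in ji].
- by case=> //; [rewrite u0; lra|move=> _ ru; lra].
- by case=> //; [rewrite u1; lra|move=> _ ru; lra].
Qed.

Lemma subarc_open (i : 'I_(ne P)) s t : 0 <= s -> s <= 1 -> 0 <= t -> t <= 1 ->
  curve i @` `]s, t[%classic = graph_set P `&` ~` outside_subarc i s t.
Proof.
move=> s0 s1 t0 t1; rewrite eqEsubset; split=> x.
  move=> hx; split; last exact: outside_subarc_disj hx.
  case: hx => r /=; rewrite in_itv/= => /andP[sr rt] <-; exists i => //; exists r => //=.
  by rewrite in_itv/=; lra.
by move=> [/(outside_subarc_cover i s t)[]].
Qed.

End ContinuousGraph.
End Topology.

(** * Arcs between consecutive vertices of another graph on the same set *)

Section Gaps.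
Context {R : realType}.
Implicit Types (P Q G : graph R) (e x y q : R3 R) (s t r : R).

Lemma rat_near (s t r d : R) : s < t -> s <= r <= t -> 0 < d ->
  exists a : rat, s < ratr a < t /\ `|ratr a - r| < d.
Proof.
move=> st /andP[sr rt] d0; have [tr|{}rt] := leP t r.
  have /rat_in_itvoo[a] : Num.max s (t - d) < t by rewrite gt_max st ltrBlDr ltrDl.
  rewrite in_itv/= gt_max => /andP[/andP[sa da] at']; exists a; rewrite sa at'; split => //.
  have -> : r = t by apply/eqP; rewrite eq_le rt tr.
  by rewrite ltr_norml; lra.
have /rat_in_itvoo[a] : r < Num.min t (r + d) by rewrite lt_min rt ltrDl.
rewrite in_itv/= lt_min => /andP[ra /andP[at' da]]; exists a.
by rewrite (le_lt_trans sr ra) at'; split => //; rewrite ltr_norml; lra.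
Qed.

Lemma near_curve P (i : 'I_(ne P)) t (U : set (R3 R)) : continuous_graph P ->
  0 <= t <= 1 -> nbhs (curve i t) U ->
  exists2 d, 0 < d & forall s, 0 <= s <= 1 -> `|s - t| < d -> U (curve i s).
Proof.
move=> hP t01 nU; have := (subspace_continuousP _ _).1 (@curve_cts _ _ hP i) t.
rewrite /= in_itv/= => /(_ t01 _ nU); rewrite /within/= => -[d /= d0 h].
exists d => // s s01 st; by apply: h => //=; rewrite distrC.
Qed.

(** An open subarc is dense in the closed one. *)
Lemma closed_subarc P (i : 'I_(ne P)) s t (C : set (R3 R)) : continuous_graph P ->
  0 <= s -> s < t -> t <= 1 -> closed C ->
  curve i @` `]s, t[%classic `<=` C -> curve i @` `[s, t]%classic `<=` C.
Proof.
move=> hP s0 st t1 cC sC x [r /= + <-]; rewrite in_itv/= => srt.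
apply: contrapT => nC; have /open_nbhs_nbhs : open_nbhs (curve i r) (~` C).
  by split => //; exact: closed_openC.
move/near_curve => /(_ hP)[|d d0 h]; first lra.
have [a [sat da]] := rat_near st srt d0.
apply: (h (ratr a)) => //; first lra.
by apply: sC; exists (ratr a).
Qed.

Lemma dot_ge0 x : 0 <= dot x x.
Proof. by rewrite /dot !addr_ge0// -expr2 sqr_ge0. Qed.

Lemma dot_eq0 x : dot x x = 0 -> x = 0.
Proof.
case: x => [[a b] c]; rewrite /dot /= => h.
have a0 := sqr_ge0 a; have b0 := sqr_ge0 b; have c0 := sqr_ge0 c.
rewrite -!expr2 in h.
have := sqrf_eq0 a; have := sqrf_eq0 b; have := sqrf_eq0 c.
have -> : a ^+ 2 = 0 by lra.
have -> : b ^+ 2 = 0 by lra.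
have -> : c ^+ 2 = 0 by lra.
by rewrite eqxx => /esym/eqP-> /esym/eqP-> /esym/eqP->.
Qed.

Lemma enorm_gt0 x : x != 0 -> 0 < enorm x.
Proof.
move=> x0; rewrite /enorm sqrtr_gt0 lt_neqAle dot_ge0 andbT eq_sym.
by apply: contraNN x0 => /eqP/dot_eq0->.
Qed.

Lemma enormB_gt0 x y : x <> y -> 0 < enorm (x - y).
Proof. by move=> /eqP xy; apply: enorm_gt0; rewrite subr_eq0. Qed.

Definition mesh_le Q (d : R) := forall (i : 'I_(ne Q)) x y,
  arc_set i x -> arc_set i y -> enorm (x - y) <= d.

(** The parameters [s] and [t] are consecutive among those of the points of
    the edge that lie in V. *)
Definition is_gap P (V : set (R3 R)) (i : 'I_(ne P)) s t : Prop :=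
  [/\ 0 <= s < t, t <= 1, V (curve i s), V (curve i t)
    & forall r, s < r < t -> ~ V (curve i r)].

(** The orientation [b] tells which end of the edge lies at parameter [s]. *)
Definition spans Q (j : 'I_(ne Q)) (b : bool) P (i : 'I_(ne P)) s t :=
  [/\ arc_set j = curve i @` `[s, t]%classic, vtx (endpt b j) = curve i s
    & vtx (endpt (~~ b) j) = curve i t].

Section TwoGraphs.
Variables (P Q : graph R).
Hypotheses (hP : continuous_graph P) (hQ : continuous_graph Q).
Hypothesis PQ : graph_set P = graph_set Q.

(** The open arcs are the connected components of the graph without its
    vertices. *)
Lemma conn_in_oarc (K : set (R3 R)) (j : 'I_(ne Q)) : connected K -> K `<=` graph_set Q ->
  (forall x, K x -> ~ vset Q x) -> K `&` oarc j !=set0 -> K `<=` oarc j.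
Proof.
move=> cK sK nV [x0 [Kx0 jx0]].
suff h : K `<=` arc_set j.
  move=> x Kx; have [xe|xe|//] := arc_split hQ (h x Kx);
  by case: (nV x Kx); rewrite xe; eexists.
apply: (@connected_split _ K _ (\bigcup_(k in [set k | k != j]) arc_set k)) => //.
- exact: arc_closed.
- by apply: closed_bigcup => [|k _]; [exact: finite_finset|exact: arc_closed].
- move=> x /sK[k _ kx]; have [<-|kj] := eqVneq k j; first by left.
  by right; exists k.
- rewrite -subset0 => x [[Kx /(arc_split hQ)]] [xe|xe|jx].
  + by case: (nV x Kx); rewrite xe; eexists.
  + by case: (nV x Kx); rewrite xe; eexists.
  + by move=> [k /= kj /(oarc_arc_inj hQ jx)jk]; rewrite jk eqxx in kj.
- by exists x0; split=> //; exact: oarc_arc.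
Qed.

(** The open subarc and the open arc of Q through one of its points are both
    connected components of the graph without the vertices of Q. This is how
    the edges of two graphs drawn on the same set are compared. *)
Lemma gap_spanned (i : 'I_(ne P)) s t : is_gap (vset Q) i s t ->
  exists j b, @spans Q j b P i s t.
Proof.
move=> [/andP[s0 st] t1 Vs Vt nV].
pose m := (s + t) / 2.
have mst : s < m < t by rewrite /m; lra.
have sub01 : `]s, t[ `<=` `[(0:R), 1].
  by move=> r /=; rewrite !in_itv/=; lra.
have subQ : curve i @` `]s, t[%classic `<=` graph_set Q.
  by rewrite -PQ => _ [r /sub01 r01 <-]; exists i => //; exists r.
have nVK x : (curve i @` `]s, t[%classic) x -> ~ vset Q x.
  by move=> [r /=]; rewrite in_itv/= => /nV h <-.
have Km : (curve i @` `]s, t[%classic) (curve i m) by exists m; rewrite //= in_itv.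
have [/(nVK _ Km)//|[j jm]] := graph_set_split hQ (subQ _ Km).
have Kj : curve i @` `]s, t[%classic `<=` oarc j.
  apply: conn_in_oarc => //; last by exists (curve i m).
  by apply: subarc_connected => //; exact: interval_is_interval.
have jK : oarc j `<=` curve i @` `[s, t]%classic.
  apply: (@connected_split _ _ _ (@outside_subarc _ P i s t)).
  - exact: oarc_connected.
  - exact: subarc_closed.
  - by apply: outside_subarc_closed => //; lra.
  - move=> x /oarc_arc/arc_graph; rewrite -PQ => /(outside_subarc_cover i s t)[|]; last by right.
    by move=> [r rst <-]; left; exists r => //; exact: subset_itv_oo_cc rst.
  - rewrite -subset0 => x [[jx [r /= + rx]]]; rewrite -rx in jx *.
    rewrite in_itv/= => /andP[]; rewrite le_eqVlt => /orP[/eqP sr|sr].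
      by case: (oarc_notin_vset hQ jx); rewrite -sr.
    rewrite le_eqVlt => /orP[/eqP re|rt].
      by case: (oarc_notin_vset hQ jx); rewrite re.
    by apply: outside_subarc_disj => //; exists r; rewrite //= in_itv/= sr.
  - exists (curve i m); split => //; exists m => //=.
    by rewrite in_itv/=; lra.
have arcE : arc_set j = curve i @` `[s, t]%classic.
  rewrite eqEsubset; split.
    apply: closed_subarc => //; exact: subarc_closed.
  apply: closed_subarc => //; first exact: arc_closed.
  exact: subset_trans Kj (@oarc_arc _ _ _).
have h b : vtx (endpt b j) = curve i s \/ vtx (endpt b j) = curve i t.
  have := arc_end hQ j b; rewrite arcE => -[r /=]; rewrite in_itv/= => /andP[].
  rewrite le_eqVlt => /orP[/eqP<- _|sr]; first by left.
  rewrite le_eqVlt => /orP[/eqP<-|rt rb]; first by right.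
  by case: (nV r); rewrite ?sr ?rt// rb; eexists.
have k r : vset Q (curve i r) -> s <= r <= t ->
    curve i r = vtx (endpt false j) \/ curve i r = vtx (endpt true j).
  move=> Vr rst; have : arc_set j (curve i r) by rewrite arcE; exists r.
  by move=> /(arc_split hQ)[->|->|/(oarc_notin_vset hQ)//]; [left|right].
have ks := k s Vs; have kt := k t Vt.
exists j; case: (h false) => hf; case: (h true) => ht.
- exists false; split=> //=; case: kt; first lra; move=> ->; congruence.
- by exists false.
- by exists true.
- exists false; split=> //=; case: ks; first lra; move=> ->; congruence.
Qed.

(** A subarc free of vertices of Q lies in one arc of Q, hence is at most as
    large as the arcs of Q. *)
Lemma subarc_meets (i : 'I_(ne P)) s t d : mesh_le Q d -> 0 <= s < t -> t <= 1 ->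
  d < enorm (curve i s - curve i t) -> exists2 r, s <= r <= t & vset Q (curve i r).
Proof.
move=> md /andP[s0 st] t1; rewrite ltNge => /negP dst; apply: contrapT => nV; apply: dst.
have nV' r : s <= r <= t -> ~ vset Q (curve i r) by move=> rst Vr; apply: nV; exists r.
have Q' r : s <= r <= t -> graph_set Q (curve i r).
  by move=> rst; rewrite -PQ; exists i => //; exists r; rewrite //= in_itv/=; lra.
have st' : s <= s <= t by lra.
have [/(nV' _ st')//|[j js]] := graph_set_split hQ (Q' _ st').
have sub : curve i @` `[s, t]%classic `<=` oarc j.
  apply: conn_in_oarc => //.
  - apply: subarc_connected => //; first exact: interval_is_interval.
    by move=> r /=; rewrite !in_itv/=; lra.
  - by move=> x [r /= + <-]; rewrite in_itv/= => /Q'.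
  - by move=> x [r /= + <-]; rewrite in_itv/= => /nV'.
  - by exists (curve i s); split=> //; exists s; rewrite //= in_itv.
by apply: (md j); apply/oarc_arc/sub; [exists s|exists t]; rewrite //= in_itv/=; lra.
Qed.

(** Split at any intermediate vertex and keep a part over which h still
    decreases. *)
Lemma gap_descent (i : 'I_(ne P)) (h : R -> R) s t : 0 <= s < t -> t <= 1 ->
  vset Q (curve i s) -> vset Q (curve i t) -> h t < h s ->
  exists s' t', [/\ is_gap (vset Q) i s' t', s <= s', t' <= t & h t' < h s'].
Proof.
pose B s t := [pred v : 'I_(nv Q) | `[< exists2 x, s < x < t & curve i x = vtx v >]].
have [n] := ubnP #|B s t|; elim: n s t => // n IH s t Bn st t1 Vs Vt hst.
have [/existsP[v /asboolP[x sxt xv]]|/existsPn nB] := boolP [exists v, v \in B s t]; last first.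
  exists s, t; split=> //; split=> // r rst [v _ vr].
  by have /asboolP[] := nB v; exists r.
have x1 : x <= 1 by lra.
have Vx : vset Q (curve i x) by exists v.
have smaller a b : s <= a -> b <= t -> ~~ (a < x < b) -> (#|B a b| < n)%N.
  move=> sa bt axb; rewrite -ltnS; apply: leq_trans Bn; apply: proper_card.
  apply/properP; split.
    apply/fintype.subsetP => w /asboolP[y ayb yw]; apply/asboolP; exists y => //; lra.
  exists v; first by apply/asboolP; exists x.
  apply/asboolP => -[y ayb yv];
  have [|||_ xy] := @curve_inj _ P hP i i x y; [by lra|by lra|by rewrite xv yv|].
  by move: axb; rewrite xy ayb.
have [hx|hx] := ltP (h x) (h s).
  have [||||||s' [t' [? ? ? ?]]] := IH s x => //; try lra.
    by apply: smaller => //; lra.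
  by exists s', t'; split => //; lra.
have [||||||s' [t' [? ? ? ?]]] := IH x t => //; try lra.
  by apply: smaller => //; lra.
by exists s', t'; split => //; lra.
Qed.

Lemma gap_around (i : 'I_(ne P)) u r w : 0 <= u < r -> r < w <= 1 ->
  vset Q (curve i u) -> vset Q (curve i w) -> ~ vset Q (curve i r) ->
  exists s t, [/\ is_gap (vset Q) i s t, s < r < t, u <= s & t <= w].
Proof.
move=> ur rw Vu Vw nVr.
(* A step function whose only drop is at r: the gap over which it decreases
   contains r. *)
pose h (z : R) : R := if z < r then 1 else 0.
have [|||||s [t [g us tw hst]]] := @gap_descent i h u w => //; try lra.
  have -> : h u = 1 by rewrite /h; case: ltP => // ?; lra.
  by have -> : h w = 0 by rewrite /h; case: ltP => // ?; lra.
have rt : r <= t.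
  by rewrite leNgt; apply/negP => tr; move: hst; rewrite /h tr; case: ifP; rewrite ?ltxx ?ltr10.
have sr : s < r.
  rewrite ltNge; apply/negP => rs; move: hst; rewrite /h (ltNge s) rs /=.
  by case: ifP; rewrite ?ltxx ?ltr10.
exists s, t; split=> //; rewrite sr /= lt_neqAle rt andbT.
by case: g => [_ _ _ Vt _]; apply/eqP => re; apply: nVr; rewrite re.
Qed.

End TwoGraphs.
End Gaps.

(** * Cut numbers and the domination principle *)

Section Cuts.
Context {R : realType}.
Implicit Types (P Q G : graph R) (e x y : R3 R) (s t r p q : R).

Definition mu_chi P e : R :=
  2^-1 * \sum_(v < nv P) Num.max (\sum_(a : 'I_(ne P) * bool | end_vertex a == v)
                                    chi (tangent a) e) 0.

Lemma dotZ e c x : dot e (c *: x) = c * dot e x.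
Proof. by rewrite /dot /= /GRing.scale /=; ring. Qed.

Lemma chi_tangent P e (a : 'I_(ne P) * bool) : chi (tangent a) e =
  Num.sg (dot e (vtx (endpt a.2 a.1)) - dot e (vtx (endpt (~~ a.2) a.1))).
Proof.
rewrite /chi /tangent dotZ sgrM /chord dotB.
have [->|c0] := eqVneq (vtx (endpt (~~ a.2) a.1)) (vtx (endpt a.2 a.1)).
  by rewrite !subrr sgr0 mulr0 oppr0.
by rewrite gtr0_sg ?mul1r ?invr_gt0 ?enorm_gt0 ?subr_eq0// -sgrN opprB.
Qed.

Definition cut P e (W : pred 'I_(nv P)) : R :=
  \sum_(i < ne P) ((W (endpt false i))%:R - (W (endpt true i))%:R) *
    Num.sg (dot e (vtx (endpt false i)) - dot e (vtx (endpt true i))).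

(** The two ends of an edge carry opposite signs, so edges inside W cancel. *)
Lemma sum_chi_cut P e (W : pred 'I_(nv P)) :
  \sum_(v | W v) \sum_(a : 'I_(ne P) * bool | end_vertex a == v) chi (tangent a) e
  = cut e W.
Proof.
rewrite /cut.
transitivity (\sum_(a : 'I_(ne P) * bool | W (end_vertex a)) chi (tangent a) e).
  rewrite [RHS](partition_big (@end_vertex R P) W) //=.
  apply: eq_bigr => v Wv; apply: eq_bigl => a.
  by case: eqP => [->|]; rewrite ?Wv ?andbF.
rewrite big_mkcond /= -(pair_bigA _ (fun i b => if W (endpt b i) then chi (tangent (i, b)) e else 0)) /=.
apply: eq_bigr => i _; rewrite big_bool /= !chi_tangent /=.
rewrite -[X in Num.sg X]opprB sgrN.
by case: (W _); case: (W _); rewrite /=; ring.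
Qed.

Lemma cut_le_mu P e (W : pred 'I_(nv P)) : 2^-1 * cut e W <= mu_chi P e.
Proof.
rewrite -sum_chi_cut /mu_chi ler_pM2l ?invr_gt0// big_mkcond/=.
by apply: ler_sum => v _; rewrite le_max; case: (W v); rewrite lexx ?orbT.
Qed.

(** A sum of positive parts is attained on the set of the vertices with a
    nonnegative sum. *)
Lemma mu_chi_cut P e : exists W : pred 'I_(nv P), mu_chi P e = 2^-1 * cut e W.
Proof.
exists (fun v => 0 <= \sum_(a : 'I_(ne P) * bool | end_vertex a == v) chi (tangent a) e).
rewrite -sum_chi_cut /mu_chi [X in _ = _ * X]big_mkcond/=; congr (_ * _).
by apply: eq_bigr => v _; case: leP.
Qed.

Lemma fin_lower_bound n (f : 'I_n -> R) : (forall i, 0 < f i) ->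
  exists2 d, 0 < d & forall i, d <= f i.
Proof.
move=> f0; exists (1 + \sum_i (f i)^-1)^-1.
  by rewrite invr_gt0 ltr_wpDr// sumr_ge0// => i _; rewrite invr_ge0 ltW.
move=> i; rewrite -[leRHS]invrK lef_pV2 ?posrE ?invr_gt0//; last first.
  by rewrite ltr_wpDr// sumr_ge0// => j _; rewrite invr_ge0 ltW.
rewrite (bigD1 i)//= addrCA lerDl addr_ge0// sumr_ge0// => j _.
by rewrite invr_ge0 ltW.
Qed.

Lemma near_height P e (i : 'I_(ne P)) t c : continuous_graph P -> 0 <= t <= 1 ->
  (dot e (curve i t) < c -> exists2 d, 0 < d &
     forall s, 0 <= s <= 1 -> `|s - t| < d -> dot e (curve i s) < c) /\
  (c < dot e (curve i t) -> exists2 d, 0 < d &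
     forall s, 0 <= s <= 1 -> `|s - t| < d -> c < dot e (curve i s)).
Proof.
move=> hP t01; split=> h.
  apply: (@near_curve _ P i t (fun x => dot e x < c)) => //.
  exact: (@dot_continuous _ e _ _ (lt_nbhsl h)).
apply: (@near_curve _ P i t (fun x => c < dot e x)) => //.
exact: (@dot_continuous _ e _ _ (lt_nbhsr h)).
Qed.


Lemma dotZl c e x : dot (c *: e) x = c * dot e x.
Proof. by rewrite /dot /= /GRing.scale /=; ring. Qed.

(** Near the two ends of an edge that is not horizontal, the heights are
    ordered as at the ends. *)
Lemma slope_ends P e (i : 'I_(ne P)) : continuous_graph P ->
  dot e (curve i 1) < dot e (curve i 0) ->
  exists a b : R, [/\ 0 < a, a < b, b < 1 & forall p q, 0 <= p <= a -> b <= q <= 1 ->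
    dot e (curve i q) < dot e (curve i p)].
Proof.
move=> hP h; set m := (dot e (curve i 0) + dot e (curve i 1)) / 2.
have [||d1 d1p hd1] := (@near_height P e i 0 m hP _).2; [by lra|by rewrite /m; lra|].
have [||d2 d2p hd2] := (@near_height P e i 1 m hP _).1; [by lra|by rewrite /m; lra|].
have [a [a0 a3 ad]] : exists a : R, [/\ 0 < a, a <= 1 / 3 & a <= d1 / 2].
  by case: (leP (d1 / 2) (1 / 3)) => h'; [exists (d1 / 2)|exists (1 / 3)]; split; lra.
have [b [b0 b3 bd]] : exists b : R, [/\ b < 1, 2 / 3 <= b & 1 - d2 / 2 <= b].
  by case: (leP (1 - d2 / 2) (2 / 3)) => h'; [exists (2 / 3)|exists (1 - d2 / 2)]; split; lra.
exists a, b; split => //; first by lra.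
move=> p q pa qb; apply: (@lt_trans _ _ m); [apply: hd2|apply: hd1]; try lra.
- by rewrite ltr_norml; lra.
- by rewrite ltr_norml; lra.
Qed.

Section Domination.
Variables (P Q : graph R) (e : R3 R).
Hypotheses (hP : continuous_graph P) (hQ : continuous_graph Q).
Hypothesis PQ : graph_set P = graph_set Q.
Variables (p q : 'I_(ne P) -> R) (j : 'I_(ne P) -> 'I_(ne Q)) (b : 'I_(ne P) -> bool).
Hypothesis gap : forall i, is_gap (vset Q) i (p i) (q i).
Hypothesis jspan : forall i, spans (j i) (b i) i (p i) (q i).
Hypothesis same_sign : forall i,
  Num.sg (dot e (curve i (p i)) - dot e (curve i (q i))) =
  Num.sg (dot e (vtx (endpt false i)) - dot e (vtx (endpt true i))).

Let tau i := (p i + q i) / 2.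

Let tauP i : [/\ 0 <= p i, p i < tau i, tau i < q i & q i <= 1].
Proof. by rewrite /tau; case: (gap i) => *; split; lra. Qed.

(** The part of the graph that can be reached from W without crossing one
    of the points at which the arcs of P are cut. *)
Definition star (W : pred 'I_(nv P)) : set (R3 R) :=
  \bigcup_(i in setT)
    ((if W (endpt false i) then curve i @` `[0, tau i]%classic else set0) `|`
     (if W (endpt true i) then curve i @` `[tau i, 1]%classic else set0)).

Let star_closed W : closed (star W).
Proof.
apply: closed_bigcup => [|i _]; first exact: finite_finset.
have [p0 pt tq q1] := tauP i.
apply: closedU; case: ifP => _; try exact: closed0; apply: subarc_closed => //; lra.
Qed.

Let star_cover W x : graph_set P x -> star W x \/ star (predC W) x.
Proof.
move=> [i _ [t /= + <-]]; rewrite in_itv/= => t01.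
have [tt|tt] := leP t (tau i).
  case Wf : (W (endpt false i)); [left|right]; exists i => //; left; rewrite /= Wf;
  by exists t => //=; rewrite in_itv/=; lra.
case Wf : (W (endpt true i)); [left|right]; exists i => //; right; rewrite /= Wf;
by exists t => //=; rewrite in_itv/=; lra.
Qed.

(** Where a point of the stars comes from: a vertex of W, or a point of an
    open edge on the side of an end in W. *)
Let home W x : star W x -> (exists2 v, W v & vtx v = x) \/
  (exists i t, [/\ 0 < t < 1, curve i t = x & if t < tau i then W (endpt false i) else
                    if tau i < t then W (endpt true i) else true]).
Proof.
move=> [i _ []]; case: ifP => // Wi [t /= + <-]; rewrite in_itv/= => t01;
  have [p0 pt tq q1] := tauP i.
  have [->|t0] := eqVneq t 0; first by left; exists (endpt false i); rewrite ?curve0.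
  right; exists i, t; split => //; first by rewrite lt_neqAle eq_sym t0; lra.
  by case: ifP => // h; case: ifP => //; lra.
have [->|t0] := eqVneq t 1; first by left; exists (endpt true i); rewrite ?curve1.
right; exists i, t; split => //; first by rewrite [t < 1]lt_neqAle t0; lra.
by case: ifP => // h; [lra|case: ifP].
Qed.

Let star_disj W x : star W x -> star (predC W) x -> exists i, x = curve i (tau i).
Proof.
move=> /home[[v Wv vx]|[i [t [t01 tx h]]]] /home[[w Ww wx]|[i' [t' [t01' tx' h']]]].
- by move: Ww; rewrite /= -(vtx_inj hP (etrans vx (esym wx))) Wv.
- by case: (curve_notin_vset hP (i := i') t01'); rewrite tx' -vx; eexists.
- by case: (curve_notin_vset hP (i := i) t01); rewrite tx -wx; eexists.
- have [|||ii tt] := @curve_inj _ P hP i i' t t' => //; [lra|congruence|].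
  subst i' t'; exists i; rewrite -tx; congr (curve i _).
  move: h h'; case: ltgtP => // _ /=; first by move=> ->.
  by move=> ->.
Qed.

(** The label of a vertex of Q is the membership in W of the vertex of P
    whose star contains it. An arc of Q that avoids the cut points has ends
    with equal labels, since it is connected; the arc of Q through the cut
    point of the edge i joins the two stars at its ends, and by hypothesis its
    ends compare in height like those of i. *)
Lemma cut_domination (W : pred 'I_(nv P)) :
  exists W' : pred 'I_(nv Q), cut e W = cut e W'.
Proof.
exists (fun v => `[< star W (vtx v) >]).
have jinj : injective j.
  move=> i i' ii'.
  have [p0 pt tq q1] := tauP i; have [p0' pt' tq' q1'] := tauP i'.
  have : arc_set (j i) (curve i (tau i)).
    by have [-> _ _] := jspan i; exists (tau i) => //=; rewrite in_itv/=; lra.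
  rewrite ii'; have [-> _ _] := jspan i' => -[t' /=]; rewrite in_itv/= => t01 /esym.
  by case/(curve_inj hP) => //; lra.
have arcQ (k : 'I_(ne Q)) : arc_set k `<=` graph_set P by rewrite PQ; exact: arc_graph.
have nocut k : k \notin codom j -> star W (vtx (endpt false k)) <-> star W (vtx (endpt true k)).
  move=> kj.
  have dj x : arc_set k x -> star W x -> star (predC W) x -> False.
    move=> kx h1 h2; have [i xi] := star_disj h1 h2.
    have [p0 pt tq q1] := tauP i; have [_ _ _ _ nV] := gap i.
    have nVx : ~ vset Q x by rewrite xi; apply: nV; rewrite pt.
    have ox : oarc k x by case: (arc_split hQ kx) => // xe; case: nVx; rewrite xe; eexists.
    move/negP: kj; apply; apply/codomP; exists i; apply: (oarc_arc_inj hQ ox).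
    by have [-> _ _] := jspan i; exists (tau i) => //=; rewrite in_itv/=; lra.
  have all_in x y : arc_set k x -> arc_set k y -> star W x -> star W y.
    move=> kx ky Wx; suff : arc_set k `<=` star W by apply.
    apply: (@connected_split _ _ _ (star (predC W))) => //.
    - by apply: (subarc_connected hQ) => //; exact: interval_is_interval.
    - by move=> z /arcQ/star_cover-/(_ W).
    - by rewrite -subset0 => z [[]] /dj h/h.
    - by exists x.
  by split; apply: all_in; exact: arc_end.
rewrite [in RHS]/cut [RHS](bigID (fun k => k \in codom j))/= [X in _ + X]big1 ?addr0; last first.
  move=> k /nocut h; have -> : `[< star W (vtx (endpt false k)) >] = `[< star W (vtx (endpt true k)) >].
    by apply/asboolP/asboolP; rewrite h.
  by rewrite subrr mul0r.
have uj : uniq (codom j) by apply/injectiveP.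
rewrite /cut -(big_uniq _ uj) /codom /image_mem big_map big_enum/=.
apply: eq_bigr => i _.
have [p0 pt tq q1] := tauP i.
have lab b' t : 0 <= t <= 1 -> t != tau i -> b' = (tau i < t) ->
    `[< star W (curve i t) >] = W (endpt b' i).
  move=> t01 /eqP tt bt.
  have inW (W' : pred 'I_(nv P)) : W' (endpt b' i) -> star W' (curve i t).
    move=> Wi; exists i => //; rewrite /=; case: ltP bt Wi => h -> ->; [right|left];
    by exists t => //=; rewrite in_itv/=; lra.
  case Wi : (W (endpt b' i)); apply/asboolP; first exact: inW.
  move=> h; have [|i' ii'] := star_disj h; first by apply: inW; rewrite /= Wi.
  have [p0' pt' tq' q1'] := tauP i'.
  have [|||ie te] := @curve_inj _ P hP i' i (tau i') t; [lra|lra|by []|].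
  by apply: tt; rewrite -te ie.
have labp : `[< star W (curve i (p i)) >] = W (endpt false i).
  by apply: lab; [lra|rewrite lt_eqF|apply/esym/negbTE; rewrite -leNgt ltW].
have labq : `[< star W (curve i (q i)) >] = W (endpt true i).
  by apply: lab; [lra|rewrite gt_eqF|].
rewrite -same_sign; have [_] := jspan i.
case: (b i) => /= -> ->; rewrite labp labq //.
by rewrite -[X in _ = _ * Num.sg X]opprB sgrN mulrN -mulNr opprB.
Qed.

End Domination.

(** Each arc of P, since it is not horizontal, contains near its ends
    vertices of a fine graph Q whose heights are ordered like those of the
    ends; some two consecutive vertices between them are then ordered in the
    same way, and the arc is cut there. *)
Theorem mu_domination P e : continuous_graph P -> regular_direction P e ->
  exists2 d, 0 < d & forall Q, continuous_graph Q -> graph_set P = graph_set Q ->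
    mesh_le Q d -> mu_chi P e <= mu_chi Q e.
Proof.
move=> hP reg.
pose c i := Num.sg (dot e (vtx (endpt false i)) - dot e (@vtx R P (endpt true i))).
have c0 i : c i != 0.
  by rewrite sgr_eq0 subr_eq0; apply/eqP => h; apply: (reg i); rewrite /chord dotB/= h subrr.
have ends i : exists ab : R * R, [/\ 0 < ab.1, ab.1 < ab.2, ab.2 < 1 &
    forall p q, 0 <= p <= ab.1 -> ab.2 <= q <= 1 ->
    c i * dot e (curve i q) < c i * dot e (curve i p)].
  have [|a [b [a0 ab b1 h]]] := @slope_ends P (c i *: e) i hP.
    rewrite !dotZl -subr_gt0 -mulrBr curve0// curve1// /c -normrEsg normr_gt0.
    by rewrite -sgr_eq0 c0.
  by exists (a, b); split => //= p q hp hq; have := h p q hp hq; rewrite !dotZl.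
have [ab abP] := choice ends.
have [|d d0 dl] := @fin_lower_bound (ne P) (fun i =>
    Num.min (enorm (curve i 0 - curve i (ab i).1)) (enorm (curve i (ab i).2 - curve i 1))).
  move=> i; have [a0 aab b1 _] := abP i; rewrite lt_min !enormB_gt0// => h.
  - by have [|||_] := @curve_inj _ P hP i i (ab i).2 1; [lra|lra|by []|lra].
  - by have [|||_] := @curve_inj _ P hP i i (ab i).1 0; [lra|lra|by []|lra].
(* half of d, because subarc_meets asks for subarcs larger than the mesh *)
exists (d / 2); first by rewrite divr_gt0.
move=> Q hQ PQ mQ.
have gaps i : exists pq : R * R, is_gap (vset Q) i pq.1 pq.2 /\
    c i * dot e (curve i pq.2) < c i * dot e (curve i pq.1).
  have [a0 aab b1 hab] := abP i.
  have := dl i; rewrite le_min => /andP[d1 d2].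
  have [|||r1 r1P V1] := subarc_meets hP hQ PQ (i := i) (s := 0) (t := (ab i).1) mQ; try lra.
  have [|||r2 r2P V2] := subarc_meets hP hQ PQ (i := i) (s := (ab i).2) (t := 1) mQ; try lra.
  have r12 : 0 <= r1 < r2 by lra.
  have r21 : r2 <= 1 by lra.
  have hr : c i * dot e (curve i r2) < c i * dot e (curve i r1) by apply: hab; lra.
  have [s [t [g _ _ st]]] :=
    gap_descent hP (h := fun t => c i * dot e (curve i t)) r12 r21 V1 V2 hr.
  by exists (s, t).
have [pq pqP] := choice gaps.
have spn i : exists jb : 'I_(ne Q) * bool, spans jb.1 jb.2 i (pq i).1 (pq i).2.
  by have [j [b h]] := gap_spanned hP hQ PQ (pqP i).1; exists (j, b).
have [jb jbP] := choice spn.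
have [W ->] := mu_chi_cut P e.
have [|W' ->] := @cut_domination P Q e hP hQ PQ (fun i => (pq i).1) (fun i => (pq i).2)
  (fun i => (jb i).1) (fun i => (jb i).2) (fun i => (pqP i).1) jbP _ W; last exact: cut_le_mu.
move=> i; have [_] := pqP i; rewrite -subr_gt0 -mulrBr /c.
have [_|_|_] := sgrP (dot e (vtx (endpt false i)) - dot e (vtx (endpt true i))).
- by rewrite mul0r ltxx.
- by rewrite mul1r => /gtr0_sg.
- by rewrite mulN1r oppr_gt0 => /ltr0_sg.
Qed.

End Cuts.

(** * Inserting vertices *)

Section Insertion.
Context {R : realType}.
Implicit Types (P Q G : graph R) (e x y : R3 R) (s t r : R).

Lemma affine_par (a b t : R) : a < b -> 0 <= t <= 1 -> a <= a + t * (b - a) <= b.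
Proof.
move=> ab /andP[t0 t1].
have h1 : 0 <= t * (b - a) by rewrite mulr_ge0//; lra.
have h2 : 0 <= (1 - t) * (b - a) by rewrite mulr_ge0//; lra.
by rewrite mulrBl mul1r in h2; lra.
Qed.

Lemma affine_par_lt (a b t : R) : a < b -> 0 < t < 1 -> a < a + t * (b - a) < b.
Proof.
move=> ab /andP[t0 t1].
have h1 : 0 < t * (b - a) by rewrite mulr_gt0//; lra.
have h2 : 0 < (1 - t) * (b - a) by rewrite mulr_gt0//; lra.
by rewrite mulrBl mul1r in h2; lra.
Qed.

Lemma affine_cts P (i : 'I_(ne P)) (a b : R) : continuous_graph P -> 0 <= a -> a < b -> b <= 1 ->
  {within `[(0 : R), 1]%classic, continuous (fun t => curve i (a + t * (b - a)))}.
Proof.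
move=> hP a0 ab b1; apply/subspace_continuousP => s /=; rewrite in_itv/= => s01 U nU.
have sab := affine_par ab s01.
have nU' : nbhs (curve i (a + s * (b - a))) U by exact: nU.
have [|d d0 h] := near_curve hP _ nU'; first lra.
exists d => //= r; rewrite in_itv/= => sr r01.
change (U (curve i (a + r * (b - a)))); apply: h.
  by have := affine_par ab r01; lra.
have -> : a + r * (b - a) - (a + s * (b - a)) = (r - s) * (b - a) by ring.
rewrite normrM distrC (gtr0_norm (_ : 0 < b - a)) ?subr_gt0//.
by apply: le_lt_trans sr; rewrite ler_piMr//=; lra.
Qed.

Section OnePoint.
Variables (P : graph R) (hP : continuous_graph P) (i0 : 'I_(ne P)) (tau : R).
Hypothesis tau01 : 0 < tau < 1.

(** Every edge of the new graph is the part between two parameters of an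
    old edge: the edge [i0] keeps its initial part, and its final part is the
    additional edge [ord_max]. *)
Definition ins_part (i : 'I_(ne P).+1) : 'I_(ne P) * R * R :=
  if unlift ord_max i is Some j then (j, 0, if j == i0 then tau else 1) else (i0, tau, 1).

Definition ins_curve i s : R3 R :=
  let: (j, a, b) := ins_part i in curve j (a + s * (b - a)).

Definition ins_vtx (v : 'I_(nv P).+1) : R3 R :=
  if unlift ord_max v is Some w then vtx w else curve i0 tau.

Definition ins_endpt (c : bool) (i : 'I_(ne P).+1) : 'I_(nv P).+1 :=
  if unlift ord_max i is Some j then
    if (j == i0) && c then ord_max else lift ord_max (endpt c j)
  else if c then lift ord_max (endpt true i0) else ord_max.

Definition insertion : graph R := Graph ins_vtx ins_endpt ins_curve.

Lemma ins_partP i : [/\ 0 <= (ins_part i).1.2, (ins_part i).1.2 < (ins_part i).2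
  & (ins_part i).2 <= 1].
Proof.
case/andP: tau01 => t0 t1; rewrite /ins_part; case: (unlift _ _) => [j|] /=.
  by case: eqP => _; split; rewrite ?lexx ?ltr01 ?ler01 ?ltW.
by split; rewrite ?lexx ?ltW.
Qed.

Lemma ins_curveE i s : ins_curve i s = curve (ins_part i).1.1
  ((ins_part i).1.2 + s * ((ins_part i).2 - (ins_part i).1.2)).
Proof. by rewrite /ins_curve; case: ins_part => [[]]. Qed.

Lemma ins_par01 i s : 0 <= s <= 1 ->
  (ins_part i).1.2 <= (ins_part i).1.2 + s * ((ins_part i).2 - (ins_part i).1.2) <= (ins_part i).2.
Proof. by have [_ ab _] := ins_partP i; exact: affine_par. Qed.

Lemma ins_par01_lt i s : 0 < s < 1 ->
  (ins_part i).1.2 < (ins_part i).1.2 + s * ((ins_part i).2 - (ins_part i).1.2) < (ins_part i).2.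
Proof. by have [_ ab _] := ins_partP i; exact: affine_par_lt. Qed.

Lemma ins_cts i : {within `[(0 : R), 1]%classic, continuous (ins_curve i)}.
Proof.
have -> : ins_curve i = _ := funext (ins_curveE i).
by have [a0 ab b1] := ins_partP i; exact: affine_cts.
Qed.

Lemma ins_inj (i j : 'I_(ne P).+1) s t : 0 < s < 1 -> 0 <= t <= 1 ->
  ins_curve i s = ins_curve j t -> i = j /\ s = t.
Proof.
move=> s01 t01; rewrite !ins_curveE.
have ps := ins_par01_lt i s01; have pt := ins_par01 j t01.
have [a0 ab b1] := ins_partP i; have [a0' ab' b1'] := ins_partP j.
move=> /(curve_inj hP)[||oo pp]; [by lra|by lra|].
have ij : i = j.
  move: oo ps pt; rewrite pp /ins_part; case: unliftP => [i'|] ->; case: unliftP => [j'|] -> //=.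
  - by move=> ->.
  - by move=> ->; rewrite eqxx => h1 h2; exfalso; lra.
  - by move=> <-; rewrite eqxx => h1 h2; exfalso; lra.
split=> //; move: pp; rewrite ij => /addrI/mulIf; apply.
by rewrite subr_eq0 gt_eqF.
Qed.

Let edge_adj i c : adjacent_vertices (G := insertion) (ins_endpt c i) (ins_endpt (~~ c) i).
Proof. by apply/existsP; exists i; apply/existsP; exists c; rewrite !eqxx. Qed.

(** The only old edge that disappears is replaced by a path through the new
    vertex. *)
Let conn_edge c j : connect (@adjacent_vertices _ insertion)
  (lift ord_max (endpt c j)) (lift ord_max (endpt (~~ c) j)).
Proof.
have e1 c' : ins_endpt c' ord_max = if c' then lift ord_max (endpt true i0) else ord_max.
  by rewrite /ins_endpt unlift_none.
have e2 c' k : ins_endpt c' (lift ord_max k) =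
    if (k == i0) && c' then ord_max else lift ord_max (endpt c' k).
  by rewrite /ins_endpt liftK.
have [->|ji] := eqVneq j i0; last first.
  by apply: connect1; have := edge_adj (lift ord_max j) c; rewrite !e2 (negbTE ji).
case: c => /=; apply: (@connect_trans _ _ (ord_max : 'I_(nv insertion))); apply: connect1.
- by have := edge_adj ord_max true; rewrite !e1.
- by have := edge_adj (lift ord_max i0) true; rewrite !e2 eqxx.
- by have := edge_adj (lift ord_max i0) false; rewrite !e2 eqxx.
- by have := edge_adj ord_max false; rewrite !e1.
Qed.

Let conn_lift u v : connect (@adjacent_vertices _ insertion) (lift ord_max u) (lift ord_max v).
Proof.
case: hP => _ /(_ u v)/connectP[p pp ->] _ _ _ {v}.
elim: p u pp => //= w p IH u /andP[/existsP[i /existsP[c /andP[/eqP<- /eqP<-]]] /IH].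
exact: connect_trans (conn_edge c i).
Qed.

Lemma ins_continuous : continuous_graph insertion.
Proof.
have new c : connect (@adjacent_vertices _ insertion)
    (if c then ord_max else lift ord_max (endpt false i0))
    (if c then lift ord_max (endpt false i0) else ord_max).
  have := edge_adj (lift ord_max i0) c; rewrite /ins_endpt liftK eqxx /=.
  by case: c => /connect1.
split.
- by [].
- move=> u v; have [u' ->|->] := unliftP ord_max u; have [v' ->|->] := unliftP ord_max v.
  + exact: conn_lift.
  + exact: connect_trans (conn_lift _ _) (new false).
  + exact: connect_trans (new true) (conn_lift _ _).
  + exact: connect0.
- exact: ins_cts.
- move=> i c; rewrite /= ins_curveE /ins_part /ins_vtx /ins_endpt.
  case: unliftP => [j|] _ /=; case: c; rewrite ?(mul0r, mul1r, addr0, add0r, subr0).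
  + case: eqP => [->|_] /=; first by rewrite unlift_none.
    by rewrite liftK curve1.
  + by rewrite andbF liftK curve0.
  + by rewrite liftK addrC subrK curve1.
  + by rewrite unlift_none.
- split; last exact: ins_inj.
  move=> u v /=; rewrite /ins_vtx.
  have nV : ~ vset P (curve i0 tau) by exact: curve_notin_vset.
  case: (unliftP _ u) => [u' ->|->]; case: (unliftP _ v) => [v' ->|->] //.
  + by move/(vtx_inj hP) => ->.
  + by move=> h; case: nV; exists u'.
  + by move=> h; case: nV; exists v'.
Qed.

Lemma ins_graph_set : graph_set insertion = graph_set P.
Proof.
rewrite eqEsubset; split => [x [i _ [s /= + <-]]|x [i _ [s /= + <-]]]; rewrite in_itv/= => s01.
  rewrite ins_curveE; exists (ins_part i).1.1 => //; eexists; last by [].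
  have := ins_par01 i s01; have [] := ins_partP i => *.
  by rewrite /= in_itv/=; lra.
have [ii|ii] := eqVneq i i0; last first.
  exists (lift ord_max i : 'I_(ne insertion)) => //; exists s; first by rewrite /= in_itv.
  by rewrite /= ins_curveE /ins_part liftK/= (negbTE ii) add0r subr0 mulr1.
have [st|ts] := leP s tau.
  exists (lift ord_max i : 'I_(ne insertion)) => //; exists (s / tau).
    case/andP: tau01 => t0 _; have s0 : 0 <= s by lra.
    by rewrite /= in_itv/= (divr_ge0 s0 (ltW t0)) ler_pdivrMr// mul1r.
  rewrite /= ins_curveE /ins_part liftK/= ii eqxx add0r subr0 divfK//.
  by rewrite gt_eqF//; case/andP: tau01.
exists (ord_max : 'I_(ne insertion)) => //; exists ((s - tau) / (1 - tau)).
  have t1 : 0 < 1 - tau by lra.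
  have s0 : 0 <= s - tau by lra.
  by rewrite /= in_itv/= (divr_ge0 s0 (ltW t1)) ler_pdivrMr// mul1r; lra.
rewrite /= ins_curveE /ins_part unlift_none/= divfK ?gt_eqF ?subr_gt0//; last first.
  by case/andP: tau01.
by rewrite ii addrC subrK.
Qed.

Lemma ins_vset : vset insertion = vset P `|` [set curve i0 tau].
Proof.
rewrite eqEsubset; split => [x [v _ <-]|x [[v _ <-]|->]] /=.
- by rewrite /ins_vtx; case: unliftP => [w|] _; [left; exists w|right].
- by exists (lift ord_max v : 'I_(nv insertion)); rewrite //= /ins_vtx liftK.
- by exists (ord_max : 'I_(nv insertion)); rewrite //= /ins_vtx unlift_none.
Qed.

End OnePoint.

Theorem insert_points P (A : set (R3 R)) : continuous_graph P -> finite_set A ->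
  A `<=` graph_set P -> exists Q, [/\ continuous_graph Q, graph_set P = graph_set Q
    & vset Q = vset P `|` A].
Proof.
move=> hP /finite_seqP[F ->] {A}; elim: F => [|x F IH] sub.
  exists P; split => //; rewrite -[LHS]setU0; congr (_ `|` _).
  by rewrite eqEsubset; split=> x //=; rewrite in_nil.
have [|Q [hQ PQ vQ]] := IH.
  by move=> y /= yF; apply: sub; rewrite /= inE yF orbT.
have xQ : graph_set Q x by rewrite -PQ; apply: sub; rewrite /= inE eqxx.
have FE : vset P `|` [set` x :: F] = vset Q `|` [set x].
  rewrite vQ -setUA; congr (_ `|` _); rewrite eqEsubset; split=> y /=; rewrite inE.
    by move=> /orP[/eqP|]; [right|left].
  by case=> [->|->]; rewrite ?eqxx ?orbT.
case: (graph_set_split hQ xQ) => [Vx|[i [t /=]]].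
  exists Q; split => //; rewrite FE; apply/esym/setUidPl => _ -> //.
rewrite in_itv/= => t01 tx; exists (@insertion Q i t); split.
- exact: ins_continuous.
- by rewrite ins_graph_set.
- by rewrite FE ins_vset tx.
Qed.

End Insertion.

(** * Subdivisions and their edge ends *)

Section Refinement.
Context {R : realType}.
Implicit Types (P Q G : graph R) (e x y : R3 R) (s t r : R).

(** The last clause cuts the loops. *)
Definition subdivides Q G : Prop :=
  [/\ continuous_graph Q, graph_set G = graph_set Q, vset G `<=` vset Q
    & forall i : 'I_(ne G), exists2 t, 0 < t < 1 & vset Q (curve i t)].

Section Structure.
Variables (G Q : graph R) (hG : continuous_graph G) (sQ : subdivides Q G).

Let hQ : continuous_graph Q. Proof. by case: sQ. Qed.
Let GQ : graph_set G = graph_set Q. Proof. by case: sQ. Qed.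
Let VGQ : vset G `<=` vset Q. Proof. by case: sQ. Qed.

Lemma vset_curve_end (i : 'I_(ne G)) (c : bool) : vset Q (curve i c%:R).
Proof. by apply: VGQ; rewrite curve_end//; eexists. Qed.

Lemma gap_mid V (i : 'I_(ne G)) s t : is_gap V i s t -> s < (s + t) / 2 < t.
Proof. by move=> [/andP[s0 st] _ _ _ _]; lra. Qed.

Lemma edge_gap (k : 'I_(ne Q)) : exists (i : 'I_(ne G)) s t b,
  is_gap (vset Q) i s t /\ spans k b i s t.
Proof.
have ok : oarc k (curve k (1/2)) by exists (1/2) => //=; rewrite in_itv/=; lra.
have nV := oarc_notin_vset hQ ok.
have := arc_graph (oarc_arc ok); rewrite -GQ => /(graph_set_split hG)[/VGQ//|[i [r /=]]].
rewrite in_itv/= => r01 re.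
have [|||||s [t [g srt _ _]]] := @gap_around _ G Q hG i 0 r 1; try lra.
- exact: (vset_curve_end i false).
- exact: (vset_curve_end i true).
- by rewrite re.
have [k' [b sp]] := gap_spanned hG hQ GQ g.
exists i, s, t, b; split=> //; suff -> : k = k' by [].
by apply: (oarc_arc_inj hQ ok); have [-> _ _] := sp; exists r => //=; rewrite in_itv/=; lra.
Qed.

(** Two equal ends would make the gap a whole loop, which contains a vertex
    of Q in its interior. *)
Lemma gap_neq (i : 'I_(ne G)) s t : is_gap (vset Q) i s t -> curve i s <> curve i t.
Proof.
move=> [/andP[s0 st] t1 Vs Vt nV] e.
have [s0'|] := boolP (0 < s).
  by have [|||_] := @curve_inj _ G hG i i s t; [lra|lra|by []|lra].
rewrite -leNgt => s0'; have [t1'|] := boolP (t < 1).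
  by have [|||_] := @curve_inj _ G hG i i t s; [lra|lra|by []|lra].
rewrite -leNgt => t1'; case: sQ => _ _ _ /(_ i)[r r01 Vr].
by apply: (nV r) => //; lra.
Qed.

Lemma gap_uniq (i : 'I_(ne G)) s t s' t' r : is_gap (vset Q) i s t -> is_gap (vset Q) i s' t' ->
  s < r < t -> s' <= r <= t' -> s = s' /\ t = t'.
Proof.
move=> [/andP[s0 st] t1 Vs Vt nV] [/andP[s0' st'] t1' Vs' Vt' nV'] srt srt'.
have sr' : s' != r by apply/eqP => e; apply: (nV r) => //; rewrite -e.
have rt' : r != t' by apply/eqP => e; apply: (nV r) => //; rewrite e.
move: srt'; rewrite !le_eqVlt (negbTE sr') (negbTE rt') /= => srt'.
split; apply/eqP; rewrite eq_le !leNgt; apply/andP; split; apply/negP => h.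
- by apply: (nV' s) => //; lra.
- by apply: (nV s') => //; lra.
- by apply: (nV t') => //; lra.
- by apply: (nV' t) => //; lra.
Qed.

Lemma spans_inj (k k' : 'I_(ne Q)) b b' (i i' : 'I_(ne G)) s t s' t' r :
  is_gap (vset Q) i s t -> is_gap (vset Q) i' s' t' ->
  spans k b i s t -> spans k' b' i' s' t' -> k = k' -> [/\ i = i', s = s', t = t' & b = b'].
Proof.
move=> g g' [kE bs bt] [kE' bs' bt'] kk; subst k'.
have m := gap_mid g; set mid := (s + t) / 2 in m.
have : arc_set k (curve i mid) by rewrite kE; exists mid => //=; rewrite in_itv/=; lra.
rewrite kE' => -[u /=]; rewrite in_itv/= => ust /esym ue.
have [||ii mu] := curve_inj hG _ _ ue.
- by case: g => *; lra.
- by case: g' => *; lra.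
subst i'; rewrite -mu in ust; have [ss tt] := gap_uniq g g' m ust.
split=> //; subst s' t'; apply: contrapT => /eqP bb.
have bn : b' = ~~ b by case: (b) (b') bb => [] [].
by apply: (gap_neq g); rewrite -bt -bs' bn.
Qed.

Lemma spans_inj_edge (k k' : 'I_(ne Q)) b b' (i : 'I_(ne G)) s t :
  is_gap (vset Q) i s t -> spans k b i s t -> spans k' b' i s t -> k = k'.
Proof.
move=> g [kE bs bt] [kE' bs' bt'].
have m := gap_mid g; set mid := (s + t) / 2 in m.
have hk : arc_set k (curve i mid) by rewrite kE; exists mid => //=; rewrite in_itv/=; lra.
have hk' : arc_set k' (curve i mid) by rewrite kE'; exists mid => //=; rewrite in_itv/=; lra.
have [_ _ _ _ /(_ mid m) nV] := g.
apply: (@oarc_arc_inj _ Q hQ k k' (curve i mid)) => //.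
by case: (arc_split hQ hk) => // he; case: nV; rewrite he; eexists.
Qed.

Lemma no_loop (k : 'I_(ne Q)) : endpt false k <> endpt true k.
Proof.
have [i [s [t [b [g [_ bs bt]]]]]] := edge_gap k => e.
by apply: (gap_neq g); rewrite -bs -bt; case: (b); rewrite /= e.
Qed.

(** The directions in which G leaves the point x: the component [a.2] is
    [false] for the direction of increasing parameters on the edge [a.1] and
    [true] for the opposite one, as for the ends of the edges. *)
Definition germ_at x (a : 'I_(ne G) * bool) : bool :=
  `[< exists t, [/\ 0 <= t <= 1, curve a.1 t = x & if a.2 then 0 < t else t < 1] >].

(** The edge of Q with end [k] starts along the edge [a.1] of G in the
    direction [a.2]. The orientation [k.2 (+) a.2] makes the end [k] the first
    point of the gap if [a.2] is [false], and its last point otherwise. *)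
Definition leaves_along (k : 'I_(ne Q) * bool) (a : 'I_(ne G) * bool) : Prop :=
  exists s t, is_gap (vset Q) a.1 s t /\ spans k.1 (k.2 (+) a.2) a.1 s t.

Lemma leaves_ex k : exists a, leaves_along k a.
Proof.
case: k => k c; have [i [s [t [b [g sp]]]]] := edge_gap k.
by exists (i, c (+) b), s, t; rewrite /= addbA addbb.
Qed.

Lemma leaves_fun k a a' : leaves_along k a -> leaves_along k a' -> a = a'.
Proof.
case: k a a' => [k c] [i b] [i' b'] [s [t [g sp]]] [s' [t' [g' sp']]].
by have [/= -> _ _ /addbI->] := spans_inj 0 g g' sp sp' erefl.
Qed.

Lemma leaves_germ k a : leaves_along k a -> germ_at (vtx (end_vertex k)) a.
Proof.
case: k a => [k c] [i b] [s [t [[/andP[s0 st] t1 _ _ _] [_ /= ps pt]]]].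
apply/asboolP; rewrite /end_vertex /=; case: b ps pt => /=.
  by rewrite addbT negbK => _ pt; exists t; split; rewrite ?pt//; lra.
by rewrite addbF => ps _; exists s; split; rewrite ?ps//; lra.
Qed.

Lemma germ_param (i : 'I_(ne G)) (b : bool) t t' : 0 <= t <= 1 -> 0 <= t' <= 1 ->
  curve i t = curve i t' -> (if b then 0 < t else t < 1) -> (if b then 0 < t' else t' < 1) ->
  t = t'.
Proof.
move=> t01 t01' tt ht ht'.
have [t0|] := boolP (0 < t < 1); first by have [_] := curve_inj hG t0 t01' tt.
have [t0'|] := boolP (0 < t' < 1); first by have [_] := curve_inj hG t0' t01 (esym tt).
by case: b ht ht' => ht ht'; rewrite ?ht ?ht' ?andbT /= -leNgt => h -; rewrite -leNgt => h'; lra.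
Qed.

Lemma leaves_inj k k' a : leaves_along k a -> leaves_along k' a ->
  end_vertex k = end_vertex k' -> k = k'.
Proof.
case: k k' a => [k c] [k' c'] [i b] [s [t [/= g sp]]] [s' [t' [/= g' sp']]].
rewrite /end_vertex/= => ev.
have [[/andP[s0 st] t1 Vs Vt nV] [/andP[s0' st'] t1' Vs' Vt' nV']] := (g, g').
have [ss tt] : s = s' /\ t = t'.
  have [_ /= ps pt] := sp; have [_ /= ps' pt'] := sp'.
  case: b ps pt ps' pt' {sp sp'} => /=; rewrite ?addbT ?addbF ?negbK => ps pt ps' pt'.
    have tt : t = t'.
      by apply: (@germ_param i true); [lra|lra|rewrite -pt -pt' ev|lra|lra].
    subst t'; apply: (gap_uniq (r := (Num.max s s' + t) / 2) g g');
    by case: (leP s s') => h; lra.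
  have ss : s = s'.
    by apply: (@germ_param i false); [lra|lra|rewrite -ps -ps' ev|lra|lra].
  subst s'; apply: (gap_uniq (r := (s + Num.min t t') / 2) g g');
  by case: (leP t t') => h; lra.
subst s' t'; have kk := spans_inj_edge g sp sp'.
by have [_ _ _ /addIb->] := spans_inj 0 g g' sp sp' kk; rewrite kk.
Qed.

Lemma germ_leaves (v : 'I_(nv Q)) a : germ_at (vtx v) a ->
  exists2 k, end_vertex k = v & leaves_along k a.
Proof.
case: a => i b /asboolP[r [r01 /= rv hb]].
have Vr : vset Q (curve i r) by rewrite rv; exists v.
have [s [t [g rst]]] : exists s t, is_gap (vset Q) i s t /\ r = if b then t else s.
  (* A step function whose only drop is next to r forces the gap to end, or to
     start, at r. *)
  case: b hb => hr.
    pose h (z : R) : R := if z < r then 1 else 0.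
    have [|||||s [t [g us tw hst]]] := @gap_descent _ G Q hG i h 0 r; [lra|lra| |by []| |].
    - exact: (vset_curve_end i false).
    - by rewrite /h hr ltxx ltr01.
    exists s, t; split=> //; apply/eqP; rewrite eq_le tw andbT leNgt; apply/negP => tr.
    by move: hst; rewrite /h tr; case: ifP; rewrite ?ltxx ?ltr10.
  pose h (z : R) : R := if z <= r then 1 else 0.
  have [|||||s [t [g us tw hst]]] := @gap_descent _ G Q hG i h r 1; [lra|lra|by []| | |].
  - exact: (vset_curve_end i true).
  - by rewrite /h lexx leNgt hr /= ltr01.
  exists s, t; split=> //; apply/eqP; rewrite eq_le us/= leNgt; apply/negP => tr.
  by move: hst; rewrite /h (leNgt s) tr /=; case: ifP; rewrite ?ltxx ?ltr10.
have [k [c sp]] := gap_spanned hG hQ GQ g.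
exists (k, c (+) b); last by exists s, t; rewrite /= -addbA addbb addbF.
apply: (vtx_inj hQ); rewrite /end_vertex /= -rv rst.
by case: sp => _; case: (b) => /=; rewrite ?addbT ?addbF.
Qed.

(** The edge ends of Q at a vertex correspond one-to-one to the directions
    in which G leaves this point: they are the first pieces, up to the next
    vertex of Q. *)
Lemma sum_germs (V : nmodType) (v : 'I_(nv Q)) (F : 'I_(ne Q) * bool -> V)
    (F' : 'I_(ne G) * bool -> V) :
  (forall k a, end_vertex k = v -> leaves_along k a -> F k = F' a) ->
  \sum_(k | end_vertex k == v) F k = \sum_(a | germ_at (vtx v) a) F' a.
Proof.
move=> FF'; have [f fP] := choice leaves_ex.
have finj : {in [set k | end_vertex k == v]%SET &, injective f}.
  move=> k k'; rewrite !inE => /eqP kv /eqP kv' ff.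
  by apply: (@leaves_inj _ _ (f k)); rewrite ?kv ?kv'// ff.
transitivity (\sum_(a in f @: [set k | end_vertex k == v]%SET) F' a).
  rewrite big_imset//=; apply: eq_big => [k|k /eqP kv]; first by rewrite inE.
  exact: FF'.
apply: eq_bigl => a; apply/imsetP/idP => [[k]|/germ_leaves[k kv lk]].
  by rewrite inE => /eqP<- ->; exact: leaves_germ.
by exists k; [rewrite inE kv|exact: leaves_fun lk (fP k)].
Qed.

Lemma germ_vertex (u : 'I_(nv G)) a : germ_at (vtx u) a = (end_vertex a == u).
Proof.
case: a => i b; apply/asboolP/eqP => [[t [t01 /= tu hb]]|<-].
  have tb : t = b%:R.
    have [h|] := boolP (0 < t < 1).
      by case: (curve_notin_vset hG (i := i) h); rewrite tu; eexists.
    by case: b hb => h; rewrite h ?andbT /= -leNgt => h'; rewrite /=; lra.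
  by apply: (vtx_inj hG); rewrite -tu tb curve_end.
exists b%:R; rewrite curve_end//=; split=> //; case: b; rewrite ?lexx ?ler01 ?ltr01//.
Qed.

Lemma germ_interior (i : 'I_(ne G)) t a : 0 < t < 1 -> germ_at (curve i t) a = (a.1 == i).
Proof.
case: a => j b t01; apply/asboolP/eqP => [[s [s01 /= st hb]]| /= ->].
  by have [] := curve_inj hG t01 s01 (esym st).
by exists t; split=> //=; [lra|case: b; lra].
Qed.

Lemma sum_end_vertex (V : nmodType) (v : 'I_(nv Q)) (u : 'I_(nv G))
    (F : 'I_(ne Q) * bool -> V) (F' : 'I_(ne G) * bool -> V) : vtx v = vtx u ->
  (forall k a, end_vertex k = v -> leaves_along k a -> F k = F' a) ->
  \sum_(k | end_vertex k == v) F k = \sum_(a | end_vertex a == u) F' a.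
Proof. by move=> vu /sum_germs->; apply: eq_bigl => a; rewrite vu germ_vertex. Qed.

Lemma sum_interior (V : nmodType) (v : 'I_(nv Q)) (i : 'I_(ne G)) t
    (F : 'I_(ne Q) * bool -> V) (F' : 'I_(ne G) * bool -> V) :
  0 < t < 1 -> curve i t = vtx v ->
  (forall k a, end_vertex k = v -> leaves_along k a -> F k = F' a) ->
  \sum_(k | end_vertex k == v) F k = F' (i, true) + F' (i, false).
Proof.
move=> t01 tv /sum_germs->.
transitivity (\sum_(a | (a.1 == i) && true) F' a).
  by apply: eq_bigl => a; rewrite -tv germ_interior// andbT.
rewrite (eq_bigr (fun a => F' (a.1, a.2))); last by case.
by rewrite -(pair_big (pred1 i) xpredT (fun j c => F' (j, c)))/= big_pred1_eq big_bool.
Qed.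

Lemma degree_vertex (v : 'I_(nv Q)) (u : 'I_(nv G)) : vtx v = vtx u -> degree v = degree u.
Proof.
move=> vu; rewrite /degree -!sum1_card.
by apply: (sum_end_vertex (V := nat) (F := fun=> 1%N) (F' := fun=> 1%N)).
Qed.

Lemma degree_interior (v : 'I_(nv Q)) (i : 'I_(ne G)) t : 0 < t < 1 -> curve i t = vtx v ->
  degree v = 2%N.
Proof.
move=> t01 tv; rewrite /degree -sum1_card.
exact: (sum_interior (V := nat) (F := fun=> 1%N) (F' := fun=> 1%N) t01 tv).
Qed.

(** Degrees are counted by germs, so they do not depend on the
    subdivision. *)
Lemma subdivides_approximating : approximating G Q.
Proof.
split=> //; first exact: no_loop.
move=> x d; split=> [[d2 [v [vx vd]]]|[d2 [u [ux ud]]]]; split=> //.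
  have : graph_set G x by rewrite GQ -vx; apply: (vset_graph hQ); eexists.
  move=> /(graph_set_split hG)[[u _ ux]|[i [t /=]]].
    by exists u; rewrite -(@degree_vertex v u)// vx ux.
  rewrite in_itv/= => t01 tx; case: d2.
  by rewrite -vd (@degree_interior v i t t01)// tx vx.
have [v _ vx] : vset Q x by apply: VGQ; exists u.
by exists v; rewrite (@degree_vertex v u)// vx ux.
Qed.

End Structure.
End Refinement.

(** * Subdivisions with small arcs *)

Section Mesh.
Context {R : realType}.
Implicit Types (P Q G : graph R) (e : R3 R) (s t : R).

(** The norm of a product is the maximum norm. *)
Lemma enorm_le (x : R3 R) : enorm x <= 3 * `|x|.
Proof.
have h0 : 0 <= 3 * `|x| by rewrite mulr_ge0.
rewrite -[leRHS](ger0_norm h0) -sqrtr_sqr /enorm ler_sqrt ?sqr_ge0//.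
have [n1 n2] : `|x.1| <= `|x| /\ `|x.2| <= `|x|.
  by split; rewrite [leRHS]prod_normE le_max lexx ?orbT.
have [n11 n12] : `|x.1.1| <= `|x| /\ `|x.1.2| <= `|x|.
  by split; apply: le_trans n1; rewrite [leRHS]prod_normE le_max lexx ?orbT.
have sq (z : R) : `|z| <= `|x| -> z * z <= `|x| ^+ 2.
  by move=> h; rewrite -expr2 -real_normK ?num_real// ler_sqr ?nnegrE.
have := sq _ n11; have := sq _ n12; have := sq _ n2.
have := sqr_ge0 `|x|; rewrite /dot exprMn; lra.
Qed.

(** The sets of rationals from which parameters of new vertices may be
    chosen. *)
Definition dense_rats (A : rat -> Prop) :=
  forall a b : R, a < b -> exists2 r : rat, a < ratr r < b & A r.

(** By compactness, finitely many intervals on which the curve oscillates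
    little, taken of half their size, cover the edge; marking a point of A in
    the outer quarters of each of them leaves no large gap. *)
Lemma edge_mesh_points G (i : 'I_(ne G)) (d : R) (A : rat -> Prop) :
  continuous_graph G -> 0 < d -> dense_rats A ->
  exists N : set rat, [/\ finite_set N, forall r, N r -> (0 : R) < ratr r < (1 : R),
     forall r, N r -> A r &
     forall s t, 0 <= s -> t <= 1 -> s < t -> (forall r, N r -> ~ s < ratr r < t) ->
     forall u v, s <= u <= t -> s <= v <= t -> enorm (curve i u - curve i v) <= d].
Proof.
move=> hG d0 dA.
have loc (x : R) : exists del : R, 0 < del /\ (0 <= x <= 1 -> forall u v, 0 <= u <= 1 -> 0 <= v <= 1 ->
    `|u - x| < del -> `|v - x| < del -> enorm (curve i u - curve i v) <= d).
  have [x01|nx01] := boolP (0 <= x <= 1); last by exists 1; split.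
  (* two radii of d / 6 in the maximum norm, times the factor 3 of enorm_le *)
  have b0 : 0 < d / 6 by rewrite divr_gt0.
  have [del del0 h] := near_curve hG x01 (nbhsx_ballx (curve i x) _ b0).
  exists del; split=> // _ u v u01 v01 ux vx.
  apply: le_trans (enorm_le _) _.
  have : `|curve i u - curve i v| <= d / 6 + d / 6; last by lra.
  rewrite -(subrKA (curve i x)); apply: le_trans (ler_normD _ _) _; apply: lerD; apply: ltW.
    by have := h u u01 ux; rewrite prod_norm_ball /ball_/= distrC.
  by have := h v v01 vx; rewrite prod_norm_ball /ball_/=.
have [del delP] := choice loc.
have rats (x : R) : exists lr : rat * rat, [/\ A lr.1, A lr.2, x - del x < ratr lr.1 < x - del x / 2
    & x + del x / 2 < ratr lr.2 < x + del x].
  have [del0 _] := delP x.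
  have [|l lP Al] := dA (x - del x) (x - del x / 2); first lra.
  have [|r rP Ar] := dA (x + del x / 2) (x + del x); first lra.
  by exists (l, r).
have [lr lrP] := choice rats.
have := @segment_compact R 0 1; rewrite compact_cover.
move=> /(_ R `[0, 1]%classic (fun x : R => `]x - del x / 2, x + del x / 2[%classic))[].
- by move=> x _; exact: interval_open.
- move=> x x01; exists x => //=; rewrite in_itv/=.
  by have [del0 _] := delP x; lra.
move=> D sD cov.
pose N := [set r : rat | (0 : R) < ratr r < (1 : R)] `&`
   ((fun x : R => (lr x).1) @` [set` D] `|` (fun x : R => (lr x).2) @` [set` D]).
exists N; split.
- apply: finite_setIr; rewrite finite_setU; split; apply: finite_image; exact: finite_fset.
- by move=> r [].
- by move=> r [_ [[x _ <-]|[x _ <-]]]; have [] := lrP x.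
move=> s t s0 t1 st nN u v ust vst.
have [|x /= xD] := cov ((s + t) / 2); first by rewrite /= in_itv/=; lra.
rewrite in_itv/= => mx.
have [_ _ lx rx] := lrP x; have [del0 dx] := delP x.
have x01 : 0 <= x <= 1 by have := sD _ xD; rewrite mem_setE.
have sl : ratr (lr x).1 <= s.
  have [h|h] := leP (ratr (lr x).1 : R) 0; first lra.
  rewrite leNgt; apply/negP => h'; apply: (nN (lr x).1); last lra.
  by split; [rewrite /=; lra|left; exists x].
have tr : t <= ratr (lr x).2.
  have [h|h] := leP 1 (ratr (lr x).2 : R); first lra.
  rewrite leNgt; apply/negP => h'; apply: (nN (lr x).2); last lra.
  by split; [rewrite /=; lra|right; exists x].
by apply: dx; rewrite ?ltr_norml; lra.
Qed.

Lemma mesh_points G (d : R) (A : 'I_(ne G) -> rat -> Prop) :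
  continuous_graph G -> 0 < d -> (forall i, dense_rats (A i)) ->
  exists N : 'I_(ne G) -> set rat, [/\ forall i, finite_set (N i),
     forall i r, N i r -> (0 : R) < ratr r < (1 : R), forall i r, N i r -> A i r &
     forall Q, subdivides Q G -> (forall i r, N i r -> vset Q (curve i (ratr r))) ->
       mesh_le Q d].
Proof.
move=> hG d0 dA.
have [N NP] := choice (fun i => @edge_mesh_points G i d (A i) hG d0 (dA i)).
exists N; split; try by move=> i; have [] := NP i.
move=> Q sQ NQ k x y; have [i [s [t [b [[st t1 _ _ nV] [-> _ _]]]]]] := edge_gap hG sQ k.
move=> [u /=]; rewrite in_itv/= => ust <- [v /=]; rewrite in_itv/= => vst <-.
have [_ _ _ h] := NP i; apply: (h s t) => //; [lra|lra|].
by move=> r Nr srt; apply: (nV (ratr r)) => //; exact: NQ.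
Qed.

Definition gap_regular G Q e := forall (i : 'I_(ne G)) s t,
  is_gap (vset Q) i s t -> dot e (curve i s) <> dot e (curve i t).

Lemma subdivides_regular G Q e : continuous_graph G -> subdivides Q G ->
  gap_regular G Q e -> regular_direction Q e.
Proof.
move=> hG sQ h k; have [i [s [t [b [g [_ bs bt]]]]]] := edge_gap hG sQ k.
have := h i s t g; rewrite -bs -bt /chord dotB /=.
by case: (b) => /= hne /eqP; rewrite subr_eq0 => /eqP; [|move/esym].
Qed.

Definition marked G (N : 'I_(ne G) -> set R) : set (R3 R) :=
  [set x | exists i s, N i s /\ curve i s = x].

Lemma marked_finite G (N : 'I_(ne G) -> set R) : (forall i, finite_set (N i)) ->
  finite_set (marked N).
Proof.
move=> fN; suff -> : marked N = \bigcup_(i in setT) (curve i @` N i).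
  by apply: bigcup_finite => [|i _]; [exact: finite_finset|exact: finite_image].
by rewrite eqEsubset; split => [x [i [s [Ns <-]]]|x [i _ [s Ns <-]]]; [exists i => //; exists s|exists i, s].
Qed.

Lemma subdivision_exists G (N : 'I_(ne G) -> set R) : continuous_graph G ->
  (forall i, finite_set (N i)) -> (forall i s, N i s -> 0 < s < 1) -> (forall i, N i !=set0) ->
  exists Q, subdivides Q G /\ vset Q = vset G `|` marked N.
Proof.
move=> hG fN N01 N0.
have [|Q [hQ GQ VQ]] := insert_points hG (marked_finite fN).
  move=> x [i [s [/N01 s01 <-]]]; exists i => //; exists s => //.
  by rewrite /= in_itv/=; lra.
exists Q; split; last exact: VQ.
split; [exact: hQ|exact: GQ|by rewrite VQ; exact: subsetUl|].
move=> i; have [s Ns] := N0 i; exists s; first exact: N01 Ns.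
by rewrite VQ; right; exists i, s.
Qed.

Lemma vset_interior G Q (N : 'I_(ne G) -> set R) : continuous_graph G ->
  (forall i s, N i s -> 0 < s < 1) ->
  vset Q = vset G `|` marked N ->
  forall (i : 'I_(ne G)) s, 0 < s < 1 -> vset Q (curve i s) <-> N i s.
Proof.
move=> hG N01 VQ i s s01; rewrite VQ; split=> [[/(curve_notin_vset hG s01)//|]|Ns].
  move=> [j [t [Nt /esym h]]]; have t01 := N01 _ _ Nt.
  have [|ij st] := curve_inj hG s01 _ h; first by case/andP: t01 => *; rewrite !ltW.
  by rewrite ij st.
by right; exists i, s.
Qed.

End Mesh.

(** * Refining sequences without horizontal chords *)

Section RefiningSequence.
Context {R : realType}.
Implicit Types (P Q G : graph R) (e : R3 R) (s t : R).

(** The parameters 0 and 1 are not compared because the edge may be a loop. *)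
Definition generic G e := forall (i : 'I_(ne G)) (a b : rat),
  0 < (ratr a : R) < 1 -> 0 <= (ratr b : R) <= 1 -> a != b ->
  dot e (curve i (ratr a)) <> dot e (curve i (ratr b)).

Lemma avoid_finite (F : seq R) (a b : R) : a < b ->
  exists a' b', [/\ a <= a', a' < b', b' <= b & forall x, a' < x < b' -> x \notin F].
Proof.
elim: F a b => [|x F IH] a b ab; first by exists a, b.
have [a' [b' [aa ab' bb nF]]] := IH a b ab.
have [xab|xab] := boolP (a' < x < b'); last first.
  exists a', b'; split=> // y yab; rewrite inE negb_or nF// andbT.
  by apply: contraNneq xab => <-.
exists a', x; split=> //; [lra|lra|move=> y yax].
by rewrite inE negb_or nF ?andbT ?lt_eqF//; lra.
Qed.

(** On one edge, each forbidden height is taken at one rational parameter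
    at most. *)
Lemma avoiding_heights G P e (i : 'I_(ne G)) : generic G e ->
  dense_rats (R := R) (fun r => 0 < (ratr r : R) < 1 ->
    forall x, vset P x -> dot e x <> dot e (curve i (ratr r))).
Proof.
move=> gen a b ab.
pose bad (v : 'I_(nv P)) : R := xget 0 [set s | exists r : rat,
  [/\ s = ratr r, 0 < s < 1 & dot e (vtx v) = dot e (curve i s)]].
have [a' [b' [aa ab' bb nF]]] := avoid_finite [seq bad v | v <- enum 'I_(nv P)] ab.
have [r] := rat_in_itvoo ab'; rewrite in_itv/= => rab.
exists r; first lra.
move=> r01 x [v _ <-] h; have := nF _ rab; apply/negP; rewrite negbK.
apply/mapP; exists v; first by rewrite mem_enum.
rewrite /bad; case: xgetP => [s sE [r' [sr s01 hs]]|/(_ (ratr r))]; last first.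
  by case; exists r.
rewrite sr; congr ratr; apply/eqP; apply: contrapT => /negP rr.
apply: (gen i r r' r01) => //; first by rewrite -sr; lra.
by rewrite -h hs sr.
Qed.

Section Step.
Variables (G P : graph R) (e : R3 R).
Hypotheses (hG : continuous_graph G) (gen : generic G e).

Lemma gapW (V W : set (R3 R)) (i : 'I_(ne G)) s t : V `<=` W ->
  V (curve i s) -> V (curve i t) -> is_gap W i s t -> is_gap V i s t.
Proof. by move=> VW Vs Vt [st t1 _ _ n]; split=> // r /n nW /VW. Qed.

(** The new vertices have rational parameters and heights different from
    those of the old vertices, so no new chord is horizontal. *)
Lemma regular_refinement (d : R) : subdivides P G -> gap_regular G P e -> 0 < d ->
  exists Q, [/\ subdivides Q G, gap_regular G Q e, vset P `<=` vset Q &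
    forall Q', subdivides Q' G -> vset Q `<=` vset Q' -> mesh_le Q' d].
Proof.
move=> sP rP d0.
have [N [fN N01 NA NM]] := mesh_points hG d0 (fun i => avoiding_heights P i gen).
pose M i := (ratr @` N i : set R).
have M01 i s : M i s -> 0 < s < 1 by move=> [r /N01 ? <-].
have fM i : finite_set (M i) by exact: finite_image.
have [hP GP VGP spl] := sP.
have [|Q [hQ PQ VQ]] := insert_points hP (marked_finite fM).
  move=> x [i [s [/M01 s01 <-]]]; rewrite -GP; exists i => //; exists s => //.
  by rewrite /= in_itv/=; lra.
have VPQ : vset P `<=` vset Q by rewrite VQ; exact: subsetUl.
have sQ : subdivides Q G.
  split=> //; [by rewrite GP|exact: subset_trans VPQ|].
  by move=> i; have [t t01 Vt] := spl i; exists t => //; exact: VPQ.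
have mk (i : 'I_(ne G)) s : 0 <= s <= 1 -> marked M (curve i s) -> exists2 r, N i r & s = ratr r.
  move=> s01 [j [t [[r Nr rt] ts]]]; have t01 : 0 < t < 1 by rewrite -rt; exact: N01 Nr.
  by have [ji <-] := curve_inj hG t01 s01 ts; exists r; rewrite -?ji.
exists Q; split=> //.
  move=> i s t g; have [/andP[s0 st] t1 Vs Vt nV] := g.
  have s01 : 0 <= s <= 1 by lra.
  have t01 : 0 <= t <= 1 by lra.
  move: Vs Vt; rewrite {1 2}VQ => -[Vs|Ms] [Vt|Mt].
  - by apply: rP; exact: gapW g.
  - by have [r Nr ->] := mk _ _ t01 Mt; exact: (NA i r Nr (N01 _ _ Nr) _ Vs).
  - by have [r Nr ->] := mk _ _ s01 Ms; apply/nesym; exact: (NA i r Nr (N01 _ _ Nr) _ Vt).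
  - have [r Nr sr] := mk _ _ s01 Ms; have [r' Nr' tr] := mk _ _ t01 Mt.
    rewrite sr tr; apply: gen; [exact: N01 Nr|by have := N01 _ _ Nr'; lra|].
    by apply/eqP => rr; move: st; rewrite sr tr rr ltxx.
move=> Q' sQ' QQ'; apply: NM => // i r Nr; apply: QQ'; rewrite VQ; right.
by exists i, (ratr r); split=> //; exists r.
Qed.

End Step.

Lemma height_cts G e (i : 'I_(ne G)) : continuous_graph G ->
  {within `[(0:R), 1]%classic, continuous (fun t => dot e (curve i t))}.
Proof.
move=> hG; apply/subspace_continuousP => t t01 /=; apply: continuous_cvg.
  exact: dot_continuous.
exact: (subspace_continuousP _ _).1 (curve_cts hG (i := i)) t t01.
Qed.

(** If an end of the arc realizes the maximum, it is chosen; otherwise the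
    maximum exceeds the heights of both ends strictly. *)
Lemma arc_max Q e (k : 'I_(ne Q)) : continuous_graph Q ->
  exists x, attains_max e (arc_set k) x /\
    ((exists b, x = vtx (endpt b k)) \/ forall b, dot e (vtx (endpt b k)) < dot e x).
Proof.
move=> hQ.
have [c c01 cmax] := EVT_max ler01 (@height_cts Q e k hQ).
have mx x : attains_max e (arc_set k) x -> forall b, dot e (vtx (endpt b k)) <= dot e x.
  by move=> [_ h] b; apply: h; exact: arc_end.
have cM : attains_max e (arc_set k) (curve k c).
  split; first by exists c.
  by move=> _ [t t01 <-]; exact: cmax.
have [/existsP[b /eqP hb]|/existsPn nb] :=
    boolP [exists b, dot e (vtx (endpt b k)) == dot e (curve k c)].
  exists (vtx (endpt b k)); split; last by left; exists b.
  by split; [exact: arc_end|case: cM => _ h y /h; rewrite hb].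
exists (curve k c); split=> //; right=> b.
by rewrite lt_neqAle nb mx.
Qed.

Lemma dotNl e (x : R3 R) : dot (- e) x = - dot e x.
Proof. by rewrite /dot /=; ring. Qed.

Lemma arc_min Q e (k : 'I_(ne Q)) : continuous_graph Q ->
  exists x, attains_min e (arc_set k) x /\
    ((exists b, x = vtx (endpt b k)) \/ forall b, dot e x < dot e (vtx (endpt b k))).
Proof.
move=> hQ; have [x [[kx h] hb]] := arc_max (- e) k hQ.
exists x; split; first by split=> // y /h; rewrite !dotNl lerN2.
by case: hb => [|hb]; [left|right=> b; have := hb b; rewrite !dotNl ltrN2].
Qed.

(** With the extrema chosen at an end whenever possible, the at most four
    vertices on an arc (its ends, the maximum and the minimum) have distinct
    heights. *)
Lemma extremal_refinement G Q e : continuous_graph G -> subdivides Q G -> gap_regular G Q e ->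
  exists P, [/\ subdivides P G, gap_regular G P e, vset Q `<=` vset P & adds_extrema e Q P].
Proof.
move=> hG sQ rQ; have [hQ GQ VGQ spl] := sQ.
have [x xP] := choice (fun k => @arc_max Q e k hQ).
have [y yP] := choice (fun k => @arc_min Q e k hQ).
have fin : finite_set (range x `|` range y).
  by rewrite finite_setU; split; apply: finite_image; exact: finite_finset.
have [|P [hP QP VP]] := insert_points hQ fin.
  by move=> z [] [k _ <-]; exists k => //; [case: (xP k) => [[]]|case: (yP k) => [[]]].
have QVP : vset Q `<=` vset P by rewrite VP; exact: subsetUl.
have sP : subdivides P G.
  split=> //; [by rewrite GQ|exact: subset_trans QVP|].
  by move=> i; have [t t01 Vt] := spl i; exists t => //; exact: QVP.
exists P; split=> //; last first.
  exists x, y; split; [by move=> k; case: (xP k)|by move=> k; case: (yP k)|].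
  by rewrite -/(vset P) VP setUA.
move=> i s t g; have [/andP[s0 st] t1 Vs Vt nV] := g.
have m := gap_mid g; set mid := (s + t) / 2 in m.
have [|||||s' [t' [g' mid' us tw]]] := @gap_around _ G Q hG i 0 mid 1; [lra|lra| | | |].
- exact: (vset_curve_end hG sQ i false).
- exact: (vset_curve_end hG sQ i true).
- by move=> /QVP; exact: nV.
have [s's tt'] : s' <= s /\ t <= t'.
  have [_ _ /QVP Vs' /QVP Vt' _] := g'; split; rewrite leNgt; apply/negP => h.
    by apply: (nV s') => //; lra.
  by apply: (nV t') => //; lra.
have [k [b sp]] := gap_spanned hG hQ GQ g'.
have inarc r : s <= r <= t -> arc_set k (curve i r).
  by move=> rst; case: sp => -> _ _; exists r; rewrite //= in_itv/=; lra.
pose pt (z : R3 R) := (exists b, z = vtx (endpt b k)).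
have pt_of z : arc_set k z -> vset Q z -> pt z.
  by move=> /(arc_split hQ)[->|->|/(oarc_notin_vset hQ)//]; [exists false|exists true].
have four z : arc_set k z -> vset P z -> [\/ pt z, z = x k | z = y k].
  move=> kz; rewrite VP => -[/(pt_of _ kz)|]; first by constructor 1.
  move=> [[j _ jz]|[j _ jz]].
    have [jk|jk] := eqVneq j k; first by constructor 2; rewrite -jk.
    constructor 1; apply: (pt_of _ kz); apply: contrapT => nQ; move/eqP: jk; apply.
    have jz' : arc_set j z by rewrite -jz; case: (xP j) => [[]].
    apply: (oarc_arc_inj hQ _ kz).
    by case: (arc_split hQ jz') => // ze; case: nQ; rewrite ze; eexists.
  have [jk|jk] := eqVneq j k; first by constructor 3; rewrite -jk.
  constructor 1; apply: (pt_of _ kz); apply: contrapT => nQ; move/eqP: jk; apply.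
  have jz' : arc_set j z by rewrite -jz; case: (yP j) => [[]].
  apply: (oarc_arc_inj hQ _ kz).
  by case: (arc_split hQ jz') => // ze; case: nQ; rewrite ze; eexists.
have pts z w : pt z -> pt w -> z <> w -> dot e z <> dot e w.
  have := rQ i s' t' g'; case: sp => _ <- <- hne [c ->] [c' ->].
  by move: hne; case: (b) (c) (c') => [] [] [] //= hne _; auto; apply/nesym.
have xk z : pt z -> z <> x k -> dot e z < dot e (x k).
  move=> [c zc]; have [_ [[c' xc]|h]] := xP k => zx; last by rewrite zc.
  rewrite lt_neqAle; apply/andP; split; last first.
    by case: (xP k) => [[_ h] _]; apply: h; rewrite zc; exact: arc_end.
  by apply/eqP/pts => //; [exists c|exists c'].
have yk z : pt z -> z <> y k -> dot e (y k) < dot e z.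
  move=> [c zc]; have [_ [[c' xc]|h]] := yP k => zx; last by rewrite zc.
  rewrite lt_neqAle; apply/andP; split; last first.
    by case: (yP k) => [[_ h] _]; apply: h; rewrite zc; exact: arc_end.
  by apply/eqP/nesym/pts => //; [exists c|exists c'].
have xy : x k <> y k -> dot e (y k) < dot e (x k).
  move=> ne; pose p := vtx (endpt false k).
  have pp : pt p by exists false.
  have [xp|xp] := pselect (p = x k); first by rewrite -xp; apply: yk => //; rewrite xp.
  have [yp|yp] := pselect (p = y k); first by rewrite -yp; exact: xk.
  exact: lt_trans (yk _ pp yp) (xk _ pp xp).
(* the two ends of the gap are distinct points among the ends of k, x k, y k *)
have [||zp|zx|zy] := four (curve i s); [by apply: inarc; lra|by []|..];
  have [||wp|wx|wy] := four (curve i t); try (by apply: inarc; lra); try by [];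
  have ne := gap_neq hG sP g.
- exact: pts.
- by apply/eqP; rewrite wx lt_eqF// xk// -wx.
- by apply/eqP; rewrite wy gt_eqF// yk// -wy.
- by apply/eqP; rewrite zx gt_eqF// xk// -zx; apply/nesym.
- by case: ne; rewrite zx wx.
- by apply/eqP; rewrite zx wy gt_eqF// xy// -zx -wy.
- by apply/eqP; rewrite zy lt_eqF// yk// -zy; apply/nesym.
- by apply/eqP; rewrite zy wx lt_eqF// xy// -zy -wx; apply/nesym.
- by case: ne; rewrite zy wy.
Qed.

Lemma rational_subdivision G e (L : set rat) : continuous_graph G -> generic G e ->
  finite_set L -> L !=set0 -> (forall r, L r -> 0 < (ratr r : R) < 1) ->
  exists P, [/\ subdivides P G, gap_regular G P e &
    vset P = vset G `|` marked (fun i : 'I_(ne G) => ratr @` L)].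
Proof.
move=> hG gen fL [l Ll] L01.
have N01 (i : 'I_(ne G)) s : (ratr @` L) s -> 0 < s < 1 by move=> [r /L01 ? <-].
have [||P [sP VP]] := @subdivision_exists _ G (fun=> ratr @` L) hG _ N01.
- by move=> i; exact: finite_image.
- by move=> i; exists (ratr l); exists l.
exists P; split=> // i s t [/andP[s0 st] t1 Vs Vt nV].
have par r : 0 <= r <= 1 -> vset P (curve i r) ->
    [\/ r = 0, r = 1 | exists2 q, L q & r = ratr q].
  move=> /andP[]; rewrite le_eqVlt => /orP[/eqP<-|r0]; first by constructor 1.
  rewrite le_eqVlt => /orP[/eqP->|r1]; first by constructor 2.
  have r01 : 0 < r < 1 by lra.
  by move/(vset_interior hG N01 VP i r01) => [q Lq <-]; constructor 3; exists q.
have Vl : vset P (curve i (ratr l)) by rewrite VP; right; exists i, (ratr l); split=> //; exists l.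
clear VP.
have l01 := L01 _ Ll.
have s01 : 0 <= s <= 1 by lra.
have t01 : 0 <= t <= 1 by lra.
have end0 q : L q -> dot e (curve i (ratr q)) <> dot e (curve i 0).
  move=> Lq; have q01 := L01 q Lq; rewrite -(rmorph0 (@ratr R)).
  apply: gen; rewrite ?rmorph0 ?lexx ?ler01//.
  by apply/eqP => q0; move: q01; rewrite q0 rmorph0 ltxx.
have end1 q : L q -> dot e (curve i (ratr q)) <> dot e (curve i 1).
  move=> Lq; have q01 := L01 q Lq; rewrite -(rmorph1 (@ratr R)).
  apply: gen; rewrite ?rmorph1 ?lexx ?ler01//.
  by apply/eqP => q0; move: q01; rewrite q0 rmorph1 ltxx andbF.
case: (par s s01 Vs) => [s_|s_|[p Lp s_]]; case: (par t t01 Vt) => [t_|t_|[q Lq t_]];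
  try (by exfalso; lra).
- by case: (nV (ratr l)) => //; rewrite s_ t_.
- by rewrite s_ t_; apply/nesym; exact: end0.
- by rewrite s_ t_; exact: end1.
- rewrite s_ t_; apply: gen; [exact: L01|by have := L01 q Lq; lra|].
  by apply/eqP => pq; move: st; rewrite s_ t_ pq ltxx.
Qed.

Lemma regular_start G e : continuous_graph G -> generic G e ->
  exists P, subdivides P G /\ gap_regular G P e.
Proof.
move=> hG gen; have [|||P [sP rP _]] := @rational_subdivision G e [set 1 / 2] hG gen.
- exact: finite_set1.
- by exists (1 / 2).
- by move=> r ->; rewrite fmorph_div rmorph1 (rmorph_nat _ 2); lra.
by exists P.
Qed.

(** These are the properties of [mu_sequence] except for the convergence of
    the net total curvatures, which [NTC_poly_cvg] derives from the shrinking
    of the arcs. *)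
Theorem refining_sequence G e : continuous_graph G -> generic G e ->
  exists P : nat -> graph R,
  [/\ forall k, approximating G (P k) /\ regular_direction (P k) e,
      forall k, refines (P k.+1) (P k),
      forall k, mesh_le (P k) k.+1%:R^-1
    & forall k, exists2 Q, approximating G Q & adds_extrema e Q (P k)].
Proof.
move=> hG gen.
pose T := {P | subdivides P G /\ gap_regular G P e}.
have step (kP : nat * T) : exists P' : T, [/\ vset (sval kP.2) `<=` vset (sval P'),
    mesh_le (sval P') kP.1.+1%:R^-1 &
    exists2 Q, approximating G Q & adds_extrema e Q (sval P')].
  case: kP => k [P [sP rP]] /=.
  have [|Q [sQ rQ PQ mQ]] := regular_refinement hG gen sP rP (d := k.+1%:R^-1).
    by rewrite invr_gt0.
  have [P' [sP' rP' QP' xP']] := extremal_refinement hG sQ rQ.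
  exists (exist _ P' (conj sP' rP')); split=> //=.
  - exact: subset_trans QP'.
  - exact: mQ.
  - by exists Q => //; exact: subdivides_approximating.
have [f fP] := choice step.
have [P0 P0P] := regular_start hG gen.
pose S := fix S k : T := f (k, if k is k'.+1 then S k' else exist _ P0 P0P).
have SP k : exists P' : T, S k = f (k, P') by case: k => [|k]; eexists.
exists (fun k => sval (S k)); split=> k.
- have [sP rP] := svalP (S k); split; first exact: subdivides_approximating.
  exact: subdivides_regular rP.
- by rewrite /refines; have [] := fP (k.+1, S k).
- by have [P' ->] := SP k; have [] := fP (k, P').
- by have [P' ->] := SP k; have [] := fP (k, P').
Qed.

End RefiningSequence.

(** * Net local maxima as sums of signs *)

Section Counting.
Context {R : realType}.
Implicit Types (P Q G : graph R) (e : R3 R) (s t : R).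

Definition pm (b : bool) : R := if b then 1 else - 1.

Section Pairs.
Variables (G : graph R) (D : double_param G).

(** Each point over a vertex arises from exactly two darts. *)
Lemma over_vertex_pair (h k : dart G) :
  ([set k; joint D k] == [set h; joint D h])%SET = (k \in [set h; joint D h]%SET).
Proof.
apply/eqP/idP => [<-|]; first by rewrite finset.in_set2 eqxx.
rewrite finset.in_set2 => /orP[/eqP->//|/eqP->].
by rewrite jointK finset.setUC.
Qed.

Lemma sum_pairs (v : 'I_(nv G)) (w : dart G -> R) :
  \sum_(h | dart_vertex h == v) w h =
  \sum_(m in over_vertex D v) \sum_(h in m) w h.
Proof.
rewrite (partition_big (fun h => [set h; joint D h]%SET) (mem (over_vertex D v)))/=; last first.
  by move=> h hv; apply/imsetP; exists h; rewrite ?inE.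
apply: eq_bigr => m /imsetP[h]; rewrite inE => /eqP hv ->.
apply: eq_bigl => k; rewrite over_vertex_pair andb_idl// finset.in_set2.
by move=> /orP[/eqP->|/eqP->]; rewrite ?joint_vertex hv.
Qed.

(** A pair is a maximum when both its darts go down and a minimum when both
    go up, so maxima minus minima is half the sum of the signs of all darts,
    and each edge end carries two darts. *)
Lemma nlm_vertexE e (v : 'I_(nv G)) (s : 'I_(ne G) * bool -> bool) :
  (forall a, end_vertex a = v -> edge_max e a.1 a.2%:R <-> s a) ->
  (forall a, end_vertex a = v -> edge_min e a.1 a.2%:R <-> ~~ s a) ->
  nlm_vertex D e v = 2^-1 * \sum_(a | end_vertex a == v) pm (s a).
Proof.
move=> smax smin; rewrite /nlm_vertex; congr (_ * _).
pose w (h : dart G) := pm (s (h.1.1, h.2)).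
have dv (h : dart G) : end_vertex (h.1.1, h.2) = dart_vertex h by [].
have -> : \sum_(a | end_vertex a == v) pm (s a) = 2^-1 * \sum_(h | dart_vertex h == v) w h.
  rewrite [in LHS]big_mkcond [in RHS]big_mkcond/=.
  pose F (i : 'I_(ne G)) (b : bool) : R := if end_vertex (i, b) == v then pm (s (i, b)) else 0.
  rewrite [in LHS](eq_bigr (fun a => F a.1 a.2)); last by case.
  rewrite -(pair_bigA _ F) /=.
  rewrite [in RHS](eq_bigr (fun h : dart G =>
    (fun (ic : 'I_(ne G) * bool) b => F ic.1 b) h.1 h.2)); last by case=> [[i c] b].
  rewrite -(pair_bigA _ (fun (ic : 'I_(ne G) * bool) b => F ic.1 b)) /=.
  rewrite -(pair_bigA _ (fun i (c : bool) => \sum_b F i b)) /=.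
  rewrite mulr_sumr; apply: eq_bigr => i _; rewrite !big_bool /=.
  by lra.
rewrite sum_pairs mulr_sumr /lmax_vertex /lmin_vertex -!sum1_card !natr_sum.
rewrite !big_mkcondr/= -sumrB; apply: eq_bigr => m /imsetP[h]; rewrite inE => /eqP hv ->.
have hv' : dart_vertex (joint D h) = v by rewrite joint_vertex.
rewrite big_setU1/= ?big_set1 ?finset.in_set1 1?eq_sym ?joint_neq//.
have allE (p : pred (dart G)) : [forall k in [set h; joint D h]%SET, p k] = p h && p (joint D h).
  apply/forall_inP/andP => [H|[ph pj] k].
    by split; apply: H; rewrite finset.in_set2 eqxx ?orbT.
  by rewrite finset.in_set2 => /orP[/eqP->|/eqP->].
rewrite !allE.
have mx k : dart_vertex k = v -> `[< edge_max e k.1.1 k.2%:R >] = s (k.1.1, k.2).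
  by move=> kv; apply/asboolP/idP; rewrite (smax (k.1.1, k.2)).
have mn k : dart_vertex k = v -> `[< edge_min e k.1.1 k.2%:R >] = ~~ s (k.1.1, k.2).
  by move=> kv; apply/asboolP/idP; rewrite (smin (k.1.1, k.2)).
rewrite !mx// !mn// /w /pm.
by case: (s _); case: (s _) => /=; lra.
Qed.

End Pairs.

Definition strict_max G e (i : 'I_(ne G)) t := exists2 d, 0 < d &
  forall s, 0 <= s <= 1 -> s != t -> `|s - t| < d -> dot e (curve i s) < dot e (curve i t).

Lemma strict_max_edge_max G e (i : 'I_(ne G)) t : strict_max e i t -> edge_max e i t.
Proof.
move=> [d d0 h]; rewrite /edge_max /within/=; exists d => //= s st.
rewrite in_itv/= => s01; have [->//|ne] := eqVneq s t.
by apply: ltW; apply: h => //; rewrite distrC.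
Qed.

Lemma strict_max_edge_min G e (i : 'I_(ne G)) t : 0 <= t <= 1 -> strict_max e i t ->
  ~ edge_min e i t.
Proof.
move=> t01 [d d0 h] [d' /= d0' h'].
have [s [s01 st sd]] : exists s, [/\ 0 <= s <= 1, s != t & `|s - t| < Num.min d d'].
  have m0 : 0 < Num.min d d' by rewrite lt_min d0.
  have [t1|t1] := ltP t 1.
    have [|a [at1 ad]] := @rat_near _ t 1 t _ t1 _ m0; first lra.
    by exists (ratr a); split=> //; [lra|rewrite gt_eqF//; lra].
  have t0 : 0 < t by lra.
  have [|a [at1 ad]] := @rat_near _ 0 t t _ t0 _ m0; first lra.
  by exists (ratr a); split=> //; [lra|rewrite lt_eqF//; lra].
move: sd; rewrite lt_min => /andP[sd sd'].
have := h' s; rewrite /ball_/= distrC in_itv/= => /(_ sd' s01).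
by rewrite leNgt (h s).
Qed.

Lemma edge_maxN G e (i : 'I_(ne G)) t : edge_max (- e) i t <-> edge_min e i t.
Proof.
by split; rewrite /edge_max /edge_min; apply: filterS => s; rewrite !dotNl lerN2.
Qed.

Lemma edge_minN G e (i : 'I_(ne G)) t : edge_min (- e) i t <-> edge_max e i t.
Proof.
by split; rewrite /edge_max /edge_min; apply: filterS => s; rewrite !dotNl lerN2.
Qed.

Lemma strict_dichotomy G e (i : 'I_(ne G)) t (b : bool) : 0 <= t <= 1 ->
  (if b then strict_max e i t else strict_max (- e) i t) ->
  (edge_max e i t <-> b) /\ (edge_min e i t <-> ~~ b).
Proof.
move=> t01; case: b => h.
  have h1 := strict_max_edge_max h; have h2 := strict_max_edge_min t01 h.
  by split; split.
have := strict_max_edge_max h; have := strict_max_edge_min t01 h.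
rewrite edge_maxN edge_minN => h1 h2.
by split; split.
Qed.

Definition down P e (a : 'I_(ne P) * bool) : bool :=
  dot e (vtx (endpt (~~ a.2) a.1)) < dot e (vtx (endpt a.2 a.1)).

Lemma regular_neq P e (a : 'I_(ne P) * bool) : regular_direction P e ->
  dot e (vtx (endpt (~~ a.2) a.1)) != dot e (vtx (endpt a.2 a.1)).
Proof.
move=> /(_ a.1); rewrite /chord dotB/= => /eqP; rewrite subr_eq0.
by case: (a.2); rewrite //= eq_sym.
Qed.

Lemma chi_pm P e (a : 'I_(ne P) * bool) : regular_direction P e ->
  chi (tangent a) e = pm (down e a).
Proof.
move=> /(@regular_neq _ _ a); rewrite chi_tangent /pm /down.
case: ltgtP => // h _; first by rewrite gtr0_sg// subr_gt0.
by rewrite ltr0_sg// subr_lt0.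
Qed.

Lemma mu_polyE (D : forall P : graph R, double_param P) P e : regular_direction P e ->
  mu_poly D P e = mu_chi P e.
Proof.
move=> reg; rewrite /mu_poly /mu_chi mulr_sumr; apply: eq_bigr => v _.
rewrite (@nlm_vertexE (chordal P) _ e v (down e)).
- rewrite maxr_pMr ?invr_ge0// mulr0; congr (Num.max (_ * _) _).
  by apply: eq_bigr => a _; rewrite chi_pm.
all: move=> [i b] _; have b01 : 0 <= (b%:R : R) <= 1 by case: b; rewrite ?lexx ?ler01.
all: suff h : if down e (i, b) then @strict_max (chordal P) e i b%:R
                else @strict_max (chordal P) (- e) i b%:R
  by have [h1 h2] := strict_dichotomy b01 h.
all: have := @regular_neq _ _ (i, b) reg; rewrite /down /=.
all: case: ltP => lt ne; exists 1 => // s s01 sb _ /=.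
all: have dl (f : R3 R) x y : dot f ((1 - s) *: (x : R3 R) + s *: y) = (1 - s) * dot f x + s * dot f y
       by rewrite /dot /= /GRing.scale /=; ring.
all: have dl' (f : R3 R) x y : dot f ((1 - b%:R) *: (x : R3 R) + b%:R *: y) =
       (1 - b%:R) * dot f x + b%:R * dot f y
       by rewrite /dot /= /GRing.scale /=; ring.
all: rewrite dl dl' ?dotNl.
all: move: ne lt sb; case: b {dl dl' b01} => /= ne lt sb.
all: rewrite ?subrr ?subr0 ?mul0r ?mul1r ?addr0 ?add0r.
all: move/eqP : ne; move: lt; move: (dot _ _) (dot _ _) => x y lt ne.
all: have s1 : s < 1 \/ s = 1 by case/andP: s01 => _; rewrite le_eqVlt => /orP[/eqP|]; auto.
all: have s0 : 0 < s \/ s = 0 by case/andP: s01; rewrite le_eqVlt => /orP[/eqP|]; auto.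
all: move/eqP : sb; nra.
Qed.

End Counting.

(** * Continuous functions with finitely many peaks *)

Section PiecewiseMonotone.
Context {R : realType}.
Variable h : R -> R.
Hypothesis hc : {within `[(0:R), 1]%classic, continuous h}.
Implicit Types (x y s t u v : R).

Let near_lt t c : 0 <= t <= 1 -> h t < c -> exists2 d, 0 < d &
  forall s, 0 <= s <= 1 -> `|s - t| < d -> h s < c.
Proof.
move=> t01 /lt_nbhsl nU; have := (subspace_continuousP _ _).1 hc t.
rewrite /= in_itv/= => /(_ t01 _ nU); rewrite /within/= => -[d /= d0 k].
by exists d => // s s01 st; apply: k => //=; rewrite distrC.
Qed.

Let near_gt t c : 0 <= t <= 1 -> c < h t -> exists2 d, 0 < d &
  forall s, 0 <= s <= 1 -> `|s - t| < d -> c < h s.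
Proof.
move=> t01 /lt_nbhsr nU; have := (subspace_continuousP _ _).1 hc t.
rewrite /= in_itv/= => /(_ t01 _ nU); rewrite /within/= => -[d /= d0 k].
by exists d => // s s01 st; apply: k => //=; rewrite distrC.
Qed.

(** Rational parameters, so that a [generic] direction separates the points
    that form the peaks. *)
Definition peak (a b c : rat) := [/\ a < b, b < c, h (ratr a) < h (ratr b) & h (ratr c) < h (ratr b)].

(** The inequalities that define a peak are strict, hence stable under small
    changes of the parameters. *)
Lemma rational_peak x y (a b c : R) : 0 <= x -> y <= 1 -> x <= a -> a < b -> b < c -> c <= y ->
  h a < h b -> h c < h b -> exists a' b' c' : rat, [/\ x < ratr a', peak a' b' c' & ratr c' < y].
Proof.
move=> x0 y1 xa ab bc cy hab hcb.
have [|d1 d10 H1] := @near_gt b (h a) _ hab; first lra.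
have [|d2 d20 H2] := @near_gt b (h c) _ hcb; first lra.
have ac : a < c by lra.
have m0 : 0 < Num.min d1 d2 by rewrite lt_min d10.
have [|b' [b'ac]] := @rat_near _ a c b _ ac _ m0; first lra.
rewrite lt_min => /andP[b'1 b'2].
have hab' := H1 (ratr b') _ b'1; have hcb' := H2 (ratr b') _ b'2.
have [||d3 d30 H3] := @near_lt a (h (ratr b')); [lra|apply: hab'; lra|].
have [||d4 d40 H4] := @near_lt c (h (ratr b')); [lra|apply: hcb'; lra|].
have ab' : a < ratr b' by lra.
have bc' : ratr b' < c by lra.
have [|a' [a'ab a'3]] := @rat_near _ a (ratr b') a _ ab' _ d30; first lra.
have [|c' [c'bc c'4]] := @rat_near _ (ratr b') c c _ bc' _ d40; first lra.
exists a', b', c'; split; [lra| |lra].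
split; [rewrite -(@ltr_rat R); lra|rewrite -(@ltr_rat R); lra|apply: H3 => //; lra|apply: H4 => //; lra].
Qed.

Fixpoint peaks n x : Prop := if n is n'.+1 then
  exists a b c : rat, [/\ x < ratr a, peak a b c, (ratr c : R) < 1 & peaks n' (ratr c)] else True.

Definition monotone_on s t := (forall u v, s <= u -> u <= v -> v <= t -> h u <= h v) \/
  (forall u v, s <= u -> u <= v -> v <= t -> h v <= h u).

(** The point m is a minimum: a rise before it, or a fall after it, would
    make a peak together with m. *)
Lemma valley x y : 0 <= x -> x <= y -> y <= 1 ->
  (forall a b c : rat, x < ratr a -> peak a b c -> ratr c < y -> False) ->
  exists m, forall s t, x <= s -> s < t -> t <= y -> ~ s < m < t -> monotone_on s t.
Proof.
move=> x0 xy y1 npk.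
have hcxy : {within `[x, y]%classic, continuous h}.
  apply: continuous_subspaceW hc => r /=; rewrite !in_itv/=; lra.
have [m mxy mmin] := EVT_min xy hcxy; rewrite in_itv/= in mxy.
have npk' a b c : x <= a -> a < b -> b < c -> c <= y -> h a < h b -> h c < h b -> False.
  move=> *; have [||||||||a' [b' [c' [xa pk cy]]]] := @rational_peak x y a b c => //.
  exact: npk xa pk cy.
exists m => s t xs st ty nm.
have [tm|mt] := leP t m.
  right=> u v su uv vt; rewrite leNgt; apply/negP => huv.
  have hm : h m <= h u by apply: mmin; rewrite in_itv/=; lra.
  have {}uv : u < v by rewrite lt_neqAle uv andbT; apply/eqP => uv'; rewrite uv' ltxx in huv.
  have vm : v < m.
    rewrite lt_neqAle; apply/andP; split; last lra.
    by apply/eqP => vm; move: huv; rewrite vm ltNge hm.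
  by apply: (npk' u v m) => //; lra.
have ms : m <= s by rewrite leNgt; apply/negP => sm; apply: nm; rewrite sm.
left=> u v su uv vt; rewrite leNgt; apply/negP => huv.
have hm : h m <= h v by apply: mmin; rewrite in_itv/=; lra.
have {}uv : u < v by rewrite lt_neqAle uv andbT; apply/eqP => uv'; rewrite uv' ltxx in huv.
have mu : m < u.
  rewrite lt_neqAle; apply/andP; split; last lra.
  by apply/eqP => vm; move: huv; rewrite -vm ltNge hm.
by apply: (npk' m u v) => //; lra.
Qed.

(** Induction on the number of peaks. There is no peak before the infimum
    z of the right ends of all peaks after x, so the function is a valley
    there; if n peaks followed z, they would follow the right end of some
    peak close to z, which makes n + 1 peaks after x. *)
Lemma piecewise_monotone n x : 0 <= x <= 1 -> ~ peaks n x ->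
  exists F : set R, finite_set F /\
    forall s t, x <= s -> s < t -> t <= 1 -> (forall r, F r -> ~ s < r < t) -> monotone_on s t.
Proof.
elim: n x => [|n IH] x x01 /= np; first by [].
pose C : set R := [set z | exists a b c : rat, [/\ x < ratr a, peak a b c, (ratr c : R) < 1 & z = ratr c]].
have Cx z : C z -> x <= z.
  move=> [a [b [c [xa [ab bc _ _] _ ->]]]].
  by have := lt_trans ab bc; rewrite -(@ltr_rat R); lra.
have hiC : has_lbound C by exists x.
have [C0|/eqP/set0P C0] := pselect (C = set0).
  have [||||m mP] := @valley x 1; [lra|lra|lra| |].
    move=> a b c xa pk c1; have Cc : C (ratr c) by exists a, b, c.
    by rewrite C0 in Cc.
  exists [set m]; split; first exact: finite_set1.
  by move=> s t xs st t1 nF; apply: mP => //; exact: nF.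
(* the first place by which a peak after x can be completed *)
pose z := inf C.
have xz : x <= z by apply: lb_le_inf.
have z1 : z <= 1.
  have [w Cw] := C0; have := ge_inf hiC Cw; rewrite -/z.
  by move: Cw => [a [b [c [_ _ c1 ->]]]]; lra.
have [||F2 [fF2 F2P]] := IH z; first lra.
  move=> pz; apply: np.
  case: n pz {IH} => [_|n /= [a' [b' [c' [za' pk' c1' pn]]]]].
    by have [_ [a [b [c [xa pk c1 _]]]]] := C0; exists a, b, c.
  have [_ [a [b [c [xa pk c1 ->]]]] ca] := inf_lt C0 za'.
  by exists a, b, c; split=> //; exists a', b', c'.
have [||||m mP] := @valley x z; [lra|by []|by []| |].
  move=> a b c xa pk cz; move: (cz); rewrite ltNge => /negP; apply; apply: ge_inf => //.
  by exists a, b, c; split=> //; lra.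
exists ([set m] `|` ([set z] `|` F2)); split.
  by rewrite !finite_setU; split; [|split=> //]; exact: finite_set1.
move=> s t xs st t1 nF.
have [tz|zt] := leP t z.
  by apply: mP => //; apply: nF; left.
have zs : z <= s.
  by rewrite leNgt; apply/negP => sz; apply: (nF z); [right; left|rewrite sz].
by apply: F2P => // r Fr; apply: nF; right; right.
Qed.

Lemma peaks_seq n x : peaks n x -> exists f : nat -> rat * rat * rat,
  (forall j, (j < n)%N -> [/\ x < ratr (f j).1.1, peak (f j).1.1 (f j).1.2 (f j).2
    & (ratr (f j).2 : R) < 1]) /\
  (forall j k, (j < k)%N -> (k < n)%N -> (f j).2 < (f k).1.1).
Proof.
elim: n x => [|n IH] x /=; first by move=> _; exists (fun=> (0, 0, 0)).
move=> [a [b [c [xa pk c1 /IH[f [fP fs]]]]]].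
exists (fun j => if j is j'.+1 then f j' else (a, b, c)); split.
  move=> [_|j jn]; first by split.
  have [ca pkj c1j] := fP j jn; split=> //.
  by case: pk => ab bc _ _; have := lt_trans ab bc; rewrite -(@ltr_rat R); lra.
move=> [|j] [|k] //= jk kn; last exact: fs.
by have [ca _ _] := fP k kn; rewrite -(@ltr_rat R).
Qed.

End PiecewiseMonotone.

(** * Net local maxima at the vertices of a monotone subdivision *)

Section LocalCount.
Context {R : realType}.
Implicit Types (P Q G : graph R) (e : R3 R) (s t u v r : R).

Definition side_max G e (i : 'I_(ne G)) t (b : bool) := exists2 d, 0 < d &
  forall s, 0 <= s <= 1 -> (if b then s < t else t < s) -> `|s - t| < d ->
    dot e (curve i s) < dot e (curve i t).

Definition strict_gaps G Q e := forall (i : 'I_(ne G)) s t, is_gap (vset Q) i s t ->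
  (forall u v, s <= u -> u < v -> v <= t -> dot e (curve i u) < dot e (curve i v)) \/
  (forall u v, s <= u -> u < v -> v <= t -> dot e (curve i v) < dot e (curve i u)).

Lemma side_strict_max G e (i : 'I_(ne G)) t : side_max e i t true -> side_max e i t false ->
  strict_max e i t.
Proof.
move=> [d1 d10 h1] [d2 d20 h2]; exists (Num.min d1 d2); first by rewrite lt_min d10.
move=> s s01; rewrite lt_min neq_lt => /orP[] st /andP[sd1 sd2]; first exact: h1.
exact: h2.
Qed.

Lemma end_strict_max G e (i : 'I_(ne G)) (b : bool) : side_max e i b%:R b ->
  strict_max e i b%:R.
Proof.
move=> h; apply: side_strict_max; case: b h => //= _; exists 1 => // s /andP[s0 s1].
  by rewrite ltNge s0.
by rewrite ltNge s1.
Qed.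

Lemma side_contra G e (i : 'I_(ne G)) t (b : bool) : 0 <= t <= 1 ->
  (if b then 0 < t else t < 1) ->
  side_max e i t b -> (\forall s \near within `[(0:R), 1]%classic (nbhs t),
    dot e (curve i t) <= dot e (curve i s)) -> False.
Proof.
move=> t01 tb [d d0 h] [d' /= d0' h'].
have m0 : 0 < Num.min d d' by rewrite lt_min d0.
have [s [s01 st sd]] : exists s, [/\ 0 <= s <= 1, if b then s < t else t < s & `|s - t| < Num.min d d'].
  case: b tb {h} => tb.
    have [|a [at1 ad]] := @rat_near _ 0 t t _ tb _ m0; first lra.
    by exists (ratr a); split=> //; lra.
  have [|a [at1 ad]] := @rat_near _ t 1 t _ tb _ m0; first lra.
  by exists (ratr a); split=> //; lra.
move: sd; rewrite lt_min => /andP[sd sd'].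
have := h' s; rewrite /ball_/= distrC in_itv/= => /(_ sd' s01).
by rewrite leNgt (h s).
Qed.

Section Formula.
Variables (G Q : graph R) (e : R3 R) (D : forall P : graph R, double_param P).
Hypotheses (hG : continuous_graph G) (sQ : subdivides Q G) (mQ : strict_gaps G Q e).

Lemma strict_regular : regular_direction Q e.
Proof.
apply: subdivides_regular hG sQ _ => i s t g; have [/andP[_ st] _ _ _ _] := g.
by have [|] := mQ g => /(_ s t (lexx _) st (lexx _)); move=> h heq; rewrite heq ltxx in h.
Qed.

(** On a monotone arc, the comparison of the heights of the two ends decides
    the behaviour of the height near each of them. *)
Lemma leaves_side k (a : 'I_(ne G) * bool) r : leaves_along k a -> 0 <= r <= 1 ->
  curve a.1 r = vtx (@end_vertex R Q k) -> (if a.2 then 0 < r else r < 1) ->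
  (chi (tangent k) e = 1 /\ side_max e a.1 r a.2) \/
  (chi (tangent k) e = -1 /\ side_max (- e) a.1 r a.2).
Proof.
case: k a => [k c] [i b] [s [t [/= g [_ ps pt]]]] r01; rewrite chi_tangent /end_vertex/= => rk rb.
have [/andP[s0 st] t1 _ _ _] := g.
have rE : r = if b then t else s.
  apply: (@germ_param _ G hG i b) => //; [case: (b); lra| |case: (b); lra].
  by rewrite rk; case: (b) ps pt; rewrite /= ?addbT ?addbF ?negbK.
have oE : vtx (endpt (~~ c) k) = curve i (if b then s else t).
  by case: (b) ps pt; rewrite /= ?addbT ?addbF ?negbK.
rewrite -rk oE rE; have := mQ g; case: b {rb oE ps pt rk} rE => rE [|] mono.
- left; split; first by rewrite gtr0_sg// subr_gt0; apply: mono; rewrite ?lexx.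
  exists (t - s); first lra.
  by move=> w w01 wt; rewrite ltr_norml => wd; apply: mono; lra.
- right; split; first by rewrite ltr0_sg// subr_lt0; apply: mono; rewrite ?lexx.
  exists (t - s); first lra.
  by move=> w w01 wt; rewrite ltr_norml !dotNl ltrN2 => wd; apply: mono; lra.
- right; split; first by rewrite ltr0_sg// subr_lt0; apply: mono; rewrite ?lexx.
  exists (t - s); first lra.
  by move=> w w01 wt; rewrite ltr_norml !dotNl ltrN2 => wd; apply: mono; lra.
- left; split; first by rewrite gtr0_sg// subr_gt0; apply: mono; rewrite ?lexx.
  exists (t - s); first lra.
  by move=> w w01 wt; rewrite ltr_norml => wd; apply: mono; lra.
Qed.

Lemma side_excl (i : 'I_(ne G)) t (b : bool) : 0 <= t <= 1 -> (if b then 0 < t else t < 1) ->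
  side_max e i t b -> side_max (- e) i t b -> False.
Proof.
move=> t01 tb [d1 d10 h1] [d2 d20 h2].
have m0 : 0 < Num.min d1 d2 by rewrite lt_min d10.
have [s [s01 st]] : exists s, [/\ 0 <= s <= 1, if b then s < t else t < s & `|s - t| < Num.min d1 d2].
  case: b tb {h1 h2} => tb.
    have [|a [at1 ad]] := @rat_near _ 0 t t _ tb _ m0; first lra.
    by exists (ratr a); split=> //; lra.
  have [|a [at1 ad]] := @rat_near _ t 1 t _ tb _ m0; first lra.
  by exists (ratr a); split=> //; lra.
rewrite lt_min => /andP[sd1 sd2]; have := h2 s s01 st sd2.
by rewrite !dotNl ltrN2 ltNge ltW// h1.
Qed.

Lemma leaves_pm k (a : 'I_(ne G) * bool) r : leaves_along k a -> 0 <= r <= 1 ->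
  curve a.1 r = vtx (@end_vertex R Q k) -> (if a.2 then 0 < r else r < 1) ->
  chi (tangent k) e = pm `[< side_max e a.1 r a.2 >].
Proof.
move=> ka r01 rk rb; have [[-> h]|[-> h]] := leaves_side ka r01 rk rb.
  by rewrite asboolT.
by rewrite asboolF// => h'; exact: side_excl h' h.
Qed.

Lemma nlm_at_vertex (w : 'I_(nv Q)) (x : 'I_(nv G)) : vtx w = vtx x ->
  nlm (D G) e (vtx x) = 2^-1 * \sum_(k | end_vertex k == w) chi (tangent k) e.
Proof.
move=> wx.
have par (a : 'I_(ne G) * bool) : 0 <= (a.2%:R : R) <= 1 /\
    if a.2 then 0 < (a.2%:R : R) else (a.2%:R : R) < 1.
  by case: a => i [] /=; rewrite ?ltr01 ?lexx ?ler01.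
have -> : nlm (D G) e (vtx x) = nlm_vertex (D G) e x.
  have one (F : 'I_(nv G) -> nat) : (\sum_(v < nv G | vtx v == vtx x) F v = F x)%N.
    rewrite (eq_bigl (pred1 x)) ?big_pred1_eq// => v /=.
    by apply/eqP/eqP => [/(vtx_inj hG)|->].
  have zero (E : R3 R -> forall i : 'I_(ne G), R -> Prop) :
    #|[pred ic : 'I_(ne G) * bool | `[< exists t : R,
              [/\ (0 < t < 1)%R, curve ic.1 t = vtx x & E e ic.1 t] >]]| = 0%N.
    apply: eq_card0 => ic; apply/asboolP => -[t [t01 tx _]].
    by apply: (curve_notin_vset hG (i := ic.1) t01); rewrite tx; eexists.
  rewrite /nlm /nlm_vertex /lmax /lmin !one.
  by rewrite (zero (fun e i t => edge_max e i t)) (zero (fun e i t => edge_min e i t)) !addn0.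
have end_of (a : 'I_(ne G) * bool) : end_vertex a = x -> curve a.1 a.2%:R = vtx x.
  by move=> <-; exact: curve_end.
rewrite (nlm_vertexE (D G) (s := fun a => `[< side_max e a.1 a.2%:R a.2 >])).
- congr (_ * _); apply/esym; apply: (sum_end_vertex hG sQ wx) => k a kw ka.
  have ax : end_vertex a = x.
    by have := leaves_germ ka; rewrite kw wx germ_vertex// => /eqP.
  have [p1 p2] := par a; apply: leaves_pm => //.
  by rewrite end_of// kw wx.
all: move=> a ax; have [p1 p2] := par a.
all: have : germ_at (vtx w) a by rewrite wx germ_vertex// ax.
all: move=> /(germ_leaves hG sQ)[k kw ka].
all: have [|[_ h]|[_ h]] := leaves_side ka p1 _ p2; try by rewrite end_of// kw wx.
- by rewrite asboolT//; have [] := strict_dichotomy (b := true) p1 (end_strict_max h).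
- rewrite asboolF; last by move=> h'; exact: side_excl h' h.
  by have [] := strict_dichotomy (b := false) p1 (end_strict_max h).
- by rewrite asboolT//; have [] := strict_dichotomy (b := true) p1 (end_strict_max h).
- rewrite asboolF; last by move=> h'; exact: side_excl h' h.
  by have [] := strict_dichotomy (b := false) p1 (end_strict_max h).
Qed.

Lemma nlm_interior_point (i : 'I_(ne G)) t : 0 < t < 1 ->
  nlm (D G) e (curve i t) = (`[< edge_max e i t >])%:R - (`[< edge_min e i t >])%:R.
Proof.
move=> t01.
have zero (F : 'I_(nv G) -> nat) : (\sum_(v < nv G | vtx v == curve i t) F v = 0)%N.
  rewrite big1// => v /eqP vt; case: (curve_notin_vset hG (i := i) t01).
  by rewrite -vt; eexists.
have two (E : R3 R -> forall i : 'I_(ne G), R -> Prop) :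
    #|[pred ic : 'I_(ne G) * bool | `[< exists t' : R,
              [/\ (0 < t' < 1)%R, curve ic.1 t' = curve i t & E e ic.1 t'] >]]| =
    (2 * `[< E e i t >])%N.
  case: (asboolP (E e i t)) => h; last first.
    rewrite muln0; apply: eq_card0 => ic; apply/asboolP => -[t' [t01' tt]].
    have [|ii ->] := curve_inj hG t01' _ tt; first by lra.
    by rewrite ii.
  rewrite muln1 -sum1_card.
  transitivity (\sum_(ic : 'I_(ne G) * bool | (ic.1 == i) && true) 1)%N.
    apply: eq_bigl => ic; rewrite andbT; apply/asboolP/eqP => [[t' [t01' tt _]]|->].
      by have [|] := curve_inj hG t01' _ tt; first by lra.
    by exists t.
  by rewrite -(pair_big (pred1 i) xpredT (fun _ _ => 1%N))/= big_pred1_eq big_bool.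
rewrite /nlm /lmax /lmin !zero.
rewrite (two (fun e i t => edge_max e i t)) (two (fun e i t => edge_min e i t)) !add0n !natrM.
by lra.
Qed.

Lemma nlm_at_interior (w : 'I_(nv Q)) (i : 'I_(ne G)) t : 0 < t < 1 -> curve i t = vtx w ->
  nlm (D G) e (vtx w) = 2^-1 * \sum_(k | end_vertex k == w) chi (tangent k) e.
Proof.
move=> t01 tw; have t01' : 0 <= t <= 1 by lra.
have pb (b : bool) : if b then 0 < t else t < 1 by case: b; lra.
rewrite (sum_interior hG sQ t01 tw (F' := fun a => pm `[< side_max e i t a.2 >])); last first.
  move=> k a kw ka.
  have ai : a.1 = i by have := leaves_germ ka; rewrite kw -tw germ_interior// => /eqP.
  by rewrite -ai; apply: leaves_pm => //; rewrite ?kw ai.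
rewrite -tw nlm_interior_point//=.
have sd b : side_max e i t b \/ side_max (- e) i t b.
  have : germ_at (vtx w) (i, b) by rewrite -tw germ_interior.
  move=> /(germ_leaves hG sQ)[k kw ka].
  by have [|[_ h]|[_ h]] := leaves_side ka t01' _ (pb b); rewrite ?kw//; [left|right].
have F b : side_max (- e) i t b -> `[< side_max e i t b >] = false.
  by move=> h; apply: asboolF => h'; exact: side_excl h' h.
have T b : side_max e i t b -> `[< side_max e i t b >] = true by move=> h; exact: asboolT.
have nmax b : side_max (- e) i t b -> ~ edge_max e i t.
  move=> h h'; apply: side_contra t01' (pb b) h _.
  by apply: filterS h' => s; rewrite !dotNl lerN2.
have nmin b : side_max e i t b -> ~ edge_min e i t.
  by move=> h h'; exact: side_contra t01' (pb b) h h'.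
case: (sd true) => h1; case: (sd false) => h2.
- rewrite (T _ h1) (T _ h2) asboolT ?asboolF; [by rewrite /pm /=; lra|exact: nmin h1|].
  exact/strict_max_edge_max/side_strict_max.
- by rewrite (T _ h1) (F _ h2) asboolF ?asboolF; [rewrite /pm /=; lra|exact: nmin h1|exact: nmax h2].
- by rewrite (F _ h1) (T _ h2) asboolF ?asboolF; [rewrite /pm /=; lra|exact: nmin h2|exact: nmax h1].
- rewrite (F _ h1) (F _ h2) asboolF ?asboolT; [by rewrite /pm /=; lra| |exact: nmax h1].
  by apply/edge_maxN/strict_max_edge_max/side_strict_max.
Qed.

(** At a vertex of G, both sides are counted by the ends of the edges; in
    the interior of an edge there are just two sides, and the four possible
    combinations of signs are checked. *)
Lemma nlm_subdivision (w : 'I_(nv Q)) :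
  nlm (D G) e (vtx w) = 2^-1 * \sum_(k | end_vertex k == w) chi (tangent k) e.
Proof.
have [hQ GQ _ _] := sQ.
have : graph_set G (vtx w) by rewrite GQ; apply: (vset_graph hQ); eexists.
move=> /(graph_set_split hG)[[x _ xw]|[i [t /=]]].
  by rewrite -xw; exact: nlm_at_vertex.
by rewrite in_itv/= => t01; exact: nlm_at_interior.
Qed.

End Formula.
End LocalCount.

(** * Critical points *)

Section CriticalPoints.
Context {R : realType}.
Implicit Types (P Q G : graph R) (e : R3 R) (s t u v r : R).

(** At a highest vertex all edges go down, so the sum of signs there is
    positive. *)
Lemma mu_chi_half P e : continuous_graph P -> regular_direction P e ->
  exists2 n : nat, (0 < n)%N & mu_chi P e = n%:R / 2.
Proof.
move=> hP reg.
pose nd (w : 'I_(nv P)) := #|[pred a : 'I_(ne P) * bool | (end_vertex a == w) && down e a]|.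
pose nu (w : 'I_(nv P)) := #|[pred a : 'I_(ne P) * bool | (end_vertex a == w) && ~~ down e a]|.
have S w : \sum_(a : 'I_(ne P) * bool | end_vertex a == w) chi (tangent a) e = (nd w)%:R - (nu w)%:R.
  rewrite (bigID (down e))/=; congr (_ + _).
    rewrite /nd -sum1_card natr_sum; apply: eq_bigr => a /andP[_ da].
    by rewrite chi_pm// da.
  rewrite /nu -sum1_card natr_sum -sumrN; apply: eq_bigr => a /andP[_ da].
  by rewrite chi_pm// /pm (negbTE da).
have M w : Num.max (\sum_(a : 'I_(ne P) * bool | end_vertex a == w) chi (tangent a) e) 0 = (nd w - nu w)%N%:R.
  rewrite S; have [le|lt] := leqP (nu w) (nd w).
    by rewrite natrB// max_l// subr_ge0 ler_nat.
  by rewrite (eqP (ltnW lt : (nd w - nu w == 0)%N)) max_r// subr_le0 ler_nat ltnW.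
exists (\sum_(w < nv P) (nd w - nu w))%N; last first.
  by rewrite /mu_chi mulrC natr_sum; congr (_ * _); apply: eq_bigr => w _.
have [ne0 _ _ _ _] := hP.
pose w0 := endpt false (Ordinal ne0).
pose w := [arg max_(w > w0) dot e (vtx w)]%O.
have wmax (x : 'I_(nv P)) : dot e (vtx x) <= dot e (vtx w).
  by rewrite /w; case: Order.TotalTheory.arg_maxP => // y _ /(_ x isT).
have dn a : end_vertex a = w -> down e a.
  move=> aw; have := @regular_neq _ P e a reg; rewrite /down lt_neqAle => -> /=.
  by have := wmax (endpt (~~ a.2) a.1); rewrite -aw.
rewrite (bigD1 w)//= addn_gt0; apply/orP; left.
have [a aw] := vtx_end hP w.
have -> : nu w = 0%N by apply: eq_card0 => b; rewrite !inE; apply/negP => /andP[/eqP/dn ->].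
by rewrite subn0; apply/card_gt0P; exists a; rewrite inE aw eqxx dn.
Qed.

Lemma max_scale (x : R) : Num.max (2^-1 * x) 0 = 2^-1 * Num.max x 0.
Proof. by rewrite maxr_pMr ?invr_ge0// mulr0. Qed.

Section Formula.
Variables (G Q : graph R) (e : R3 R) (D : forall P : graph R, double_param P).
Hypotheses (hG : continuous_graph G) (sQ : subdivides Q G) (mQ : strict_gaps G Q e).

Let hQ : continuous_graph Q. Proof. by case: sQ. Qed.
Let GQ : graph_set G = graph_set Q. Proof. by case: sQ. Qed.

(** Away from the vertices of Q, the edge of G itself provides an open
    interval along which the height is monotone. *)
Lemma critical_vset : critical G e `<=` vset Q.
Proof.
move=> q [Gq [[d [_ [x [<- _]]]]|nmono]].
  by case: sQ => _ _ VGQ _; apply: VGQ; exists x.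
apply: contrapT => nV.
have [VG|[i [r /= + rq]]] := graph_set_split hG Gq.
  by apply: nV; case: sQ => _ _ VGQ _; exact: VGQ.
rewrite in_itv/= => r01.
have [|||||s [t [g srt _ _]]] := @gap_around _ G Q hG i 0 r 1; [lra|lra| | | |].
- exact: (vset_curve_end hG sQ i false).
- exact: (vset_curve_end hG sQ i true).
- by rewrite rq.
have [/andP[s0 st] t1 _ _ _] := g.
pose c u := curve i (s + u * (t - s)).
have st0 : 0 < t - s by lra.
apply: (nmono c).
- split.
  + apply: continuous_subspaceW (affine_cts (i := i) hG s0 st t1).
    exact: subset_itv_oo_cc.
  + move=> u v; rewrite !in_itv/= => u01 v01 /(curve_inj hG)[].
    * by have := affine_par_lt st u01; lra.
    * by have := affine_par_lt st v01; lra.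
    * by move=> _ /addrI/mulIf; apply; rewrite gt_eqF.
  + move=> a b a0 ab b1.
    have a01 : 0 <= a <= 1 by lra.
    have b01 : 0 <= b <= 1 by lra.
    have sa := affine_par st a01; have sb := affine_par st b01.
    exists (~` outside_subarc i (s + a * (t - s)) (s + b * (t - s))).
      by apply: closed_openC; apply: outside_subarc_closed => //; lra.
    rewrite -(@subarc_open _ G hG i); [|lra|lra|lra|lra].
    rewrite eqEsubset; split=> [_ [u + <-]|_ [u + <-]]; rewrite /= in_itv/= => uab.
      exists (s + u * (t - s)) => //; rewrite /= in_itv/= !ltrD2l.
      by rewrite !ltr_pM2r.
    exists ((u - s) / (t - s)).
      rewrite /= in_itv/= ltr_pdivlMr// ltr_pdivrMr//; lra.
    by rewrite /c divfK ?gt_eqF// addrC subrK.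
- exists ((r - s) / (t - s)).
    by rewrite /= in_itv/= ltr_pdivlMr// ltr_pdivrMr//; lra.
  by rewrite /c divfK ?gt_eqF// addrC subrK.
- have par u v : u \in `](0:R), 1[ -> v \in `](0:R), 1[ -> u < v ->
      [/\ s <= s + u * (t - s), s + u * (t - s) < s + v * (t - s) & s + v * (t - s) <= t].
    rewrite !in_itv/= => u01 v01 uv; rewrite ltrD2l ltr_pM2r//.
    by have := affine_par_lt st u01; have := affine_par_lt st v01; split; lra.
  have [mono|mono] := mQ g; [left|right] => u v u01 v01; rewrite le_eqVlt.
    move=> /orP[/eqP->//|uv]; have [h1 h2 h3] := par u v u01 v01 uv.
    by rewrite ltW// mono.
  move=> /orP[/eqP->//|uv]; have [h1 h2 h3] := par v u v01 u01 uv.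
  by rewrite ltW// mono.
Qed.

(** A vertex of Q that is not critical has degree 2. If the sum of signs
    were positive, both edges would go down from it: the height would have a
    strict local maximum on the graph there, and could be monotone on no open
    interval around it. *)
Lemma noncritical_le0 (w : 'I_(nv Q)) : ~ critical G e (vtx w) ->
  \sum_(k | end_vertex k == w) chi (tangent k) e <= 0.
Proof.
move=> ncrit; rewrite leNgt; apply/negP => S0.
have reg := strict_regular hG sQ mQ.
have Gw : graph_set G (vtx w) by rewrite GQ; apply: (vset_graph hQ); eexists.
have deg2 : degree w = 2%N.
  apply: contrapT => d2; apply: ncrit; split=> //; left; exists (degree w).
  have [_ _ _ tv] := subdivides_approximating hG sQ.
  by apply/tv; split=> //; exists w.
have chi1 k : end_vertex k = w -> chi (tangent k) e = 1.
  move=> kw; rewrite chi_pm//; case kd : (down e k) => //; exfalso.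
  move: S0; apply/negP; rewrite -leNgt (bigD1 k) ?kw//= chi_pm// kd /=.
  have : \sum_(i | (end_vertex i == w) && (i != k)) chi (tangent i) e <=
         \sum_(i | (end_vertex i == w) && (i != k)) (1 : R).
    by apply: ler_sum => a _; rewrite chi_pm// /pm; case: down => //; lra.
  have -> : \sum_(i : 'I_(ne Q) * bool | (end_vertex i == w) && (i != k)) (1 : R) = 1.
    have : (\sum_(i : 'I_(ne Q) * bool | end_vertex i == w) 1)%N = 2%N by rewrite sum1_card.
    rewrite (bigD1 k) ?kw//= add1n => -[c1].
    transitivity ((\sum_(i : 'I_(ne Q) * bool | (end_vertex i == w) && (i != k)) 1)%N%:R : R).
      by rewrite natr_sum.
    by rewrite c1.
  by rewrite /pm; lra.
(* both edges at w go down, and the height is monotone along them *)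
have lower (k : 'I_(ne Q)) x : arc_set k x -> arc_set k (vtx w) -> x <> vtx w -> dot e x < dot e (vtx w).
  move=> kx kq xq.
  have [b kb] : exists b, end_vertex (k, b) = w.
    have [/(vtx_inj hQ)->|/(vtx_inj hQ)->|/(oarc_notin_vset hQ)[]] := arc_split hQ kq.
    - by exists false.
    - by exists true.
    - by eexists.
  have [i [s [t [c [g [kE cs ct]]]]]] := edge_gap hG sQ k.
  have [/andP[s0 st] t1 _ _ _] := g.
  have := chi1 _ kb; rewrite chi_pm// /pm /down; case: ifP => [+ _|_ N11]; last first.
    by have := ltrN10 R; rewrite N11 ltNge ler01.
  rewrite /end_vertex/= in kb; rewrite /= kb => low.
  move: kx; rewrite kE => -[r /=]; rewrite in_itv/= => /andP[sr rt] rx.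
  have [bc|bc] := eqVneq b c.
    rewrite -bc kb in cs; rewrite -bc in ct; rewrite cs ct in low.
    have {}sr : s < r by rewrite lt_neqAle sr andbT; apply/eqP => sr'; apply: xq; rewrite -rx cs sr'.
    have [mono|mono] := mQ g; last by rewrite -rx cs; apply: mono; rewrite ?lexx.
    by move: low; rewrite ltNge ltW// mono ?lexx.
  have {}bc : b = ~~ c by case: (b) (c) bc => [] [].
  rewrite -bc kb in ct; rewrite bc negbK cs ct in low.
  have {}rt : r < t by rewrite lt_neqAle rt andbT; apply/eqP => sr'; apply: xq; rewrite -rx ct sr'.
  have [mono|mono] := mQ g; first by rewrite -rx ct; apply: mono; rewrite ?lexx.
  by move: low; rewrite ltNge ltW// mono ?lexx.
(* the arcs that avoid w form a closed set, so near w only the two edges at w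
   matter *)
pose far := \bigcup_(k in [set k : 'I_(ne Q) | ~ arc_set k (vtx w)]) arc_set k.
have cfar : closed far.
  by apply: closed_bigcup => [|k _]; [exact: finite_finset|exact: arc_closed].
have local_max x : graph_set G x -> ~ far x -> x <> vtx w -> dot e x < dot e (vtx w).
  rewrite GQ => -[k _ kx] nx xw; apply: (lower k) => //; apply: contrapT => nk.
  by apply: nx; exists k.
apply: ncrit; split=> //; right => c [cc cinj cop] [u /=]; rewrite in_itv/= => u01 cu.
have cG r : 0 < r < 1 -> graph_set G (c r).
  move=> r01; have [U _ UE] := cop 0 1 (lexx _) ltr01 (lexx _).
  have : (c @` `](0:R), 1[%classic) (c r) by exists r; rewrite //= in_itv.
  by rewrite UE => -[].
have [d d0 dU] : exists2 d, 0 < d & forall r, 0 < r < 1 -> `|r - u| < d -> ~ far (c r).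
  have nfar : nbhs (c u) (~` far).
    apply: open_nbhs_nbhs; split; first exact: closed_openC.
    by rewrite cu => -[k /= nk]; exact: nk.
  have := (subspace_continuousP _ _).1 cc u; rewrite /= in_itv/= => /(_ u01 _ nfar).
  rewrite /within/= => -[d /= d0 h]; exists d => // r r01 ru.
  by apply: (h r) => //=; rewrite distrC.
have strict r : 0 < r < 1 -> `|r - u| < d -> r != u -> dot e (c r) < dot e (c u).
  move=> r01 ru ne; rewrite cu; apply: local_max; [exact: cG|exact: dU|].
  rewrite -cu => /cinj; rewrite !in_itv/= => /(_ r01 u01) ruE.
  by rewrite ruE eqxx in ne.
have u0 : 0 < u by lra.
have u1 : u < 1 by lra.
have [|a [a0u ad]] := @rat_near _ 0 u u _ u0 _ d0; first lra.
have [|b [bu1 bd]] := @rat_near _ u 1 u _ u1 _ d0; first lra.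
have ha : dot e (c (ratr a)) < dot e (c u).
  by apply: strict => //; [lra|rewrite lt_eqF//; lra].
have hb : dot e (c (ratr b)) < dot e (c u).
  by apply: strict => //; [lra|rewrite gt_eqF//; lra].
case=> mono.
  have : dot e (c u) <= dot e (c (ratr b)) by apply: mono; rewrite ?in_itv/=; lra.
  by rewrite leNgt hb.
have : dot e (c u) <= dot e (c (ratr a)) by apply: mono; rewrite ?in_itv/=; lra.
by rewrite leNgt ha.
Qed.

Theorem critical_formula : finite_set (critical G e) /\
  mu_chi Q e = \sum_(q \in critical G e) Num.max (nlm (D G) e q) 0.
Proof.
have fc : finite_set (critical G e).
  by apply: sub_finite_set critical_vset _; apply: finite_image; exact: finite_finset.
split=> //.
rewrite (@fsbig_fwiden _ _ _ _ ([seq vtx w | w <- enum 'I_(nv Q)])).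
- rewrite big_map big_enum /mu_chi mulr_sumr; apply: eq_bigr => w _.
  by rewrite (nlm_subdivision D hG sQ mQ) max_scale.
- move=> q /critical_vset[w _ <-]; apply/mapP; exists w => //.
  by rewrite mem_enum.
- by rewrite map_inj_uniq ?enum_uniq//; exact: vtx_inj.
- move=> q [/= /mapP[w _ ->] nc]; rewrite /= (nlm_subdivision D hG sQ mQ) max_scale.
  by rewrite max_r ?mulr0// noncritical_le0.
Qed.

End Formula.

Lemma leaves_ends G Q (k : 'I_(ne Q) * bool) (a : 'I_(ne G) * bool) : leaves_along k a ->
  exists s t, [/\ is_gap (vset Q) a.1 s t,
    vtx (endpt k.2 k.1) = curve a.1 (if a.2 then t else s) &
    vtx (endpt (~~ k.2) k.1) = curve a.1 (if a.2 then s else t)].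
Proof.
case: k a => [k c] [i b] [s [t [/= g [_ ps pt]]]]; exists s, t; split=> //;
by case: b ps pt {g}; rewrite /= ?addbT ?addbF ?negbK.
Qed.

Lemma seq_argmax (T : eqType) (x0 : T) (s : seq T) (f : T -> R) : x0 \in s ->
  exists2 x, x \in s & forall y, y \in s -> f y <= f x.
Proof.
elim: s x0 => // y s IH x0 _.
case: s IH => [|z s] IH; first by exists y; rewrite ?mem_head// => w; rewrite inE => /eqP->.
have [x xs xm] := IH z (mem_head _ _).
have [fxy|fyx] := leP (f x) (f y).
  exists y; first exact: mem_head.
  by move=> w; rewrite inE => /orP[/eqP->//|/xm/le_trans]; apply.
exists x; first by rewrite inE xs orbT.
by move=> w; rewrite inE => /orP[/eqP->|/xm//]; exact: ltW.
Qed.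

(** Take the polygonal graph on the points of the peaks. Among its vertices
    between the ends of a given peak, a highest one lies above both its
    neighbours, and it contributes 1 to [mu_chi]. *)
Lemma peaks_mu G e (i : 'I_(ne G)) n : continuous_graph G -> generic G e ->
  peaks (fun t => dot e (curve i t)) n 0 ->
  exists P, [/\ subdivides P G, regular_direction P e & n%:R <= mu_chi P e].
Proof.
move=> hG gen /peaks_seq[f [fP fs]].
pose T := flatten [seq [:: (f j).1.1; (f j).1.2; (f j).2] | j <- iota 0 n].
have TP j : (j < n)%N -> [/\ (f j).1.1 \in T, (f j).1.2 \in T & (f j).2 \in T].
  move=> jn; split; apply/flattenP; exists [:: (f j).1.1; (f j).1.2; (f j).2];
  by rewrite ?inE ?eqxx ?orbT//; apply/mapP; exists j; rewrite ?mem_iota.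
pose L : set rat := [set` (1 / 2 : rat) :: T].
have L01 (r : rat) : L r -> 0 < (ratr r : R) < 1.
  rewrite /L /= inE => /orP[/eqP->|/flattenP[l /mapP[j]]].
    by rewrite fmorph_div rmorph1 (rmorph_nat _ 2); lra.
  rewrite mem_iota /= add0n => jn ->; have [a0 [ab bc _ _] c1] := fP j jn.
  by rewrite -(@ltr_rat R) in ab; rewrite -(@ltr_rat R) in bc; rewrite !inE => /or3P[]/eqP->; lra.
have [||P [sP rP VP]] := rational_subdivision hG gen _ _ L01.
- exact: finite_seq.
- by exists (1 / 2); rewrite /L /= inE eqxx.
have N01 (i' : 'I_(ne G)) s : (ratr @` L) s -> 0 < s < 1 by move=> [r /L01 ? <-].
have reg : regular_direction P e by exact: subdivides_regular rP.
exists P; split=> //.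
pose h t := dot e (curve i t).
(* a highest vertex w between the feet of the j-th peak *)
have top (j : 'I_n) : exists w : rat, [/\ L w, (f j).1.1 < w, w < (f j).2 &
    forall y, L y -> (f j).1.1 <= y <= (f j).2 -> h (ratr y) <= h (ratr w)].
  have [aT bT cT] := TP j (ltn_ord j); have [_ [ab bc hab hcb] _] := fP j (ltn_ord j).
  pose S := [seq y <- (1 / 2 : rat) :: T | (f j).1.1 <= y <= (f j).2].
  have bS : (f j).1.2 \in S by rewrite mem_filter inE bT orbT (ltW ab) (ltW bc).
  have [w] := seq_argmax (fun y => h (ratr y)) bS.
  rewrite mem_filter => /andP[/andP[aw wc] wL] wm.
  have hb := wm _ bS; rewrite /= in hb.
  exists w; split=> //.
  - rewrite lt_neqAle aw andbT; apply/eqP => aw'.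
    by move: hab; rewrite ltNge -/h aw' hb.
  - rewrite lt_neqAle wc andbT; apply/eqP => aw'.
    by move: hcb; rewrite ltNge -/h -aw' hb.
  - by move=> y Ly yac; apply: wm; rewrite mem_filter yac.
have [w wP] := choice top.
have vex (j : 'I_n) : exists v : 'I_(nv P), vtx v = curve i (ratr (w j)).
  have [Lw _ _ _] := wP j.
  have [v _ vE] : vset P (curve i (ratr (w j))).
    by rewrite VP; right; exists i, (ratr (w j)); split=> //; exists (w j).
  by exists v.
have [v vE] := choice vex.
have vinj : injective v.
  move=> j k jk; have := vE j; rewrite jk vE => /esym wjk.
  have [Lj aj jc _] := wP j; have [Lk ak kc _] := wP k.
  have w01 := L01 _ Lk.
  have [|_ ww] := curve_inj hG (L01 _ Lj) _ wjk; first by rewrite !ltW//; case/andP: w01.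
  move: ww => /fmorph_inj ww.
  apply: val_inj; case: (ltngtP j k) => // h'.
    by have := lt_trans (lt_trans jc (fs _ _ h' (ltn_ord k))) ak; rewrite ww ltxx.
  by have := lt_trans (lt_trans kc (fs _ _ h' (ltn_ord j))) aj; rewrite ww ltxx.
have marks q : L q -> vset P (curve i (ratr q)).
  by move=> Lq; rewrite VP; right; exists i, (ratr q); split=> //; exists q.
have inner r : 0 < r < 1 -> vset P (curve i r) -> exists2 q, L q & ratr q = r.
  by move=> r01 /(vset_interior hG N01 VP i r01).
have uv : uniq (codom v) by apply/injectiveP.
clear VP vinj.
have S2 j : \sum_(k | end_vertex k == v j) chi (tangent k) e = 2.
  have [Lj aj jc jm] := wP j; have w01 := L01 _ Lj.
  rewrite (sum_interior hG sP w01 (esym (vE j)) (F' := fun=> 1))// => k a kv ka.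
  have ai : a.1 = i.
    by have := leaves_germ ka; rewrite kv vE germ_interior// => /eqP.
  have [s [t [g ek ok]]] := leaves_ends ka; rewrite ai in g ek ok.
  have [/andP[s0 st] t1 Vs Vt nV] := g.
  have [aT _ cT] := TP j (ltn_ord j).
  have La : L (f j).1.1 by rewrite /L /= inE aT orbT.
  have Lc : L (f j).2 by rewrite /L /= inE cT orbT.
  have hne := rP i s t g.
  have lowside r : 0 <= r <= 1 -> vset P (curve i r) ->
      ratr (f j).1.1 <= r <= ratr (f j).2 -> h r <= h (ratr (w j)).
    move=> r01 Vr rac; have r01' : 0 < r < 1.
      by have := L01 _ La; have := L01 _ Lc; lra.
    have [q Lq qr] := inner r r01' Vr.
    rewrite -qr; apply: jm => //.
    by rewrite -!(@ler_rat R) qr.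
  rewrite chi_tangent; move: ek; rewrite -/(end_vertex k) kv vE ok.
  rewrite -(@ltr_rat R) in aj; rewrite -(@ltr_rat R) in jc.
  case: (a.2) => wE.
    have tw : ratr (w j) = t.
      by have [|_] := curve_inj hG w01 _ wE; [lra|].
    rewrite wE gtr0_sg// subr_gt0 lt_neqAle; apply/andP; split; first exact/eqP.
    have sa : ratr (f j).1.1 <= s.
      by rewrite leNgt; apply/negP => h'; apply: (nV (ratr (f j).1.1)); [lra|exact: marks].
    by rewrite -tw; apply: lowside => //; lra.
  have sw : ratr (w j) = s.
    by have [|_] := curve_inj hG w01 _ wE; [lra|].
  rewrite wE gtr0_sg// subr_gt0 lt_neqAle; apply/andP; split; first exact/eqP/nesym.
  have tc : t <= ratr (f j).2.
    by rewrite leNgt; apply/negP => h'; apply: (nV (ratr (f j).2)); [lra|exact: marks].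
  by rewrite -sw; apply: lowside => //; lra.
rewrite /mu_chi (bigID (mem (codom v)))/=.
rewrite -[X in X + _](big_uniq _ uv) /codom /image_mem big_map big_enum/=.
under eq_bigr do rewrite S2.
rewrite max_l//.
rewrite big_const iter_addr addr0 cardE size_enum_ord mulrDr.
rewrite -[X in X <= _]addr0; apply: lerD.
  have -> : (2 : R) *+ n = n%:R * 2 by rewrite mulr_natl.
  by rewrite mulrCA mulVf ?mulr1 ?pnatr_eq0.
by rewrite mulr_ge0 ?invr_ge0// sumr_ge0// => x _; rewrite le_max lexx orbT.
Qed.

End CriticalPoints.

(** * The multiplicity along sequences with shrinking arcs *)

Section FineSequences.
Context {R : realType}.
Implicit Types (P Q G : graph R) (e : R3 R) (s t u v r : R).

Definition fine_sequence G (S : nat -> graph R) := forall k, approximating G (S k) /\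
  mesh_le (S k) k.+1%:R^-1.

Lemma fine_dominates G S P e : fine_sequence G S -> continuous_graph P ->
  graph_set P = graph_set G -> regular_direction P e ->
  exists K, forall k, (K <= k)%N -> mu_chi P e <= mu_chi (S k) e.
Proof.
move=> fS hP PG reg; have [d d0 dP] := mu_domination hP reg.
have [K _ KP] := near_infty_natSinv_lt (PosNum d0).
exists K => k Kk; have [[hS SG _ _] mS] := fS k.
apply: dP => //; first by rewrite PG SG.
by move=> i x y ix iy; apply: le_trans (mS i x y ix iy) _; exact/ltW/KP.
Qed.

Lemma all_rats_dense : dense_rats (R := R) (fun=> True).
Proof. by move=> a b /rat_in_itvoo[r]; rewrite in_itv/= => rab; exists r. Qed.

(** The midpoint 1/2 is added so that every edge contains a new vertex. *)
Lemma fine_subdivision G (F : 'I_(ne G) -> set R) d : continuous_graph G -> 0 < d ->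
  (forall i, finite_set (F i)) ->
  exists P, [/\ subdivides P G, mesh_le P d &
    forall i s, 0 < s < 1 -> F i s -> vset P (curve i s)].
Proof.
move=> hG d0 fF.
have [N [fN N01 _ NM]] := mesh_points hG d0 (fun=> all_rats_dense).
pose M i := (F i `&` `]0, 1[%classic) `|` (ratr @` N i `|` [set (1 / 2 : R)]).
have M01 i s : M i s -> 0 < s < 1.
  case=> [[_]|[[r /N01 ? <-]//|->]]; first by rewrite /= in_itv.
  by rewrite divr_gt0//= ltr_pdivrMr// mul1r ltr1n.
have [||P [sP VP]] := subdivision_exists hG _ M01.
- move=> i; rewrite !finite_setU; split; first exact: finite_setIl.
  by split; [exact: finite_image|exact: finite_set1].
- by move=> i; exists (1 / 2); right; right.
have mP i s : M i s -> vset P (curve i s) by move=> Ms; rewrite VP; right; exists i, s.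
exists P; split=> //.
  by apply: NM => // i r Nr; apply: mP; right; left; exists r.
by move=> i s s01 Fs; apply: mP; left; split=> //; rewrite /= in_itv.
Qed.

Lemma fine_sequence_exists G : continuous_graph G -> exists S, fine_sequence G S.
Proof.
move=> hG.
have ex k : exists P, approximating G P /\ mesh_le P k.+1%:R^-1.
  have k0 : 0 < k.+1%:R^-1 :> R by rewrite invr_gt0.
  have [P [sP mP _]] := @fine_subdivision G (fun=> set0) _ hG k0 (fun=> finite_set0 _).
  by exists P; split=> //; exact: subdivides_approximating.
by have [S SP] := choice ex; exists S.
Qed.

(** A monotone function that takes a value twice is constant in between,
    hence has the same value at two rationals. *)
Lemma monotone_strict G e (i : 'I_(ne G)) s t : generic G e -> 0 <= s -> t <= 1 ->
  monotone_on (fun t => dot e (curve i t)) s t ->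
  (forall u v, s <= u -> u < v -> v <= t -> dot e (curve i u) < dot e (curve i v)) \/
  (forall u v, s <= u -> u < v -> v <= t -> dot e (curve i v) < dot e (curve i u)).
Proof.
move=> gen s0 t1 mono.
have ne u v : s <= u -> u < v -> v <= t -> dot e (curve i u) != dot e (curve i v).
  move=> su uv vt; apply/eqP => huv.
  have [a] := rat_in_itvoo uv; rewrite in_itv/= => auv.
  have /rat_in_itvoo[b] : ratr a < v by case/andP: auv.
  rewrite in_itv/= => bav.
  have a01 : 0 < (ratr a : R) < 1 by clear huv; lra.
  have b01 : 0 <= (ratr b : R) <= 1 by clear huv; lra.
  apply: (gen i a b a01 b01).
    by apply/eqP => ab; move: bav; rewrite ab ltxx.
  have ua : u <= ratr a by clear huv; lra.
  have ab : ratr a <= ratr b :> R by clear huv; lra.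
  have bv : ratr b <= v by clear huv; lra.
  have sa : s <= ratr a by clear huv; lra.
  have at' : ratr a <= t by clear huv; lra.
  have bt : ratr b <= t by clear huv; lra.
  have sb : s <= ratr b by clear huv; lra.
  apply/eqP; rewrite eq_le; case: mono => mono; apply/andP; split.
  - exact: mono.
  - by apply: le_trans (mono _ _ sb bv vt) _; rewrite -huv; exact: mono.
  - by apply: le_trans (mono _ _ su ua at') _; rewrite huv; exact: mono.
  - exact: mono.
case: mono => mono; [left|right] => u v su uv vt.
  by rewrite lt_neqAle ne// mono// ltW.
by rewrite lt_neqAle eq_sym ne// mono// ltW.
Qed.

(** The bound m limits the number of peaks, so there are monotone
    subdivisions. Their common value dominates each term of S because they
    can be chosen fine enough, and it is dominated by all terms of S from some
    rank on. *)
Theorem finite_value G e S (D : forall P : graph R, double_param P) m :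
  continuous_graph G -> generic G e -> fine_sequence G S ->
  (forall k, regular_direction (S k) e) -> (forall k, mu_chi (S k) e <= m) ->
  finite_set (critical G e) /\ exists K, forall k, (K <= k)%N ->
    mu_chi (S k) e = \sum_(q \in critical G e) Num.max (nlm (D G) e q) 0.
Proof.
move=> hG gen fS reg bdd.
have sub_le P : subdivides P G -> regular_direction P e ->
    exists K, forall k, (K <= k)%N -> mu_chi P e <= mu_chi (S k) e.
  by move=> [hP GP _ _]; exact: fine_dominates.
have nopeaks (i : 'I_(ne G)) : ~ peaks (fun t => dot e (curve i t)) (Num.truncn m).+1 (0 : R).
  move=> pk; have [P [sP rP nP]] := peaks_mu hG gen pk.
  have [K KP] := sub_le P sP rP.
  have := le_trans (le_trans nP (KP K (leqnn K))) (bdd K).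
  by rewrite leNgt truncnS_gt.
have F01 : 0 <= (0:R) <= 1 by rewrite lexx ler01.
have [F FP] := choice (fun i => piecewise_monotone (@height_cts R G e i hG) F01 (nopeaks i)).
(* monotone subdivisions with arcs of any size *)
have mono_sub d : 0 < d -> exists P, [/\ subdivides P G, mesh_le P d & strict_gaps G P e].
  move=> d0; have [P [sP mP FV]] := @fine_subdivision G F d hG d0 (fun i => (FP i).1).
  exists P; split=> // i s t [/andP[s0 st] t1 _ _ nV].
  apply: monotone_strict => //; apply: (FP i).2 => // r Fr srt.
  apply: (nV r) => //; apply: FV => //; lra.
have [P0 [sP0 _ mP0]] := mono_sub 1 ltr01.
have [fc _] := critical_formula D hG sP0 mP0.
split=> //.
have [K KP] := sub_le P0 sP0 (strict_regular hG sP0 mP0).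
exists K => k Kk; apply/eqP; rewrite eq_le.
rewrite -{2}(critical_formula D hG sP0 mP0).2 KP// andbT.
have [[hS SG _ _] _] := fS k.
have [d d0 dP] := mu_domination hS (reg k).
have [P [sP mP sgP]] := mono_sub d d0.
rewrite -(critical_formula D hG sP sgP).2.
by case: sP => hP GP _ _; apply: dP => //; rewrite SG.
Qed.

End FineSequences.

(** * Integration over the sphere *)

Section Measure.
Context {R : realType}.
Implicit Types (P Q G : graph R) (e : R3 R).

Lemma measurable_dot (c : R3 R) : measurable_fun [set: R3 R] (dot^~ c).
Proof.
have m1 : measurable_fun [set: R3 R] (fun x : R3 R => x.1) by exact: measurable_fst.
have m2 : measurable_fun [set: R3 R] (fun x : R3 R => x.2) by exact: measurable_snd.
have m11 : measurable_fun [set: R3 R] (fun x : R3 R => x.1.1).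
  exact: (measurableT_comp (@measurable_fst _ _ _ _) m1).
have m12 : measurable_fun [set: R3 R] (fun x : R3 R => x.1.2).
  exact: (measurableT_comp (@measurable_snd _ _ _ _) m1).
by apply: measurable_funD; first apply: measurable_funD;
  apply: measurable_funM => //; exact: measurable_cst.
Qed.

Lemma measurable_S2 : measurable (@S2 R).
Proof.
have m1 : measurable_fun [set: R3 R] (fun x : R3 R => x.1) by exact: measurable_fst.
have m2 : measurable_fun [set: R3 R] (fun x : R3 R => x.2) by exact: measurable_snd.
have m11 : measurable_fun [set: R3 R] (fun x : R3 R => x.1.1).
  exact: (measurableT_comp (@measurable_fst _ _ _ _) m1).
have m12 : measurable_fun [set: R3 R] (fun x : R3 R => x.1.2).
  exact: (measurableT_comp (@measurable_snd _ _ _ _) m1).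
have me : measurable_fun [set: R3 R] (@enorm R).
  apply: (measurableT_comp (f := @Num.sqrt R)).
    by apply: continuous_measurable_fun; exact: sqrt_continuous.
  by apply: measurable_funD; first apply: measurable_funD; apply: measurable_funM.
by rewrite -[S2]setTI; exact: (me measurableT [set 1] (measurable_set1 _)).
Qed.

Lemma measurable_sgr d (T : measurableType d) (f : T -> R) : measurable_fun [set: T] f ->
  measurable_fun [set: T] (fun x => Num.sg (f x)).
Proof.
move=> mf; have -> : (fun x => Num.sg (f x)) =
    (fun x => if f x == 0 then 0 else if f x < 0 then -1 else 1).
  by apply/funext => x; case: sgrP.
apply: measurable_fun_ifT; [|exact: measurable_cst|].
  by apply: measurable_fun_eqr => //; exact: measurable_cst.
apply: measurable_fun_ifT; [|exact: measurable_cst|exact: measurable_cst].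
by apply: measurable_fun_ltr => //; exact: measurable_cst.
Qed.

Lemma measurable_excess P (w : 'I_(nv P)) : measurable_fun [set: R3 R]
  (fun e => Num.max (\sum_(a : 'I_(ne P) * bool | end_vertex a == w) chi (tangent a) e) 0).
Proof.
apply: measurable_maxr; last exact: measurable_cst.
under eq_fun do rewrite big_mkcond.
apply: measurable_sum => a; case: (end_vertex a == w); last exact: measurable_cst.
have -> : chi (tangent a) = (fun e => 0 - Num.sg (dot e (tangent a))).
  by apply/funext => e; rewrite sub0r.
by apply: measurable_funB; [exact: measurable_cst|apply: measurable_sgr; exact: measurable_dot].
Qed.

Lemma measurable_mu_chi P : measurable_fun [set: R3 R] (mu_chi P).
Proof.
apply: measurable_funM; first exact: measurable_cst.
by apply: measurable_sum => w; exact: measurable_excess.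
Qed.

Lemma mu_chi_ge0 P e : 0 <= mu_chi P e.
Proof.
by rewrite mulr_ge0 ?invr_ge0// sumr_ge0// => w _; rewrite le_max lexx orbT.
Qed.

(** The same signs enter both sides, so the identity holds before any
    direction is excluded. *)
Lemma NTC_poly_integral P :
  NTC_poly P = ((2^-1)%:E * \int[sphere_area]_(e in S2) (mu_chi P e)%:E)%E.
Proof.
pose F (w : 'I_(nv P)) e :=
  (Num.max (\sum_(a : 'I_(ne P) * bool | end_vertex a == w) chi (tangent a) e) 0)%:E.
have mF w : measurable_fun S2 (F w).
  by apply/measurable_EFinP; apply: measurable_funTS; exact: measurable_excess.
have F0 w e : S2 e -> (0 <= F w e)%E by rewrite lee_fin le_max lexx orbT.
transitivity ((4^-1)%:E * \int[sphere_area]_(e in S2) (\sum_(w < nv P) F w e))%E.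
  rewrite ge0_integral_sum//; last exact: measurable_S2.
  by rewrite ge0_sume_distrr// => w _; apply: integral_ge0 => e; exact: F0.
have -> : (\int[sphere_area]_(e in S2) (mu_chi P e)%:E =
    (2^-1)%:E * \int[sphere_area]_(e in S2) (\sum_(w < nv P) F w e))%E.
  rewrite -ge0_integralZl//; last 3 first.
  - exact: measurable_S2.
  - exact: emeasurable_sum.
  - by move=> e Se; apply: sume_ge0 => w _; exact: F0.
  by apply: eq_integral => e _; rewrite /mu_chi EFinM -sumEFin.
by rewrite muleA -EFinM; congr (_%:E * _)%E; lra.
Qed.

Lemma sin_zeros (x : R) : 0 <= x <= 2 * pi -> sin x = 0 -> [\/ x = 0, x = pi | x = 2 * pi].
Proof.
move=> /andP[x0 x2] sx.
have [->|xn0] := eqVneq x 0; first by constructor 1.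
have [->|xnp] := eqVneq x pi; first by constructor 2.
have [->|xn2] := eqVneq x (2 * pi); first by constructor 3.
exfalso; have {}x0 : 0 < x by rewrite lt_neqAle eq_sym xn0.
have {}x2 : x < 2 * pi by rewrite lt_neqAle xn2.
have [xp|px] := ltP x pi; first by have := sin_gt0_pi (introT andP (conj x0 xp)); rewrite sx ltxx.
have {}px : pi < x by rewrite lt_neqAle eq_sym xnp.
have h : 0 < x - pi < pi by lra.
have := sin_gt0_pi h; have := sinDpi (x - pi); rewrite subrK sx => /eqP.
by rewrite eq_sym oppr_eq0 => /eqP->; rewrite ltxx.
Qed.

(** Two zeros t and t0 satisfy sin (t - t0) = 0, since (a, b) is a nontrivial
    solution of a linear system whose determinant is that sine. *)
Lemma horizontal_zeros (a b : R) : (a, b) <> (0, 0) ->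
  countable [set t : R | 0 <= t <= 2 * pi /\ a * cos t + b * sin t = 0].
Proof.
move=> ab; set Z := [set t | _].
have [Z0|/eqP/set0P[t0 [t01 z0]]] := pselect (Z = set0); first by rewrite Z0; exact: countable0.
apply: finite_set_countable.
pose F : seq R := [:: t0; t0 + pi; t0 + 2 * pi; t0 - pi; t0 - 2 * pi].
apply: (@sub_finite_set _ _ [set` F]); last exact: finite_seq.
move=> t [t02 z].
have det : sin (t - t0) = 0.
  rewrite sinB.
  have ha : a * (sin t * cos t0 - cos t * sin t0) = 0.
    have -> : a * (sin t * cos t0 - cos t * sin t0) =
      sin t * (a * cos t0 + b * sin t0) - sin t0 * (a * cos t + b * sin t) by ring.
    by rewrite z z0; ring.
  have hb : b * (sin t * cos t0 - cos t * sin t0) = 0.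
    have -> : b * (sin t * cos t0 - cos t * sin t0) =
      cos t0 * (a * cos t + b * sin t) - cos t * (a * cos t0 + b * sin t0) by ring.
    by rewrite z z0; ring.
  apply/eqP; apply: contrapT => /negP nz; apply: ab.
  move/eqP: ha; rewrite mulf_eq0 (negbTE nz) orbF => /eqP->.
  by move/eqP: hb; rewrite mulf_eq0 (negbTE nz) orbF => /eqP->.
have [h|h] := leP t0 t.
  case: (@sin_zeros (t - t0)) => //; first lra.
  - by move=> /eqP; rewrite subr_eq0 => /eqP->; rewrite /= inE eqxx.
  - by move=> /eqP; rewrite subr_eq addrC => /eqP->; rewrite /= !inE eqxx !orbT.
  - by move=> /eqP; rewrite subr_eq addrC => /eqP->; rewrite /= !inE eqxx !orbT.
case: (@sin_zeros (t0 - t)); first lra.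
- by rewrite -opprB sinN det oppr0.
- by move=> /eqP; rewrite subr_eq0 => /eqP<-; rewrite /= inE eqxx.
- move=> hp; have -> : t = t0 - pi by lra.
  by rewrite /= !inE eqxx !orbT.
- move=> hp; have -> : t = t0 - 2 * pi by lra.
  by rewrite /= !inE eqxx !orbT.
Qed.

Lemma vertical_zeros (a b : R) : (a, b) <> (0, 0) ->
  countable [set z : R | -1 <= z <= 1 /\ Num.sqrt (1 - z ^+ 2) * a + z * b = 0].
Proof.
move=> ab; apply: finite_set_countable.
pose r := Num.sqrt (a ^+ 2 / (a ^+ 2 + b ^+ 2)).
apply: (@sub_finite_set _ _ [set` [:: r; - r]]); last exact: finite_seq.
move=> z [z1 hz].
have s0 : 0 < a ^+ 2 + b ^+ 2.
  rewrite lt_neqAle addr_ge0 ?sqr_ge0// andbT eq_sym paddr_eq0 ?sqr_ge0// !sqrf_eq0.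
  by apply/negP => /andP[/eqP a0 /eqP b0]; apply: ab; rewrite a0 b0.
have z2 : 0 <= 1 - z ^+ 2.
  have -> : 1 - z ^+ 2 = (1 - z) * (1 + z) by ring.
  by rewrite mulr_ge0//; lra.
have : (Num.sqrt (1 - z ^+ 2) * a) ^+ 2 = (z * b) ^+ 2.
  have -> : Num.sqrt (1 - z ^+ 2) * a = - (z * b) by lra.
  by rewrite sqrrN.
rewrite exprMn sqr_sqrtr// exprMn => h.
have zr : z ^+ 2 = a ^+ 2 / (a ^+ 2 + b ^+ 2).
  have n0 : a ^+ 2 + b ^+ 2 != 0 by rewrite gt_eqF.
  apply: (mulIf n0); rewrite divfK//; move: h.
  by rewrite mulrBl mul1r mulrDr => h; lra.
have : z ^+ 2 == r ^+ 2 by rewrite /r sqr_sqrtr ?zr// divr_ge0 ?sqr_ge0// ltW.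
by rewrite eqf_sqr /= !inE.
Qed.

(** In the coordinates (t, z), the section of the great circle at t is
    finite, unless c is horizontal and t is one of the finitely many angles
    orthogonal to c. *)
Lemma null_plane (c : R3 R) : c != 0 -> sphere_area.-negligible [set e : R3 R | dot e c = 0].
Proof.
move=> c0; set A := [set e | _].
have mA : measurable A.
  rewrite -[A]setTI; exact: (@measurable_dot c measurableT _ (measurable_set1 0)).
exists A; split=> //.
rewrite /sphere_area /pushforward /mrestr /= /product_measure1 /=.
set B := _ `&` _.
have mB : measurable B.
  apply: measurableI; last exact: measurable_cyl_domain.
  by rewrite -[X in measurable X]setTI; exact: measurable_cyl.
(* the angles whose section is not finite *)
pose N := [set t : R | 0 <= t <= 2 * pi /\ (c.2 = 0 /\ c.1.1 * cos t + c.1.2 * sin t = 0)].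
have cN : countable N.
  have [c20|c20] := eqVneq c.2 0; last first.
    suff -> : N = set0 by exact: countable0.
    by rewrite -subset0 => t [_ [c2 _]]; move: c20; rewrite c2 eqxx.
  apply: (@sub_countable _ _ N [set t : R | 0 <= t <= 2 * pi /\ c.1.1 * cos t + c.1.2 * sin t = 0]).
    by apply: subset_card_le => t [h [_ k]].
  apply: horizontal_zeros => -[c11 c12].
  by move: c0; case: c c11 c12 c20 {A mA B mB N} => [[x y] z] /= -> -> ->; rewrite eqxx.
have mN : measurable N by exact: countable_measurable.
have sec t : ~ N t -> lebesgue_measure (xsection B t) = 0%E.
  move=> Nt; apply: countable_lebesgue_measure0.
  have [t01|t01] := boolP (0 <= t <= 2 * pi); last first.
    suff -> : xsection B t = set0 by exact: countable0.
    rewrite -subset0 => z /xsectionP[_ [/=]].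
    by rewrite in_itv/= (negbTE t01).
  pose a := c.1.1 * cos t + c.1.2 * sin t.
  apply: (@sub_countable _ _ _ [set z : R | -1 <= z <= 1 /\ Num.sqrt (1 - z ^+ 2) * a + z * c.2 = 0]).
    apply: subset_card_le => z /xsectionP[/= hz [_ /=]].
    rewrite in_itv/= => z1; split=> //; rewrite -hz /cyl /dot /= /a; ring.
  by apply: vertical_zeros => -[a0 c20]; apply: Nt.
rewrite (@ae_eq_integral _ _ _ lebesgue_measure setT (cst 0%E))//.
- by rewrite integral0.
- exact: (measurable_fun_xsection lebesgue_measure mB).
exists N; split=> //; first exact: countable_lebesgue_measure0.
by move=> t /= ht; apply: contrapT => Nt; apply: ht => _; exact: sec.
Qed.

Lemma sphere_area_S2 : (0 < sphere_area (@S2 R))%E.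
Proof.
have -> : sphere_area (@S2 R) = (lebesgue_measure \x lebesgue_measure)%E (@cyl_domain R).
  rewrite /sphere_area /pushforward /mrestr; congr (_ _).
  rewrite eqEsubset; split=> [p []//|p dp]; split=> //.
  move: dp => [_ /=]; rewrite in_itv/= => z1.
  have z2 : 0 <= 1 - p.2 ^+ 2.
    have -> : 1 - p.2 ^+ 2 = (1 - p.2) * (1 + p.2) by ring.
    by rewrite mulr_ge0//; lra.
  rewrite /S2 /= /enorm /dot /=; set r := Num.sqrt (1 - p.2 ^+ 2).
  have r2 : r ^+ 2 = 1 - p.2 ^+ 2 by rewrite sqr_sqrtr.
  have -> : r * cos p.1 * (r * cos p.1) + r * sin p.1 * (r * sin p.1) + p.2 * p.2 =
      r ^+ 2 * (cos p.1 ^+ 2 + sin p.1 ^+ 2) + p.2 ^+ 2 by ring.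
  by rewrite cos2Dsin2 r2 mulr1 subrK sqrtr1.
rewrite product_measure1E; [|exact: measurable_itv|exact: measurable_itv].
have itv_gt0 (x y : R) : x < y -> (0 < lebesgue_measure (`[x, y]%classic : set R))%E.
  by move=> xy; rewrite lebesgue_measure_itv /= lte_fin xy -EFinB lte_fin subr_gt0.
by apply: mule_gt0; apply: itv_gt0; [rewrite mulr_gt0// pi_gt0|lra].
Qed.

Lemma ae_countable (T : countType) (p : T -> R3 R -> Prop) :
  (forall x, {ae sphere_area, forall e, p x e}) -> {ae sphere_area, forall e, forall x, p x e}.
Proof.
move=> h.
have : {ae sphere_area, forall e, forall n,
    if @choice.unpickle T n is Some x then p x e else True}.
  apply: ae_foralln => n; case: (choice.unpickle n) => [x|]; first exact: h.
  exact: aeW.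
by apply: filterS => e H x; have := H (choice.pickle x); rewrite choice.pickleK.
Qed.

Lemma ae_not_orthogonal (c : R3 R) : c != 0 -> {ae sphere_area, forall e : R3 R, dot e c <> 0}.
Proof.
move=> /null_plane h; apply: negligibleS h => e /= /contrapT.
by [].
Qed.

Lemma ae_regular P : continuous_graph P -> (forall i : 'I_(ne P), endpt false i <> endpt true i) ->
  {ae sphere_area, forall e, regular_direction P e}.
Proof.
move=> hP nl; apply: ae_countable => i; apply: ae_not_orthogonal.
by rewrite subr_eq0; apply/eqP => /(vtx_inj hP)/esym/nl.
Qed.

Lemma ae_generic G : continuous_graph G -> {ae sphere_area, forall e, generic G e}.
Proof.
move=> hG.
have : {ae sphere_area, forall e, forall x : 'I_(ne G) * rat * rat,
    0 < (ratr x.1.2 : R) < 1 -> 0 <= (ratr x.2 : R) <= 1 -> x.1.2 != x.2 ->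
    dot e (curve x.1.1 (ratr x.1.2)) <> dot e (curve x.1.1 (ratr x.2))}.
  apply: ae_countable => -[[i a] b] /=.
  have [a01|a01] := boolP (0 < (ratr a : R) < 1); last by apply: aeW.
  have [b01|b01] := boolP (0 <= (ratr b : R) <= 1); last by apply: aeW.
  have [ab|ab] := eqVneq a b; first by apply: aeW.
  have c0 : curve i (ratr a) - curve i (ratr b) != 0.
    rewrite subr_eq0; apply/eqP => /(curve_inj hG a01 b01)[_ /fmorph_inj ab'].
    by rewrite ab' eqxx in ab.
  apply: filterS (ae_not_orthogonal c0) => e h _ _ _ hab.
  by apply: h; rewrite dotB hab subrr.
by apply: filterS => e h i a b; exact: (h (i, a, b)).
Qed.

End Measure.

(** * Lower limits and integrals *)

Section Limits.
Context {R : realType}.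
Local Open Scope ereal_scope.

Lemma ge_limn_einf (w : (\bar R)^nat) x K : (forall k, (K <= k)%N -> x <= w k) ->
  x <= limn_einf w.
Proof.
move=> h; rewrite limn_einf_lim; apply: lime_ge; first exact: is_cvg_einfs.
exists K => // n Kn; apply: le_ereal_inf_tmp => _ [m nm <-]; apply: h.
exact: leq_trans Kn nm.
Qed.

Lemma limn_einf_le (w : (\bar R)^nat) x : (forall k, w k <= x) -> limn_einf w <= x.
Proof.
move=> h; rewrite limn_einf_lim; apply: lime_le; first exact: is_cvg_einfs.
apply: nearW => n; apply: le_trans (h n).
by apply: ereal_inf_lbound; exists n => //=.
Qed.

Lemma limn_einf_cvg (w : (\bar R)^nat) x : (forall k, w k <= x) -> x <= limn_einf w ->
  w k @[k --> \oo] --> x.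
Proof.
move=> h1 h2; have h3 : limn_einf w = x.
  by apply/eqP; rewrite eq_le h2 limn_einf_le.
apply: (@squeeze_cvge _ _ _ _ (einfs w) _ (cst x)).
- apply: nearW => n; rewrite h1 andbT.
  by apply: ereal_inf_lbound; exists n => //=.
- by rewrite -[X in _ --> X]h3 limn_einf_lim; exact: is_cvg_einfs.
- exact: cvg_cst.
Qed.

Lemma measurable_limn_einf d (T : measurableType d) (D : set T) (f : (T -> \bar R)^nat) :
  (forall n, measurable_fun D (f n)) -> measurable_fun D (fun x => limn_einf (f^~ x)).
Proof.
move=> mf; rewrite /limn_einf.
have -> : (fun x => - limn_esup (\- (f^~ x))) = (-%E \o (fun x => limn_esup ((fun n => \- (f n))^~ x))) by [].
apply: measurableT_comp; first exact: oppe_measurable.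
by apply: measurable_fun_limn_esup => n; apply: measurableT_comp; [exact: oppe_measurable|].
Qed.

(** Integrals of nonnegative functions are suprema over the simple functions
    below, hence monotone without any measurability. *)
Lemma ge0_le_integral_any d (T : measurableType d) (mu : {measure set T -> \bar R}) (D : set T)
    (f1 f2 : T -> \bar R) : (forall x, D x -> 0 <= f1 x) ->
  (forall x, D x -> f1 x <= f2 x) -> \int[mu]_(x in D) f1 x <= \int[mu]_(x in D) f2 x.
Proof.
move=> f10 f12; rewrite !ge0_integralE//; last first.
  by move=> x Dx; exact: le_trans (f10 x Dx) (f12 x Dx).
apply: ereal_sup_le => _ [h hf <-]; exists h => // x; apply: le_trans (hf x) _.
by rewrite /patch; case: ifPn => // /set_mem; exact: f12.
Qed.

(** The multiplicity is only known to coincide almost everywhere with a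
    measurable function; it is squeezed between two measurable functions that
    differ on a null set. *)
Lemma ge0_ae_eq_integral_any d (T : measurableType d) (mu : {measure set T -> \bar R}) (D : set T)
    (f g : T -> \bar R) : measurable D -> measurable_fun D g ->
  (forall x, D x -> 0 <= f x) -> (forall x, D x -> 0 <= g x) ->
  {ae mu, forall x, D x -> f x = g x} ->
  \int[mu]_(x in D) f x = \int[mu]_(x in D) g x.
Proof.
move=> mD mg f0 g0 [N [mN N0 NP]].
have NN x : ~ N x -> D x -> f x = g x by move=> Nx; apply: contrapT => h; apply: Nx; apply: NP.
have mI : measurable_fun D (fun x => (\1_N x : R)%:E).
  by apply/measurable_EFinP; apply: measurable_funTS; exact: measurable_indic.
have mI' : measurable_fun D (fun x => (\1_(~` N) x : R)%:E).
  by apply/measurable_EFinP; apply: measurable_funTS; apply: measurable_indic; exact: measurableC.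
pose lo x := g x * (\1_(~` N) x : R)%:E.
pose hi x := g x + +oo * (\1_N x : R)%:E.
have mlo : measurable_fun D lo by exact: emeasurable_funM.
have mhi : measurable_fun D hi.
  apply: emeasurable_funD => //; apply: emeasurable_funM => //; exact: measurable_cst.
have aelo : \int[mu]_(x in D) lo x = \int[mu]_(x in D) g x.
  apply: ae_eq_integral => //; exists N; split=> // x /= h; apply: contrapT => Nx; apply: h => Dx.
  by rewrite /lo indicE mem_set//= mule1.
have aehi : \int[mu]_(x in D) hi x = \int[mu]_(x in D) g x.
  apply: ae_eq_integral => //; exists N; split=> // x /= h; apply: contrapT => Nx; apply: h => Dx.
  by rewrite /hi indicE memNset//= mule0 adde0.
apply/eqP; rewrite eq_le -{1}aehi -aelo; apply/andP; split.
- apply: ge0_le_integral_any => // x Dx; rewrite /hi indicE.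
  have [Nx|Nx] := pselect (N x); last by rewrite memNset//= mule0 adde0 NN.
  rewrite mem_set//= mule1 addey ?leey//.
  by apply/eqP => gN; have := g0 x Dx; rewrite gN.
- apply: ge0_le_integral_any => x Dx; rewrite /lo indicE.
    by rewrite mule_ge0 ?g0// lee_fin.
  have [Nx|Nx] := pselect (N x); last by rewrite mem_set//= mule1 NN.
  by rewrite memNset ?mule0 ?f0//=; exact.
Qed.

End Limits.

(** * The representation of the net total curvature *)

Section Main.
Context {R : realType}.
Implicit Types (P Q G : graph R) (e : R3 R).
Variables (G : graph R) (D : forall P : graph R, double_param P).
Hypothesis hG : continuous_graph G.

Definition mu_chis (S : nat -> graph R) e : (\bar R)^nat := fun k => (mu_chi (S k) e)%:E.

Lemma mu_chi_le_einf (S : nat -> graph R) P e : fine_sequence G S -> approximating G P ->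
  regular_direction P e -> ((mu_chi P e)%:E <= limn_einf (mu_chis S e))%E.
Proof.
move=> fS [hP PG _ _] reg; have [K KP] := fine_dominates fS hP PG reg.
by apply: (@ge_limn_einf _ _ _ K) => k Kk; rewrite lee_fin KP.
Qed.

Lemma measurable_mus S : measurable_fun [set: R3 R] (fun e => limn_einf (mu_chis S e)).
Proof.
apply: (@measurable_limn_einf _ _ _ _ (fun k e => (mu_chi (S k) e)%:E)) => k.
by apply/measurable_EFinP; exact: measurable_mu_chi.
Qed.

Lemma mus_ge0 S e : (0 <= limn_einf (mu_chis S e))%E.
Proof. by apply: (@ge_limn_einf _ _ _ 0) => k _; rewrite lee_fin mu_chi_ge0. Qed.

Lemma NTC_poly_le P : approximating G P -> (NTC_poly P <= NTC G)%E.
Proof. by move=> aP; apply: ereal_sup_ubound; exists P. Qed.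

Let two_half (x : \bar R) : (2%:E * ((2^-1)%:E * x) = x)%E.
Proof. by rewrite muleA -EFinM mulfV ?pnatr_eq0// mul1e. Qed.

Let half_two (x : \bar R) : ((2^-1)%:E * (2%:E * x) = x)%E.
Proof. by rewrite muleA -EFinM mulVf ?pnatr_eq0// mul1e. Qed.

Section Sequence.
Variables (S : nat -> graph R).
Hypothesis fS : fine_sequence G S.

Let w k := (\int[sphere_area]_(e in S2) (mu_chi (S k) e)%:E)%E.

Let w_le k : (w k <= 2%:E * NTC G)%E.
Proof.
have := NTC_poly_le (fS k).1; rewrite NTC_poly_integral -/(w k) => h.
by rewrite -(two_half (w k)) lee_pmul2l// lte_fin.
Qed.

(** Domination by the terms of S, for almost all directions. *)
Let NTC_le : (NTC G <= (2^-1)%:E * \int[sphere_area]_(e in S2) limn_einf (mu_chis S e))%E.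
Proof.
apply: ge_ereal_sup => _ [P aP <-]; rewrite NTC_poly_integral lee_pmul2l ?lte_fin ?invr_gt0//.
apply: ae_ge0_le_integral.
- exact: measurable_S2.
- by move=> e _; rewrite lee_fin mu_chi_ge0.
- by apply/measurable_EFinP; apply: measurable_funTS; exact: measurable_mu_chi.
- by move=> e _; exact: mus_ge0.
- by apply: measurable_funTS; exact: measurable_mus.
have [hP PG nl _] := aP.
by apply: filterS (ae_regular hP nl) => e reg _; exact: mu_chi_le_einf.
Qed.

Let fatou_w : (\int[sphere_area]_(e in S2) limn_einf (mu_chis S e) <= limn_einf w)%E.
Proof.
apply: (@fatou _ _ _ sphere_area S2 measurable_S2 (fun k e => (mu_chi (S k) e)%:E)).
- by move=> k; apply/measurable_EFinP; apply: measurable_funTS; exact: measurable_mu_chi.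
- by move=> k e _; rewrite lee_fin mu_chi_ge0.
Qed.

(** Domination gives one inequality and Fatou's lemma the other, since no
    term of S exceeds NTC. *)
Lemma NTC_integral : NTC G = ((2^-1)%:E * \int[sphere_area]_(e in S2) limn_einf (mu_chis S e))%E.
Proof.
apply/eqP; rewrite eq_le NTC_le /= -[leRHS]half_two lee_pmul2l ?lte_fin ?invr_gt0//.
by apply: le_trans fatou_w _; exact: limn_einf_le.
Qed.

Lemma NTC_poly_cvg : NTC_poly (S k) @[k --> \oo] --> NTC G.
Proof.
have : ((2^-1)%:E * w k)%E @[k --> \oo] --> ((2^-1)%:E * (2%:E * NTC G))%E.
  apply: cvgeZl => //; apply: limn_einf_cvg; first exact: w_le.
  apply: le_trans fatou_w; rewrite -[leRHS]two_half lee_pmul2l ?lte_fin//.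
rewrite half_two => h; under eq_cvg do rewrite NTC_poly_integral.
exact: h.
Qed.

End Sequence.

(** The multiplicity of a polygonal graph is almost everywhere at least 1/2. *)
Lemma NTC_gt0 : (0 < NTC G)%E.
Proof.
have [S fS] := fine_sequence_exists hG.
have [aP _] := fS 0%N; have [hP PG nl _] := aP.
apply: lt_le_trans (NTC_poly_le aP); rewrite NTC_poly_integral mule_gt0 ?lte_fin ?invr_gt0//.
apply: (@lt_le_trans _ _ (\int[sphere_area]_(e in @S2 R) (2^-1)%:E)%E).
  by rewrite integral_cst ?mule_gt0 ?lte_fin ?invr_gt0 ?sphere_area_S2//; exact: measurable_S2.
apply: ae_ge0_le_integral.
- exact: measurable_S2.
- by move=> e _; rewrite lee_fin invr_ge0.
- exact: measurable_cst.
- by move=> e _; rewrite lee_fin mu_chi_ge0.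
- by apply/measurable_EFinP; apply: measurable_funTS; exact: measurable_mu_chi.
apply: filterS (ae_regular hP nl) => e reg _; rewrite lee_fin.
have [n n0 ->] := mu_chi_half hP reg.
by rewrite ler_peMl ?invr_ge0// ler1n.
Qed.

Lemma mu_sequence_fine e (P : nat -> graph R) : mu_sequence G e P -> fine_sequence G P.
Proof. by move=> [h _ _ m _] k; split; [case: (h k)|exact: m]. Qed.

(** Each of the two sequences dominates the other. *)
Lemma mus_cvg S T e : fine_sequence G S -> fine_sequence G T ->
  (forall k, regular_direction (S k) e) -> (forall k, regular_direction (T k) e) ->
  mu_chis T e k @[k --> \oo] --> limn_einf (mu_chis S e).
Proof.
move=> fS fT rS rT; apply: limn_einf_cvg => [k|].
  by apply: mu_chi_le_einf; [|case: (fT k)|].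
rewrite [leLHS]limn_einf_lim; apply: lime_le; first exact: is_cvg_einfs.
apply: nearW => n; apply: le_trans (mu_chi_le_einf fT (fS n).1 (rS n)).
by apply: ereal_inf_lbound; exists n => //=.
Qed.

Lemma is_mu_graph_mus S e : fine_sequence G S -> (forall k, regular_direction (S k) e) ->
  generic G e -> is_mu_graph D G e (limn_einf (mu_chis S e)).
Proof.
move=> fS rS gen; split.
  have [P [hP rP mP xP]] := refining_sequence hG gen; exists P.
  have fP : fine_sequence G P by move=> k; split; [case: (hP k)|exact: mP].
  by split=> //; exact: NTC_poly_cvg.
move=> T sT; have fT := mu_sequence_fine sT; have [hT _ _ _ _] := sT.
have rT k : regular_direction (T k) e by case: (hT k).
under eq_cvg do rewrite mu_polyE//.
exact: mus_cvg.
Qed.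

Lemma mu_graph_mus S e : fine_sequence G S -> (forall k, regular_direction (S k) e) ->
  generic G e -> mu_graph D G e = limn_einf (mu_chis S e).
Proof.
move=> fS rS gen; have mS := is_mu_graph_mus fS rS gen.
apply: xget_unique => // m [_ hm]; have [[P sP] hS] := mS.
exact: cvg_unique (hm P sP) (hS P sP).
Qed.

Lemma mu_graph_ge0 e : (0 <= mu_graph D G e)%E.
Proof.
rewrite /mu_graph; case: xgetP => // m _ [[P sP] hm].
have := hm P sP; move=> /cvg_lim <-//; apply: lime_ge.
  by apply/cvg_ex; exists m; exact: hm.
apply: nearW => k; rewrite lee_fin /mu_poly sumr_ge0// => v _.
by rewrite le_max lexx orbT.
Qed.

(** The multiplicities of the polygonal graphs are half-integers; when their
    limit is finite, they are eventually equal to it. *)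
Lemma mu_graph_value S e : fine_sequence G S -> (forall k, regular_direction (S k) e) ->
  generic G e ->
  (mu_graph D G e = +oo%E \/ exists2 n : nat, (0 < n)%N & mu_graph D G e = (n%:R / 2)%:E) /\
  (mu_graph D G e <> +oo%E -> finite_set (critical G e) /\
    mu_graph D G e = (\sum_(q \in critical G e) Num.max (nlm (D G) e q) 0)%:E).
Proof.
move=> fS rS gen; rewrite (mu_graph_mus fS rS gen).
set l := limn_einf _; have cl : mu_chis S e k @[k --> \oo] --> l by exact: mus_cvg.
have ub k : (mu_chis S e k <= l)%E by apply: mu_chi_le_einf; [|case: (fS k)|].
have [->|lfin] := eqVneq l +oo%E; first by split; [left|].
have [r lr] : exists r : R, l = r%:E.
  have := mus_ge0 S e; rewrite -/l; case: (l) lfin => [r|//|//] _ _; first by exists r.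
have bdd k : mu_chi (S k) e <= r by rewrite -lee_fin -lr; exact: ub.
have [fc [K KP]] := finite_value D hG gen fS rS bdd.
have lE : l = (\sum_(q \in critical G e) Num.max (nlm (D G) e q) 0)%:E.
  suff cE : mu_chis S e k @[k --> \oo] --> (\sum_(q \in critical G e) Num.max (nlm (D G) e q) 0)%:E.
    exact: cvg_unique cl cE.
  by apply: cvg_near_cst; exists K => // k /= Kk; rewrite /mu_chis KP.
split; last by move=> _.
right; have [hS _ _ _] := (fS K).1.
have [n n0 nE] := mu_chi_half hS (rS K).
by exists n => //; rewrite lE -nE KP.
Qed.

End Main.

Theorem theorem2 (R : realType) (G : graph R) (hG : continuous_graph G)
    (D : forall P : graph R, double_param P) :
  [/\ (0 < NTC G)%E,
      exists2 g : R3 R -> \bar R, measurable_fun S2 g &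
        {ae sphere_area, forall e, S2 e -> mu_graph D G e = g e},
      NTC G = ((2^-1)%:E * \int[sphere_area]_(e in S2) mu_graph D G e)%E
    & {ae sphere_area, forall e : R3 R, S2 e ->
        (mu_graph D G e = +oo%E \/
           exists2 n : nat, (0 < n)%N & mu_graph D G e = (n%:R / 2)%:E) /\
        (mu_graph D G e <> +oo%E ->
           finite_set (critical G e) /\
           mu_graph D G e = (\sum_(q \in critical G e)
                         Num.max (nlm (D G) e q) 0)%:E)}].
Proof.
have [S fS] := fine_sequence_exists hG.
have good : {ae sphere_area, forall e : R3 R,
    generic G e /\ forall k, regular_direction (S k) e}.
  apply: filterS2 (ae_generic hG) _ => [e|]; last first.
    apply: ae_foralln => k; have [[hP _ nl _] _] := fS k; exact: ae_regular hP nl.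
  by split.
have mS : measurable_fun S2 (fun e => limn_einf (mu_chis S e)).
  by apply: measurable_funTS; exact: measurable_mus.
have aeS : {ae sphere_area, forall e, S2 e -> mu_graph D G e = limn_einf (mu_chis S e)}.
  by apply: filterS good => e [gen reg] _; exact: mu_graph_mus.
split.
- exact: NTC_gt0.
- by exists (fun e => limn_einf (mu_chis S e)).
- rewrite (NTC_integral fS); congr (_ * _)%E; apply/esym.
  apply: ge0_ae_eq_integral_any => //; first exact: measurable_S2.
    by move=> e _; exact: mu_graph_ge0.
  by move=> e _; exact: mus_ge0.
- by apply: filterS good => e [gen reg] _; exact: mu_graph_value reg gen.
Qed.
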